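(* Let $N\ge 1$, let $Q$ be a real symmetric positive-definite $N\times N$ matrix, and let $B$ be a real $N\times N$ matrix all of whose eigenvalues have negative real parts. Let $\mathcal L=\mathcal L^{Q,B}$ be the associated Ornstein--Uhlenbeck operator on $L^2(\gamma_\infty)$, where $\gamma_\infty$ is its invariant Gaussian probability measure. If $B$ has only one eigenvalue, then any two generalized eigenfunctions of $\mathcal L$ with different eigenvalues are orthogonal in $L^2(\gamma_\infty)$; that is, if $u,v\in L^2(\gamma_\infty)$ are nonzero and $(\mathcal L-\mu)^k u=0$, $(\mathcal L-\nu)^m v=0$ for some $\mu\neq\nu$ in $\mathbb C$ and some positive integers $k,m$, then $\langle u,v\rangle_{L^2(\gamma_\infty)}=0$.
   Context: For $t\in(0,+\infty]$ put $Q_t=\int_0^t e^{sB}Qe^{sB^*}\,ds$ (symmetric and positive definite) and let $\gamma_t$ be the Gaussian probability measure $d\gamma_t(x)=(2\pi)^{-N/2}(\det Q_t)^{-1/2}e^{-\frac12\langle Q_t^{-1}x,x\rangle}\,dx$ on $\mathbb R^N$. The Ornstein--Uhlenbeck semigroup is $\mathcal H_t f(x)=\int f(e^{tB}x-y)\,d\gamma_t(y)$, $t>0$, defined for bounded continuous $f$ and extended to $L^2(\gamma_\infty)$ (complex-valued functions); $\gamma_\infty$ is its unique invariant probability measure. The Ornstein--Uhlenbeck operator $\mathcal L=\mathcal L^{Q,B}$ is the infinitesimal generator of $(\mathcal H_t)_{t>0}$ on $L^2(\gamma_\infty)$; on Schwartz functions it is given by $\mathcal L f(x)=\frac12\operatorname{tr}(Q\nabla^2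 f)(x)+\langle Bx,\nabla f(x)\rangle$, where $\nabla$ is the gradient and $\nabla^2$ the Hessian. A generalized eigenfunction of $\mathcal L$ with eigenvalue $\mu\in\mathbb C$ is a nonzero $u\in L^2(\gamma_\infty)$ (in the domain of the relevant power of $\mathcal L$) such that $(\mathcal L-\mu I)^k u=0$ for some positive integer $k$. *)

(* Defs.v *)
From HB Require Import structures.
From mathcomp Require Import all_boot all_order all_algebra complex.
From mathcomp Require Import all_classical all_reals all_analysis.
From mathcomp Require Import measurable_realfun.

Set Implicit Arguments.
Unset Strict Implicit.
Unset Printing Implicit Defensive.

Import Order.TTheory GRing.Theory Num.Theory.
Import numFieldTopology.Exports numFieldNormedType.Exports.

Local Open Scope classical_set_scope.
Local Open Scope ring_scope.

(* Column vectors carry the sigma-algebra generated by the coordinates; over  *)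
(* a real type this is the Borel sigma-algebra of the topology of 'cV[R]_n.   *)
Definition measure_cV_display : measure_display -> measure_display.
Proof. exact. Qed.

Section measurable_cV.
Context {d} {T : measurableType d}.
Variable n : nat.

Definition cV_coord (i : 'I_n) (x : 'cV[T]_n) : T := x i 0.

Let cV_set0 : g_sigma_preimage cV_coord set0.
Proof. exact: sigma_algebra0. Qed.

Let cV_setC A : g_sigma_preimage cV_coord A -> g_sigma_preimage cV_coord (~` A).
Proof. exact: sigma_algebraC. Qed.

Let cV_bigcup (F : _^nat) : (forall i, g_sigma_preimage cV_coord (F i)) ->
  g_sigma_preimage cV_coord (\bigcup_i (F i)).
Proof. exact: sigma_algebra_bigcup. Qed.

HB.instance Definition _ := @isMeasurable.Build (measure_cV_display d)
  ('cV[T]_n) (g_sigma_preimage cV_coord) cV_set0 cV_setC cV_bigcup.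

Lemma measurable_cV_coord (i : 'I_n) : measurable_fun setT (cV_coord i).
Proof.
move=> _ Y mY; rewrite setTI; apply: sub_sigma_algebra => /=.
rewrite -bigcup_seq/=; exists i => /=; first by rewrite mem_index_enum.
by exists Y => //; rewrite setTI.
Qed.

Lemma measurable_fun_cVP d1 (T1 : measurableType d1) (f : T1 -> 'cV[T]_n) :
  (forall i, measurable_fun setT (fun x => f x i 0)) -> measurable_fun setT f.
Proof.
move=> mf _ A mA; suff : g_sigma_preimage (fun i => cV_coord i \o f) `<=` measurable.
  by rewrite g_sigma_preimage_comp; apply; exists A.
apply: smallest_sub; first exact: sigma_algebra_measurable.
rewrite -bigcup_seq; apply: bigcup_sub => i _ B [C mC <-].
exact: mf.
Qed.

End measurable_cV.

Section lebesgue_cV_step.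
Context {R : realType}.

Definition cV_cons n (p : R * 'cV[R]_n) : 'cV[R]_n.+1 :=
  \col_i oapp (fun j => p.2 j 0) p.1 (unlift ord0 i).

Lemma measurable_cV_cons n : measurable_fun setT (@cV_cons n).
Proof.
apply: measurable_fun_cVP => i; under eq_fun do rewrite mxE.
case: unliftP => [j _|_] /=; last exact: measurable_fst.
exact: (measurableT_comp (measurable_cV_coord j) measurable_snd).
Qed.

Let cV_uncons n (x : 'cV[R]_n.+1) : R * 'cV[R]_n :=
  (x ord0 0, \col_i x (lift ord0 i) 0).

Let measurable_cV_uncons n : measurable_fun setT (@cV_uncons n).
Proof.
apply/measurable_fun_pairP; split; first exact: measurable_cV_coord.
apply: measurable_fun_cVP => i; under eq_fun do rewrite /= mxE.
exact: measurable_cV_coord.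
Qed.

Let cV_consK n : cancel (@cV_cons n) (@cV_uncons n).
Proof.
move=> [x v]; congr pair => /=; first by rewrite mxE unlift_none.
by apply/colP => i; rewrite !mxE liftK.
Qed.

Definition lebesgue_cVS n (m : {sigma_finite_measure set 'cV[R]_n -> \bar R}) :
    set 'cV[R]_n.+1 -> \bar R :=
  pushforward ((@lebesgue_measure R) \x m)%E (@cV_cons n).

Section lebesgue_cVS.
Variables (n : nat) (m : {sigma_finite_measure set 'cV[R]_n -> \bar R}).

Let lebesgue_cVS0 : lebesgue_cVS m set0 = 0%E.
Proof. by rewrite /lebesgue_cVS /pushforward preimage_set0 measure0. Qed.

Let lebesgue_cVS_ge0 A : (0 <= lebesgue_cVS m A)%E.
Proof. by rewrite /lebesgue_cVS /pushforward measure_ge0. Qed.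

Let lebesgue_cVS_sigma_additive : semi_sigma_additive (lebesgue_cVS m).
Proof.
exact: (@measure_semi_sigma_additive _ _ _
  (measure_function_pushforward__canonical__measure_function_Measure
    ((@lebesgue_measure R) \x m)%E (@measurable_cV_cons n))).
Qed.

HB.instance Definition _ := isMeasure.Build _ _ _ (lebesgue_cVS m)
  lebesgue_cVS0 lebesgue_cVS_ge0 lebesgue_cVS_sigma_additive.

Let lebesgue_cVS_sigma_finite : sigma_finite setT (lebesgue_cVS m).
Proof.
have /sigma_finiteP[F [TF ndF Foo]] := sigma_finiteT (@lebesgue_measure R).
have /sigma_finiteP[G [TG ndG Goo]] := sigma_finiteT m.
exists (fun k => @cV_uncons n @^-1` (F k `*` G k)).
  rewrite predeqE => x; split => // _.
  have [i _ Fi] : (\bigcup_k F k) (x ord0 0) by rewrite -TF.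
  have [j _ Gj] : (\bigcup_k G k) (\col_i x (lift ord0 i) 0) by rewrite -TG.
  exists (maxn i j) => //; split => /=.
    by move: Fi; exact/subsetPset/ndF/leq_maxl.
  by move: Gj; exact/subsetPset/ndG/leq_maxr.
move=> k; have [mFk Fkoo] := Foo k; have [mGk Gkoo] := Goo k.
have mFGk : measurable (F k `*` G k) by exact: measurableX.
split; first by rewrite -[X in measurable X]setTI; exact: measurable_cV_uncons.
rewrite /lebesgue_cVS /pushforward -comp_preimage (_ : _ \o _ = id).
  by rewrite preimage_id product_measure1E// lte_mul_pinfty// ge0_fin_numE.
by apply/funext => p /=; rewrite cV_consK.
Qed.

HB.instance Definition _ := @Measure_isSigmaFinite.Build _ _ _
  (lebesgue_cVS m) lebesgue_cVS_sigma_finite.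
End lebesgue_cVS.

End lebesgue_cV_step.

(* n-fold product of lebesgue_measure, i.e. Lebesgue measure on R^n. *)
Fixpoint lebesgue_cV (R : realType) n :
    {sigma_finite_measure set 'cV[R]_n -> \bar R} :=
  match n with
  | 0 => [the {sigma_finite_measure set 'cV[R]_0 -> \bar R} of \d_(0 : 'cV[R]_0)]
  | n'.+1 => [the {sigma_finite_measure set 'cV[R]_n'.+1 -> \bar R}
               of lebesgue_cVS (lebesgue_cV R n')]
  end.

Section gaussian.
Context {R : realType} {n : nat}.
Implicit Types (S : 'M[R]_n) (x : 'cV[R]_n).

Definition quad_form S x : R := (x^T *m S *m x) 0 0.

Definition gaussian_pdf S x : R :=
  (2 * pi) `^ (- (n%:R / 2)) * (\det S) `^ (- 2^-1) *
  expR (- 2^-1 * quad_form (invmx S) x).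

Lemma gaussian_pdf_ge0 S x : 0 <= gaussian_pdf S x.
Proof. by rewrite /gaussian_pdf !mulr_ge0 ?powR_ge0 ?expR_ge0. Qed.

Lemma measurable_gaussian_pdf S : measurable_fun setT (gaussian_pdf S).
Proof.
apply: measurable_funM => //; apply: measurableT_comp => //.
apply: measurable_funM => //.
under [X in measurable_fun _ X]eq_fun => x.
  rewrite /quad_form mxE; under eq_bigr => i _ do rewrite mxE.
  over.
apply: measurable_sum => i; apply: measurable_funM; last first.
  exact: measurable_cV_coord.
apply: measurable_sum => j; apply: measurable_funM => //.
by under eq_fun do rewrite mxE; exact: measurable_cV_coord.
Qed.

Definition gaussian S : set 'cV[R]_n -> \bar R :=
  fun A => (\int[lebesgue_cV R n]_(x in A) (gaussian_pdf S x)%:E)%E.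

Let gaussian0 S : gaussian S set0 = 0%E.
Proof. by rewrite /gaussian integral_set0. Qed.

Let gaussian_ge0 S A : (0 <= gaussian S A)%E.
Proof. by apply: integral_ge0 => x _; rewrite lee_fin gaussian_pdf_ge0. Qed.

Let gaussian_sigma_additive S : semi_sigma_additive (gaussian S).
Proof.
move=> F mF tF mUF; rewrite /gaussian ge0_integral_bigcup//.
- apply: is_cvg_ereal_nneg_natsum_cond => k _ _.
  by apply: integral_ge0 => x _; rewrite lee_fin gaussian_pdf_ge0.
- by apply/measurable_EFinP; apply: measurable_funTS; exact: measurable_gaussian_pdf.
- by move=> x _; rewrite lee_fin gaussian_pdf_ge0.
Qed.

HB.instance Definition _ S := isMeasure.Build _ _ _ (gaussian S)
  (gaussian0 S) (gaussian_ge0 S) (@gaussian_sigma_additive S).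

End gaussian.

Section complex_L2.
Context {d : measure_display} {T : measurableType d} {R : realType}.
Variable mu : {measure set T -> \bar R}.
Implicit Types f g : T -> R[i].

Definition cintegral f : R[i] :=
  Complex (\int[mu]_x complex.Re (f x)) (\int[mu]_x complex.Im (f x)).

(* Elements of L^2(mu) are handled through representatives: operators on      *)
(* L^2(mu) are given below by their graphs, which are stable under a.e.       *)
(* equality.                                                                  *)
Definition L2 f : Prop :=
  (fun x => complex.Re (f x)) \in Lfun mu 2%:E /\ (fun x => complex.Im (f x)) \in Lfun mu 2%:E.

Definition L2norm f : \bar R := Lnorm mu 2%:E (fun x => (Normc.normc (f x))%:E).

Definition L2dot f g : R[i] := cintegral (fun x => f x * conjc (g x)).

End complex_L2.

Section ornstein_uhlenbeck.
Context {R : realType} {N : nat}.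
Variables Q B : 'M[R]_N.
Implicit Types (f g u v w : 'cV[R]_N -> R[i]) (mu : R[i]).

Definition mexp (A : 'M[R]_N) : 'M[R]_N :=
  limn (series (fun k => (k`!%:R)^-1 *: A ^+ k)).

Definition OU_cov (t : \bar R) : 'M[R]_N := \matrix_(i, j)
  \int[lebesgue_measure]_(s in [set s : R | (0 <= s%:E <= t)%E])
    (mexp (s *: B) *m Q *m mexp (s *: B^T)) i j.

Definition OU_gauss (t : \bar R) : {measure set 'cV[R]_N -> \bar R} :=
  [the measure _ _ of gaussian (OU_cov t)].

Definition bounded_continuous f : Prop :=
  [/\ exists M : R, forall x, Normc.normc (f x) <= M,
      continuous ((fun x => complex.Re (f x))) & continuous ((fun x => complex.Im (f x)))].

Definition OU_sg (t : R) f : 'cV[R]_N -> R[i] :=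
  fun x => cintegral (OU_gauss t%:E) (fun y => f (mexp (t *: B) *m x - y)).

Local Notation gamma := (OU_gauss +oo).

(* Graph of the extension of OU_sg t from the bounded continuous functions to *)
(* L^2(gamma) by density.                                                     *)
Definition OU_sgL2 (t : R) u v : Prop :=
  [/\ L2 gamma u, L2 gamma v &
    exists f : nat -> 'cV[R]_N -> R[i],
      [/\ forall n, bounded_continuous (f n),
          L2norm gamma (fun x => f n x - u x) @[n --> \oo] --> 0%E &
          L2norm gamma (fun x => OU_sg t (f n) x - v x) @[n --> \oo] --> 0%E]].

(* Graph of the infinitesimal generator: u is in the domain and L u = w.      *)
Definition OU_op u w : Prop :=
  [/\ L2 gamma u, L2 gamma w &
    exists h : R -> 'cV[R]_N -> R[i],
      (forall t, 0 < t -> OU_sgL2 t u (h t)) /\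
      L2norm gamma (fun x => (t^-1)%:C%C * (h t x - u x) - w x) @[t --> 0^'+]
        --> 0%E].

(* Graph of (L - mu I)^k. *)
Fixpoint OU_shift_pow mu (k : nat) u w : Prop :=
  match k with
  | 0 => [/\ L2 gamma u, L2 gamma w & {ae gamma, forall x, u x = w x}]
  | k'.+1 => exists2 v, OU_op u v & OU_shift_pow mu k' (fun x => v x - mu * u x) w
  end.

Definition OU_gen_eigenfun mu u : Prop :=
  [/\ L2 gamma u, ~ {ae gamma, forall x, u x = 0} &
    exists2 k, (0 < k)%N & OU_shift_pow mu k u (fun=> 0)].

End ornstein_uhlenbeck.

Definition sym_posdef {R : realType} {N : nat} (Q : 'M[R]_N) : Prop :=
  Q^T = Q /\ forall x : 'cV[R]_N, x != 0 -> 0 < quad_form Q x.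

Definition ceigenvalue {R : realType} {N : nat} (B : 'M[R]_N) : pred R[i] :=
  eigenvalue (map_mx (fun b : R => b%:C%C) B).

(* Main.v *)
From HB Require Import structures.
Require Import Defs.
From mathcomp Require Import all_boot all_order all_algebra complex.
From mathcomp Require Import all_classical all_reals all_analysis.
From mathcomp Require Import measurable_realfun.
From mathcomp Require Import ring lra.

(** Let [gamma] be the invariant measure, a centred Gaussian of covariance [S].
    The idea is that, when [B] has a single eigenvalue, each generalized
    eigenspace of the generator is contained in a Wiener chaos of [gamma], and
    chaoses of different degrees are orthogonal.

    Two properties of [gamma] are used.  First, [S] is positive definite and
    satisfies [S = S_t + E_t S E_t^T] with [E_t = exp (t B)]
    ([OU_cov_posdef], [OU_cov_invariant]).  Secondly, the Laplace transform of
    a Gaussian is known ([gaussian_mgf]).  Everything else is read off the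
    normalised Laplace transform
    [phi u eta = exp (- q eta / 2) * \int u x * exp <eta, x> d gamma], where
    [q eta = <S eta, eta>].  The coefficient [hcoeff u eta j] of [s ^ j] in
    [phi u (s eta)] is the pairing of [u] with the Hermite polynomial of degree
    [j] in the direction [eta]; the functions all of whose coefficients of
    degree [j != d] vanish form the chaos of degree [d].

    Complex functions are split into real and imaginary parts, since the
    semigroup is real.  It acts on [phi] by the linear substitution
    [eta |-> S^-1 E_t S eta] ([phi_mehler_op], [phi_OU_sgL2]).  By the
    Cayley-Hamilton theorem the single eigenvalue [lam] of [B] is real and
    [B - lam] is nilpotent, so [E_t = exp (lam t) P_t] with [P_t] polynomial in
    [t].  Along the curves [t |-> S^-1 P_t S eta] the coefficient of degree [j]
    of [u] is therefore a polynomial [p], on which the generator acts as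
    [p |-> j lam p + p^`()] ([hcoeff_poly_OU_op]).  If [(L - mu)^k u = 0] and
    [j lam != mu], some power of the operator [p |-> (j lam - mu) p + p^`()]
    kills [p]; this operator is injective, as differentiation lowers the
    degree, so [p = 0] ([hcoeff_eigen]).  Hence [u] lies in the chaos of degree
    [d] with [d lam = mu], and vanishes if there is no such [d].

    Orthogonality of two chaoses of degrees [d != e] ([chaos_orthogonal])
    follows from Mehler's formula.  Let [X], [Y] be independent of law [gamma]
    and [Z = r X + s Y] with [r ^ 2 + s ^ 2 = 1].  The conditional expectation
    of [u Z] given [X] is [r ^ d * u X] when [u] is in the chaos of degree
    [d], because both sides have the same Laplace transform.  As [(X, Z)] and
    [(Z, X)] have the same law, computing the expectation of [u Z * v X] in
    two ways gives [r ^ d * \int u v = r ^ e * \int u v].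

    Both the conditional expectation and the action of the semigroup are
    handled by a uniqueness theorem ([moment_agree], [mgf_agree]): two signed
    weights with all exponential moments and with the same moments, or the
    same Laplace transform, have the same integral against every function. *)

Set Implicit Arguments.
Unset Strict Implicit.
Unset Printing Implicit Defensive.

Import Order.TTheory GRing.Theory Num.Theory.
Import numFieldTopology.Exports numFieldNormedType.Exports.

Local Open Scope classical_set_scope.
Local Open Scope ring_scope.

(** * Integrable real functions *)

Notation integ m f := (m.-integrable setT (EFin \o f)).

Section integ.
Context {d} {T : measurableType d} {R : realType}.
Variable m : {measure set T -> \bar R}.
Implicit Types f g : T -> R.

Lemma integ_meas f : integ m f -> measurable_fun setT f.
Proof. by move=> /measurable_int/measurable_EFinP. Qed.

Lemma integ_le g f : measurable_fun setT f -> integ m g ->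
  (forall x, `|f x| <= g x) -> integ m f.
Proof.
move=> mf ig fg; apply: le_integrable ig => //; first exact/measurable_EFinP.
move=> x _ /=; rewrite lee_fin; apply: le_trans (fg x) _; exact: ler_norm.
Qed.

Lemma integD f g : integ m f -> integ m g -> integ m (fun x => f x + g x).
Proof. by move=> f1 g1; apply: (integrableD measurableT f1 g1). Qed.

Lemma integZ k f : integ m f -> integ m (fun x => k * f x).
Proof. by move=> f1; apply: (integrableZl measurableT k f1). Qed.

Lemma integB f g : integ m f -> integ m g -> integ m (fun x => f x - g x).
Proof. by move=> f1 g1; apply: (integrableB measurableT f1 g1). Qed.

Lemma integ_norm f : integ m f -> integ m (fun x => `|f x|).
Proof. by move=> f1; apply: (integrable_abse f1). Qed.

Lemma Rintegral_dct (f_ : nat -> T -> R) f g :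
  (forall n, measurable_fun setT (f_ n)) ->
  (forall x, f_ ^~ x @ \oo --> f x) -> integ m g ->
  (forall n x, `|f_ n x| <= g x) ->
  (fun n => \int[m]_x f_ n x) @ \oo --> \int[m]_x f x.
Proof.
move=> mf_ cf ig fg.
have mf : measurable_fun setT f.
  by apply: (@measurable_fun_cvg _ _ _ _ f_) => // x _; exact: cf.
have [|||||i1 _ i3] := @dominated_convergence _ T R m setT measurableT
  (fun n x => (f_ n x)%:E) (EFin \o f) (EFin \o g).
- by move=> n; exact/measurable_EFinP.
- exact/measurable_EFinP.
- by apply: aeW => x _; exact: cvg_EFin (nearW _ _) (cf x).
- by [].
- by apply: aeW => x n _; rewrite /= lee_fin.
apply: fine_cvg; rewrite /Rintegral fineK//; exact: integrable_fin_num.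
Qed.
End integ.

Section Rsum.
Context {d} {T : measurableType d} {R : realType}.
Variables (m : {measure set T -> \bar R}) (D : set T).
Hypothesis mD : measurable D.

Lemma Rintegral_sum (I : Type) (r : seq I) (f : I -> T -> R) :
  (forall i, m.-integrable D (EFin \o f i)) ->
  m.-integrable D (fun x => (\sum_(i <- r) f i x)%:E) /\
  \int[m]_(x in D) (\sum_(i <- r) f i x) = \sum_(i <- r) \int[m]_(x in D) f i x.
Proof.
move=> fi; elim: r => [|i r [IH1 IH2]].
  split; first by under eq_fun do rewrite big_nil; exact: integrable0.
  rewrite big_nil; under eq_Rintegral do rewrite big_nil.
  by rewrite Rintegral_cst// mul0r.
split.
  under eq_fun do rewrite big_cons EFinD; apply: integrableD => //; exact: fi.
under eq_Rintegral do rewrite big_cons.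
by rewrite RintegralD// ?IH2 ?big_cons//; exact: fi.
Qed.
End Rsum.

(** * Dot products and elementary bounds on the exponential *)

Section dot.
Context {R : realType} {n : nat}.
Implicit Types x y : 'cV[R]_n.

Definition dotv x y : R := (x^T *m y) 0 0.

Lemma dotvE x y : dotv x y = \sum_i x i 0 * y i 0.
Proof. by rewrite /dotv mxE; apply: eq_bigr => i _; rewrite mxE. Qed.

Lemma dotvC x y : dotv x y = dotv y x.
Proof. by rewrite !dotvE; apply: eq_bigr => i _; rewrite mulrC. Qed.

Lemma dotvDl x y z : dotv (x + y) z = dotv x z + dotv y z.
Proof. by rewrite /dotv linearD mulmxDl mxE. Qed.

Lemma dotvNl x y : dotv (- x) y = - dotv x y.
Proof. by rewrite /dotv linearN mulNmx mxE. Qed.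

Lemma dotvZl k x y : dotv (k *: x) y = k * dotv x y.
Proof. by rewrite /dotv linearZ -scalemxAl mxE. Qed.

Lemma dotvDr x y z : dotv z (x + y) = dotv z x + dotv z y.
Proof. by rewrite dotvC dotvDl !(dotvC z). Qed.

Lemma dotvNr x y : dotv x (- y) = - dotv x y.
Proof. by rewrite dotvC dotvNl dotvC. Qed.

Lemma dotvZr k x y : dotv x (k *: y) = k * dotv x y.
Proof. by rewrite dotvC dotvZl dotvC. Qed.

Lemma dot0v x : dotv 0 x = 0.
Proof. by rewrite /dotv trmx0 mul0mx mxE. Qed.

Lemma dotv0 x : dotv x 0 = 0.
Proof. by rewrite dotvC dot0v. Qed.

Lemma dotv_delta i x : dotv (delta_mx i 0) x = x i 0.
Proof.
rewrite dotvE (bigD1 i)//= big1 ?addr0 ?mxE ?eqxx ?mul1r// => j ji.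
by rewrite mxE (negbTE ji) mul0r.
Qed.

Lemma measurable_dotv x : measurable_fun setT (dotv x).
Proof.
rewrite (_ : dotv x = fun y => \sum_i x i 0 * y i 0); last by apply/funext => y; rewrite dotvE.
apply: measurable_sum => i; apply: measurable_funM => //.
exact: measurable_cV_coord.
Qed.
End dot.

Lemma dotv_mulmxr {R : realType} {n p : nat} (A : 'M[R]_(n, p)) (x : 'cV[R]_n) (y : 'cV[R]_p) :
  dotv x (A *m y) = dotv (A^T *m x) y.
Proof. by rewrite /dotv trmx_mul trmxK mulmxA. Qed.

Lemma cvg_expR (R : realType) (T : Type) (F : set_system T) (FF : Filter F) (f : T -> R) (a : R) :
  f @ F --> a -> expR (f x) @[x --> F] --> expR a.
Proof. by move=> fa; apply: (cvg_comp f expR fa); exact: continuous_expR. Qed.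

Lemma expRabs_le (R : realType) (y : R) : expR `|y| <= expR y + expR (- y).
Proof.
have [y0|y0] := leP 0 y; first by rewrite ger0_norm// lerDl expR_ge0.
by rewrite ltr0_norm// lerDr expR_ge0.
Qed.

Lemma series_exp_le (R : realType) (y : R) n : 0 <= y -> series (exp_coeff y) n <= expR y.
Proof.
move=> y0; apply: (nondecreasing_cvgn_le _ (is_cvg_series_exp_coeff y)).
by apply: nondecreasing_series => k _ _; exact: exp_coeff_ge0.
Qed.

Lemma expR_pow_le (R : realType) (y : R) k : 0 <= y -> y ^+ k <= k`!%:R * expR y.
Proof.
move=> y0; have := series_exp_le k.+1 y0.
rewrite seriesEord/= big_ord_recr/= => h.
rewrite mulrC -ler_pdivrMr ?ltr0n ?fact_gt0//; apply: le_trans h.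
by rewrite lerDr sumr_ge0// => i _; exact: exp_coeff_ge0.
Qed.

(** * Exponentially integrable weights *)

Definition expint {d} {T : measurableType d} {R : realType} {n : nat}
   (m : {measure set T -> \bar R}) (a : T -> 'cV[R]_n) (w : T -> R) :=
  forall xi, integ m (fun x => w x * expR (dotv xi (a x))).

Section expint.
Context {d} {T : measurableType d} {R : realType} {n : nat}.
Variable m : {measure set T -> \bar R}.
Variable a : T -> 'cV[R]_n.
Hypothesis ma : measurable_fun setT a.
Implicit Types (w : T -> R) (xi : 'cV[R]_n).

Lemma expint_integ w : expint m a w -> integ m w.
Proof.
move=> /(_ 0); congr (integrable m setT _); apply/funext => x /=.
by rewrite dot0v expR0 mulr1.
Qed.

Lemma expint_meas w : expint m a w -> measurable_fun setT w.
Proof. by move=> /expint_integ /integ_meas. Qed.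

Lemma meas_dot xi : measurable_fun setT (fun x => dotv xi (a x)).
Proof. exact: (measurableT_comp (measurable_dotv xi) ma). Qed.

Lemma expint_abs w xi : expint m a w ->
  integ m (fun x => `|w x| * expR `|dotv xi (a x)|).
Proof.
move=> wi; apply: (@integ_le _ _ _ _ (fun x => `|w x * expR (dotv xi (a x))| + `|w x * expR (dotv (- xi) (a x))|)).
- apply: measurable_funM; first by apply: measurableT_comp => //; exact: expint_meas.
  by apply: measurableT_comp => //; apply: measurableT_comp => //; exact: meas_dot.
- by apply: integD; exact: integ_norm.
- move=> x; rewrite !normrM normr_id !(ger0_norm (expR_ge0 _)) -mulrDr dotvNl.
  by rewrite ler_wpM2l// expRabs_le.
Qed.

Lemma expintM_dot w xi : expint m a w -> expint m a (fun x => w x * dotv xi (a x)).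
Proof.
move=> wi eta.
apply: (@integ_le _ _ _ _ (fun x => `|w x * expR (dotv (eta + xi) (a x))| + `|w x * expR (dotv (eta - xi) (a x))|)).
- apply: measurable_funM; last by apply: measurableT_comp => //; exact: meas_dot.
  by apply: measurable_funM; [exact: expint_meas|exact: meas_dot].
- by apply: integD; exact: integ_norm.
- move=> x; rewrite !normrM !(ger0_norm (expR_ge0 _)) -mulrDr -mulrA ler_wpM2l//.
  rewrite !dotvDl !expRD -mulrDr mulrC ler_wpM2l ?expR_ge0// dotvNl.
  apply: le_trans (expRabs_le _).
  by have := @expR_pow_le R _ 1 (normr_ge0 (dotv xi (a x))); rewrite mul1r expr1.
Qed.

Lemma expintM_dotX w xi k : expint m a w -> expint m a (fun x => w x * dotv xi (a x) ^+ k).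
Proof.
move=> wi; elim: k => [|k IH]; first by under eq_fun do rewrite expr0 mulr1.
by under eq_fun do rewrite exprSr mulrA; exact: expintM_dot.
Qed.
End expint.

(** * Measures with equal moments *)

Section moments.
Context {d1 d2} {T1 : measurableType d1} {T2 : measurableType d2} {R : realType} {n : nat}.
Variables (m1 : {measure set T1 -> \bar R}) (m2 : {measure set T2 -> \bar R}).
Variables (a1 : T1 -> 'cV[R]_n) (a2 : T2 -> 'cV[R]_n) (w1 : T1 -> R) (w2 : T2 -> R).
Hypotheses (ma1 : measurable_fun setT a1) (ma2 : measurable_fun setT a2).
Hypotheses (ew1 : expint m1 a1 w1) (ew2 : expint m2 a2 w2).
Hypothesis mom : forall xi k, \int[m1]_x (w1 x * dotv xi (a1 x) ^+ k) =
  \int[m2]_x (w2 x * dotv xi (a2 x) ^+ k).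

Definition agree (g : 'cV[R]_n -> R) :=
  \int[m1]_x (w1 x * g (a1 x)) = \int[m2]_x (w2 x * g (a2 x)).

(** The absolute value of every partial sum is dominated by [exp |<xi, x>|],
    which is integrable against the weights, so that equality of the moments
    passes to entire functions of exponential type at most one. *)
Lemma agree_series (c : nat -> R) (f : R -> R) xi :
  (forall k, `|c k| <= (k`!%:R)^-1) ->
  (forall y, (fun N => \sum_(k < N) c k * y ^+ k) @ \oo --> f y) ->
  agree (fun x => f (dotv xi x)).
Proof.
move=> c1 cf.
have H d (T : measurableType d) (m : {measure set T -> \bar R}) (a : T -> 'cV[R]_n) w
   (ma : measurable_fun setT a) (ew : expint m a w) :
  (fun N => \sum_(k < N) c k * \int[m]_x (w x * dotv xi (a x) ^+ k)) @ \oo -->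
   \int[m]_x (w x * f (dotv xi (a x))).
  have E N : integ m (fun x => w x * \sum_(k < N) c k * dotv xi (a x) ^+ k) /\ \int[m]_x (w x * \sum_(k < N) c k * dotv xi (a x) ^+ k) = \sum_(k < N) c k * \int[m]_x (w x * dotv xi (a x) ^+ k).
    have -> : (fun x => w x * \sum_(k < N) c k * dotv xi (a x) ^+ k) = (fun x => \sum_(k < N) c k * (w x * dotv xi (a x) ^+ k)).
      by apply/funext => x; rewrite mulr_sumr; apply: eq_bigr => k _; rewrite mulrCA.
    have ik k : integ m (fun x => w x * dotv xi (a x) ^+ k) by apply: expint_integ; apply: expintM_dotX.
    have [i1 i2] := @Rintegral_sum _ _ _ m setT measurableT _ (index_enum 'I_N)
      (fun k x => c k * (w x * dotv xi (a x) ^+ k)) (fun k => integZ _ (ik k)).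
    by split => //; rewrite i2; apply: eq_bigr => k _; rewrite RintegralZl.
  under eq_fun do rewrite -(E _).2.
  apply: (Rintegral_dct _ _ (expint_abs ma xi ew)).
  - by move=> N; exact: integ_meas (E N).1.
  - by move=> x; apply: cvgMr; exact: cf.
  - move=> N x; rewrite normrM ler_wpM2l//.
    apply: le_trans (ler_norm_sum _ _ _) _.
    apply: le_trans (series_exp_le N (normr_ge0 _)).
    rewrite seriesEord/=; apply: ler_sum => k _.
    by rewrite normrM normrX /exp_coeff/= mulrC ler_wpM2l// exprn_ge0.
have h1 := H _ _ _ _ _ ma1 ew1; have h2 := H _ _ _ _ _ ma2 ew2.
rewrite /agree -(cvg_lim _ h1)// -(cvg_lim _ h2)//.
by congr (limn _); apply/funext => N; apply: eq_bigr => k _; rewrite mom.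
Qed.

Lemma agree_cos xi : agree (fun x => cos (dotv xi x)).
Proof.
apply: (@agree_series (fun k => (~~ odd k)%:R * (-1) ^+ k./2 / k`!%:R)).
  move=> k; rewrite !normrM normrX normrN1 expr1n mulr1 normrV ?unitfE ?pnatr_eq0 -?lt0n ?fact_gt0//.
  by rewrite !normr_nat ler_piMl// ?invr_ge0//; case: (~~ odd k).
move=> y.
have -> : (fun N => \sum_(k < N) (~~ odd k)%:R * (-1) ^+ k./2 / k`!%:R * y ^+ k) = series (cos_coeff y).
  apply/funext => N; rewrite seriesEord/=; apply: eq_bigr => k _.
  by rewrite /cos_coeff/= mulrAC.
rewrite unlock; exact: is_cvg_series_cos_coeff.
Qed.

Lemma agree_sin xi : agree (fun x => sin (dotv xi x)).
Proof.
apply: (@agree_series (fun k => (odd k)%:R * (-1) ^+ k.-1./2 / k`!%:R)).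
  move=> k; rewrite !normrM normrX normrN1 expr1n mulr1 normrV ?unitfE ?pnatr_eq0 -?lt0n ?fact_gt0//.
  by rewrite !normr_nat ler_piMl// ?invr_ge0//; case: (odd k).
move=> y.
have -> : (fun N => \sum_(k < N) (odd k)%:R * (-1) ^+ k.-1./2 / k`!%:R * y ^+ k) = series (sin_coeff y).
  apply/funext => N; rewrite seriesEord/=; apply: eq_bigr => k _.
  by rewrite /sin_coeff/= mulrAC.
rewrite unlock; exact: is_cvg_series_sin_coeff.
Qed.

Definition bddmeas (g : 'cV[R]_n -> R) :=
  measurable_fun setT g /\ exists M, forall x, `|g x| <= M.

(** [trigood g] says that the two weights multiplied by [g] have the same
    Fourier transform.  The functions satisfying [agree] are not closed under
    products, but the multipliers [h] that preserve [trigood] form an algebra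
    closed under bounded pointwise limits: this is what a functional monotone
    class argument needs. *)
Definition trigood g := [/\ bddmeas g,
  (forall xi, agree (fun x => g x * cos (dotv xi x))) &
  (forall xi, agree (fun x => g x * sin (dotv xi x)))].

Definition trigmult h := bddmeas h /\ forall g, trigood g -> trigood (fun x => g x * h x).

Lemma bddmeasM g h : bddmeas g -> bddmeas h -> bddmeas (fun x => g x * h x).
Proof.
move=> [mg [M gM]] [mh [M' hM]]; split; first exact: measurable_funM.
by exists (M * M') => x; rewrite normrM ler_pM.
Qed.

Lemma bddmeasD g h : bddmeas g -> bddmeas h -> bddmeas (fun x => g x + h x).
Proof.
move=> [mg [M gM]] [mh [M' hM]]; split; first exact: measurable_funD.
by exists (M + M') => x; rewrite (le_trans (ler_normD _ _))// lerD.
Qed.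

Lemma bddmeas_cst k : bddmeas (fun=> k).
Proof. by split; [exact: measurable_cst|exists `|k|]. Qed.

Lemma bddmeas_cos xi : bddmeas (fun x => cos (dotv xi x)).
Proof.
split; last by exists 1 => x; rewrite ler_norml cos_geN1 cos_le1.
apply: measurableT_comp; last exact: measurable_dotv.
by apply: continuous_measurable_fun; exact: continuous_cos.
Qed.

Lemma bddmeas_sin xi : bddmeas (fun x => sin (dotv xi x)).
Proof.
split; last by exists 1 => x; rewrite ler_norml sin_geN1 sin_le1.
apply: measurableT_comp; last exact: measurable_dotv.
by apply: continuous_measurable_fun; exact: continuous_sin.
Qed.

Lemma integ_bdd d (T : measurableType d) (m : {measure set T -> \bar R})
   (a : T -> 'cV[R]_n) w g : measurable_fun setT a -> expint m a w ->
   bddmeas g -> integ m (fun x => w x * g (a x)).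
Proof.
move=> ma ew [mg [M gM]].
have M0 : 0 <= M by apply: le_trans (gM 0).
apply: (@integ_le _ _ _ _ (fun x => M * `|w x|)).
- by apply: measurable_funM; [exact: expint_meas ew|exact: measurableT_comp].
- by apply: integZ; apply: integ_norm; exact: expint_integ ew.
- by move=> x; rewrite normrM mulrC ler_wpM2r.
Qed.

Lemma agreeD g h : bddmeas g -> bddmeas h -> agree g -> agree h ->
  agree (fun x => g x + h x).
Proof.
move=> bg bh ag ah; rewrite /agree.
under eq_Rintegral do rewrite mulrDr.
under [RHS]eq_Rintegral do rewrite mulrDr.
by rewrite !RintegralD//; try exact: integ_bdd; rewrite ag ah.
Qed.

Lemma agreeZ k g : bddmeas g -> agree g -> agree (fun x => k * g x).
Proof.
move=> bg ag; rewrite /agree.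
under eq_Rintegral do rewrite mulrCA.
under [RHS]eq_Rintegral do rewrite mulrCA.
by rewrite !RintegralZl//; try exact: integ_bdd; rewrite ag.
Qed.

Lemma agree_lim (g_ : nat -> 'cV[R]_n -> R) (g : 'cV[R]_n -> R) (M : R) : (forall k, measurable_fun setT (g_ k)) ->
  (forall k x, `|g_ k x| <= M) -> (forall x, g_ ^~ x @ \oo --> g x) ->
  (forall k, agree (g_ k)) -> agree g.
Proof.
move=> mg gM cg ag.
have H d (T : measurableType d) (m : {measure set T -> \bar R}) (a : T -> 'cV[R]_n) w
   (ma : measurable_fun setT a) (ew : expint m a w) :
  (fun N => \int[m]_x (w x * g_ N (a x))) @ \oo --> \int[m]_x (w x * g (a x)).
  apply: (@Rintegral_dct _ _ _ _ _ _ (fun x => M * `|w x|)).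
  - by move=> N; apply: measurable_funM; [exact: expint_meas ew|exact: measurableT_comp].
  - by move=> x; apply: cvgMr; exact: cg.
  - by apply: integZ; apply: integ_norm; exact: expint_integ ew.
  - by move=> N x; rewrite normrM mulrC ler_wpM2r.
have h1 := H _ _ _ _ _ ma1 ew1; have h2 := H _ _ _ _ _ ma2 ew2.
rewrite /agree -(cvg_lim _ h1)// -(cvg_lim _ h2)//.
by congr (limn _); apply/funext => N; exact: ag.
Qed.

Lemma bddmeas_lim (g_ : nat -> 'cV[R]_n -> R) (g : 'cV[R]_n -> R) (M : R) : (forall k, measurable_fun setT (g_ k)) ->
  (forall k x, `|g_ k x| <= M) -> (forall x, g_ ^~ x @ \oo --> g x) -> bddmeas g.
Proof.
move=> mg gM cg; split.
  by apply: (@measurable_fun_cvg _ _ _ _ g_) => // x _; exact: cg.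
exists M => x; have cn : (fun k => `|g_ k x|) @ \oo --> `|g x| by apply: cvg_norm; exact: cg.
rewrite -(cvg_lim _ cn)//.
apply: limr_le; last exact: nearW.
by apply/cvg_ex; exists `|g x|; apply: cvg_norm; exact: cg.
Qed.

Lemma trigmult_cst k : trigmult (fun=> k).
Proof.
split; first exact: bddmeas_cst.
move=> g [bg gc gs]; split; first by apply: bddmeasM => //; exact: bddmeas_cst.
- move=> xi; under [X in agree X]eq_fun do rewrite mulrAC mulrC.
  by apply: agreeZ => //; apply: bddmeasM => //; exact: bddmeas_cos.
- move=> xi; under [X in agree X]eq_fun do rewrite mulrAC mulrC.
  by apply: agreeZ => //; apply: bddmeasM => //; exact: bddmeas_sin.
Qed.

Lemma trigmultM g h : trigmult g -> trigmult h -> trigmult (fun x => g x * h x).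
Proof.
move=> [bg tg] [bh th]; split; first exact: bddmeasM.
move=> f tf; under [X in trigood X]eq_fun do rewrite mulrA.
exact/th/tg.
Qed.

Lemma trigmultD g h : trigmult g -> trigmult h -> trigmult (fun x => g x + h x).
Proof.
move=> [bg tg] [bh th]; split; first exact: bddmeasD.
move=> f tf; under [X in trigood X]eq_fun do rewrite mulrDr.
have [b1 c1 s1] := tg _ tf; have [b2 c2 s2] := th _ tf.
split; first exact: bddmeasD.
- move=> xi; under [X in agree X]eq_fun do rewrite mulrDl.
  by apply: agreeD => //; apply: bddmeasM => //; exact: bddmeas_cos.
- move=> xi; under [X in agree X]eq_fun do rewrite mulrDl.
  by apply: agreeD => //; apply: bddmeasM => //; exact: bddmeas_sin.
Qed.

Lemma trigmultZ k g : trigmult g -> trigmult (fun x => k * g x).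
Proof. by apply: trigmultM; exact: trigmult_cst. Qed.

Lemma trigmultX g k : trigmult g -> trigmult (fun x => g x ^+ k).
Proof.
move=> tg; elim: k => [|k IH].
  by under eq_fun do rewrite expr0; exact: trigmult_cst.
by under eq_fun do rewrite exprS; exact: trigmultM.
Qed.

Lemma trigmult_sum (g : nat -> 'cV[R]_n -> R) N : (forall k, trigmult (g k)) ->
  trigmult (fun x => \sum_(k < N) g k x).
Proof.
move=> tg; elim: N => [|N IH].
  by under eq_fun do rewrite big_ord0; exact: trigmult_cst.
by under eq_fun do rewrite big_ord_recr; exact: trigmultD.
Qed.

Lemma trigmult_lim (g_ : nat -> 'cV[R]_n -> R) (g : 'cV[R]_n -> R) (M : R) : (forall k, trigmult (g_ k)) ->
  (forall k x, `|g_ k x| <= M) -> (forall x, g_ ^~ x @ \oo --> g x) -> trigmult g.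
Proof.
move=> tg gM cg; split; first by apply: (bddmeas_lim _ gM cg) => k; case: (tg k) => -[].
move=> f tf.
have tfg k : trigood (fun x => f x * g_ k x) := (tg k).2 _ tf.
have [[mf [M' fM']] _ _] := tf.
have fgM k x : `|f x * g_ k x| <= M' * M by rewrite normrM ler_pM.
have cfg x : (fun k => f x * g_ k x) @ \oo --> f x * g x by apply: cvgMr; exact: cg.
split.
- by apply: (bddmeas_lim _ fgM cfg) => k; case: (tfg k) => -[].
- move=> xi; have [mc [c cc]] := bddmeas_cos xi.
  apply: (@agree_lim (fun k x => f x * g_ k x * cos (dotv xi x)) _ (M' * M * c)).
  + by move=> k; apply: measurable_funM => //; case: (tfg k) => -[].
  + by move=> k x; rewrite normrM ler_pM.
  + by move=> x; apply: cvgMl; exact: cfg.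
  + by move=> k; case: (tfg k).
- move=> xi; have [mc [c cc]] := bddmeas_sin xi.
  apply: (@agree_lim (fun k x => f x * g_ k x * sin (dotv xi x)) _ (M' * M * c)).
  + by move=> k; apply: measurable_funM => //; case: (tfg k) => -[].
  + by move=> k x; rewrite normrM ler_pM.
  + by move=> x; apply: cvgMl; exact: cfg.
  + by move=> k; case: (tfg k).
Qed.

(** A product of two trigonometric functions is a sum of trigonometric
    functions. *)
Lemma trigmult_cos xi : trigmult (fun x => cos (dotv xi x)).
Proof.
have bc := bddmeas_cos; have bs := bddmeas_sin.
split=> // g [bg gc gs]; split; first exact: bddmeasM.
- move=> eta.
  rewrite (_ : (fun _ => _) = fun x => 2^-1 * (g x * cos (dotv (xi + eta) x) + g x * cos (dotv (xi - eta) x))).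
    by apply: agreeZ; [apply: bddmeasD; exact: bddmeasM|apply: agreeD => //; exact: bddmeasM].
  by apply/funext => x; rewrite !dotvDl dotvNl cosD cosB; field.
- move=> eta.
  rewrite (_ : (fun _ => _) = fun x => 2^-1 * (g x * sin (dotv (eta + xi) x) + g x * sin (dotv (eta - xi) x))).
    by apply: agreeZ; [apply: bddmeasD; exact: bddmeasM|apply: agreeD => //; exact: bddmeasM].
  by apply/funext => x; rewrite !dotvDl dotvNl sinD sinB; field.
Qed.

Lemma trigmult_sin xi : trigmult (fun x => sin (dotv xi x)).
Proof.
have bc := bddmeas_cos; have bs := bddmeas_sin.
split=> // g [bg gc gs]; split; first exact: bddmeasM.
- move=> eta.
  rewrite (_ : (fun _ => _) = fun x => 2^-1 * (g x * sin (dotv (xi + eta) x) + g x * sin (dotv (xi - eta) x))).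
    by apply: agreeZ; [apply: bddmeasD; exact: bddmeasM|apply: agreeD => //; exact: bddmeasM].
  by apply/funext => x; rewrite !dotvDl dotvNl sinD sinB; field.
- move=> eta.
  rewrite (_ : (fun _ => _) = fun x => 2^-1 * (g x * cos (dotv (xi - eta) x) + (-1) * (g x * cos (dotv (xi + eta) x)))).
    apply: agreeZ; first by apply: bddmeasD; [|apply: (bddmeasM (bddmeas_cst _))]; exact: bddmeasM.
    apply: agreeD => //; first exact: bddmeasM.
      by apply: (bddmeasM (bddmeas_cst _)); exact: bddmeasM.
    by apply: agreeZ => //; exact: bddmeasM.
  by apply/funext => x; rewrite !dotvDl dotvNl cosB cosD; field.
Qed.

Lemma trigmult_exp g : trigmult g -> trigmult (fun x => expR (g x)).
Proof.
move=> tg; have [[_ [M gM]] _] := tg.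
apply: (@trigmult_lim (fun N x => series (exp_coeff (g x)) N) _ (expR M)).
- move=> N; under eq_fun do rewrite seriesEord/=.
  apply: (@trigmult_sum (fun k x => exp_coeff (g x) k)) => k.
  rewrite /exp_coeff/=; under eq_fun do rewrite mulrC.
  by apply: trigmultZ; exact: trigmultX.
- move=> N x; have M0 : 0 <= M by apply: le_trans (gM 0).
  apply: le_trans (series_exp_le N M0).
  rewrite !seriesEord/=; apply: le_trans (ler_norm_sum _ _ _) _.
  apply: ler_sum => k _; rewrite /exp_coeff/= normrM normrX normrV ?unitfE ?pnatr_eq0 -?lt0n ?fact_gt0//.
  by rewrite normr_nat ler_wpM2r ?invr_ge0// lerXn2r ?nnegrE.
- by move=> x; exact: is_cvg_series_exp_coeff.
Qed.

Lemma trigmult_agree g : trigmult g -> agree g.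
Proof.
move=> tg.
have t1 : trigood (fun=> 1).
  split; first exact: bddmeas_cst.
  - by move=> xi; under [X in agree X]eq_fun do rewrite mul1r; exact: agree_cos.
  - by move=> xi; under [X in agree X]eq_fun do rewrite mul1r; exact: agree_sin.
have [_ /(_ 0) + _] := tg.2 _ t1.
by under [X in agree X -> _]eq_fun do rewrite dot0v cos0 mulr1 mul1r.
Qed.

(** The linear function [N (x_i - c)] is unbounded, hence not a multiplier, but
    it is the limit of the bounded multipliers [N L sin ((x_i - c) / L)] as [L]
    tends to infinity; the double exponential keeps the limit bounded. *)
Lemma trigmult_ray_exp (i : 'I_n) (c : R) (N : nat) :
  trigmult (fun x => expR (- expR (N%:R * (x i 0 - c)))).
Proof.
pose L k : R := k.+1%:R.
have tS k : trigmult (fun x => sin ((L k)^-1 * (x i 0 - c))).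
  rewrite (_ : (fun _ => _) = fun x => cos (- ((L k)^-1 * c)) * sin (dotv ((L k)^-1 *: delta_mx i 0) x)
     + sin (- ((L k)^-1 * c)) * cos (dotv ((L k)^-1 *: delta_mx i 0) x)).
    by apply: trigmultD; apply: trigmultZ; [exact: trigmult_sin|exact: trigmult_cos].
  by apply/funext => x; rewrite dotvZl dotv_delta mulrBr sinD; ring.
apply: (@trigmult_lim (fun k x => expR (- expR (N%:R * (L k * sin ((L k)^-1 * (x i 0 - c)))))) _ 1).
- move=> k; apply: trigmult_exp; under eq_fun do rewrite -mulN1r.
  by apply: trigmultZ; apply: trigmult_exp; apply: trigmultZ; exact: trigmultZ.
- by move=> k x; rewrite ger0_norm ?expR_ge0// expR_le1 oppr_le0 expR_ge0.
- move=> x; set y := x i 0 - c.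
  have h : (fun k => L k * sin ((L k)^-1 * y)) @ \oo --> y.
    have [y0|y0] := eqVneq y 0.
      by rewrite y0; under eq_fun do rewrite mulr0 sin0 mulr0; exact: cvg_cst.
    have L0 k : L k != 0 by rewrite /L pnatr_eq0.
    have cL : (fun k => (L k)^-1 * y) @ \oo --> (0 : R)^'.
      have c0 : (fun k => (L k)^-1 * y) @ \oo --> (0 : R).
        by rewrite -[X in _ --> X](mul0r y); apply: cvgMl; exact: cvg_harmonic.
      move=> A A0; apply: (@filterS _ \oo _ (fun k => (L k)^-1 * y != 0 -> A ((L k)^-1 * y))).
        by move=> k; apply; rewrite mulf_neq0 ?invr_eq0.
      exact: c0 _ A0.
    have [ds] := @is_derive_sin R 0; rewrite cos0 => ds1.
    have : h^-1 *: (sin (h *: (1:R^o) + 0) - sin 0) @[h --> (0:R)^'] --> (1 : R) by rewrite -[in X in _ --> X]ds1; exact: ds.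
    move=> /(cvg_comp _ _ cL) /= {}h.
    have hy : (fun k => ((L k)^-1 * y)^-1 * sin ((L k)^-1 * y) * y) @ \oo --> 1 * y.
      apply: cvgMl; apply: cvg_trans h; apply: near_eq_cvg; near=> k => /=.
      by rewrite sin0 subr0 addr0 /GRing.scale/= mulr1.
    move: hy; rewrite mul1r; apply: cvg_trans; apply: near_eq_cvg; near=> k.
    by rewrite invfM invrK mulrAC mulfVK// mulrC mulrA.
  by apply: cvg_expR; apply: cvgN; apply: cvg_expR; exact: cvgMr.
Unshelve. all: by end_near. Qed.

Let step (y : R) : R := if y < 0 then 1 else if y == 0 then expR (- 1) else 0.

(** As [N] tends to infinity [exp (- exp (N y))] tends to [1] for [y < 0], to
    [0] for [y > 0], and to [exp (-1)] at [0]. *)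
Lemma trigmult_step (i : 'I_n) (c : R) : trigmult (fun x => step (x i 0 - c)).
Proof.
apply: (@trigmult_lim (fun N x => expR (- expR (N%:R * (x i 0 - c)))) _ 1).
- by move=> N; exact: trigmult_ray_exp.
- by move=> k x; rewrite ger0_norm ?expR_ge0// expR_le1 oppr_le0 expR_ge0.
- move=> x; rewrite /step; set y := x i 0 - c; case: ltgtP => y0.
  + suff : expR (- expR (k%:R * y)) @[k --> \oo] --> expR (- 0) by rewrite oppr0 expR0.
    apply: cvg_expR.
    apply: cvgN; apply/cvgrPdist_lt => e e0; near=> N.
    rewrite sub0r normrN ger0_norm ?expR_ge0//.
    have : N%:R * - y >= e^-1.
      rewrite -ler_pdivrMr ?oppr_gt0//; near: N; exact: nbhs_infty_ger.
    rewrite mulrN => h.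
    rewrite -(invrK e) -[X in X < _]invrK ltf_pV2 ?posrE ?invr_gt0 ?expR_gt0//.
    rewrite -expRN; apply: le_lt_trans h _.
    by apply: lt_le_trans (expR_ge1Dx _); rewrite ltrDr.
  + apply/cvgrPdist_lt => e e0; near=> N.
    rewrite sub0r normrN ger0_norm ?expR_ge0//.
    have h : N%:R * y >= e^-1.
      rewrite -ler_pdivrMr//; near: N; exact: nbhs_infty_ger.
    rewrite -(invrK e) -[X in X < _]invrK ltf_pV2 ?posrE ?invr_gt0 ?expR_gt0//.
    rewrite -expRN opprK; apply: le_lt_trans h _.
    have := expR_ge1Dx (N%:R * y); have := expR_ge1Dx (expR (N%:R * y)); lra.
  + by rewrite y0; under eq_fun do rewrite mulr0 expR0; exact: cvg_cst.
Unshelve. all: by end_near. Qed.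

(** Approaching [c] from the right removes the intermediate value at the jump
    of [step]. *)
Lemma trigmult_ray (i : 'I_n) (c : R) : trigmult (fun x => \1_(`]-oo, c]%classic) (x i 0)).
Proof.
apply: (@trigmult_lim (fun N x => step (x i 0 - (c + N.+1%:R^-1))) _ 1).
- by move=> N; exact: trigmult_step.
- move=> N x; rewrite /step; case: ifP => _; first by rewrite normr1.
  by case: ifP => _; rewrite ?normr0// ger0_norm ?expR_ge0// expR_le1 lerN10.
- move=> x; rewrite indicE; have [xc|xc] := leP (x i 0) c.
  + rewrite mem_set/= ?in_itv//=; apply: cvg_near_cst; near=> N.
    by rewrite /step ifT// subr_lt0 (le_lt_trans xc)// ltrDl invr_gt0.
  + rewrite memNset/= ?in_itv/=; last by apply/negP; rewrite -ltNge.
    apply: cvg_near_cst; near=> N.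
    have h : c + N.+1%:R^-1 < x i 0.
      rewrite -ltrBrDl; near: N.
      by apply: (cvgr_lt (0 : R)); [exact: cvg_harmonic|rewrite subr_gt0].
    by rewrite /step ifF ?ifF//; apply/negbTE; rewrite ?subr_eq0 ?gt_eqF// -leNgt subr_ge0 ltW.
Unshelve. all: by end_near. Qed.

Let trigset := [set A : set 'cV[R]_n | trigmult \1_A].

(** The indicator of a countable intersection is the bounded limit of the finite
    products of indicators; unions follow by complementation. *)
Lemma sigma_algebra_trigset : sigma_algebra setT trigset.
Proof.
have tC A : trigset A -> trigset (~` A).
  rewrite /trigset/= => tA; rewrite (_ : \1_(~` A) = fun x => 1 + (-1) * \1_A x).
    by apply: trigmultD; [exact: trigmult_cst|exact: trigmultZ].
  by apply/funext => x; rewrite !indicE in_setC; case: (x \in A); rewrite /= ?mulr1 ?mulr0 ?subrr ?addr0.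
have t0 : trigset set0 by rewrite /trigset/= indic0; exact: trigmult_cst.
split => //; first by move=> A; rewrite setTD; exact: tC.
move=> F tF; rewrite -(setCK (\bigcup_k F k)); apply: (tC); rewrite setC_bigcup.
apply: (@trigmult_lim (fun N x => \prod_(k < N) \1_(~` F k) x) _ 1).
- elim=> [|N IH]; first by under eq_fun do rewrite big_ord0; exact: trigmult_cst.
  under eq_fun do rewrite big_ord_recr/=; apply: trigmultM => //; exact: tC.
- move=> N x; rewrite normr_prod; apply: prodr_ile1 => k _.
  by rewrite normr_ge0/= indicE; case: (_ \in _); rewrite ?normr1 ?normr0.
- move=> x; rewrite indicE; have [xF|xF] := pselect ((\bigcap_i ~` F i) x).
    rewrite mem_set//; apply: cvg_near_cst; near=> N.
    by rewrite big1// => k _; rewrite indicE mem_set//; exact: xF.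
  rewrite memNset//; have [k xk] : exists k, F k x.
    by apply: contrapT => /forallNP h; apply: xF => i _; exact: h.
  apply: cvg_near_cst; near=> N.
  have kN : (k < N)%N by near: N; exact: nbhs_infty_gt.
  rewrite (bigD1 (Ordinal kN))//= indicE memNset ?mul0r//=; exact.
Unshelve. all: by end_near. Qed.

Lemma trigmult_indic A : measurable A -> trigmult \1_A.
Proof.
suff : g_sigma_preimage (@cV_coord _ R n) `<=` trigset by exact.
apply: smallest_sub; first exact: sigma_algebra_trigset.
rewrite -bigcup_seq; apply: bigcup_sub => i _ _ [C mC <-]; rewrite setTI.
have [t0 tD tU] := sigma_algebra_trigset.
pose H := [set C : set R | trigset (cV_coord i @^-1` C)].
suff : measurable `<=` H by exact.
have -> : (@measurable _ R) = (@RGenOInfty.G R).-sigma.-measurable by exact: RGenOInfty.measurableE.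
apply: smallest_sub; first split.
- by rewrite /H/= preimage_set0.
- by move=> A' hA; rewrite /H/= setTD preimage_setC -setTD; exact: tD.
- by move=> F hF; rewrite /H/= preimage_bigcup; exact: tU.
- move=> _ [c ->]; rewrite /H/= -setCitvl preimage_setC -setTD; apply: (tD).
  exact: trigmult_ray.
Qed.

Import HBNNSimple.

Lemma moment_agree_ge0 (g : 'cV[R]_n -> R) : measurable_fun setT g -> (forall x, 0 <= g x) ->
  integ m1 (fun x => w1 x * g (a1 x)) -> integ m2 (fun x => w2 x * g (a2 x)) ->
  agree g.
Proof.
move=> mg g0 i1 i2.
pose mEg := (measurable_EFinP setT g).2 mg.
pose h := nnsfun_approx measurableT mEg.
have h0 k x : 0 <= h k x by [].
have ch x : h ^~ x @ \oo --> g x.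
  have hh : EFin \o h ^~ x @ \oo --> (g x)%:E.
    by apply: (cvg_nnsfun_approx measurableT mEg) => // y _; rewrite lee_fin.
  exact: (fine_cvg hh).
have hle k x : h k x <= g x.
  rewrite -(cvg_lim _ (ch x))//.
  apply: (@nondecreasing_cvgn_le _ (h ^~ x)); last by apply/cvg_ex; exists (g x); exact: ch.
  by move=> a b ab; exact/lefP/nd_nnsfun_approx.
have th k : agree (h k).
  apply: trigmult_agree; rewrite (funext (fimfunEord (h k))).
  set S := finmap.enum_fset _.
  apply: (@trigmult_sum (fun i x => S`_i * \1_(h k @^-1` [set S`_i]) x)) => i.
  by apply: trigmultZ; apply: trigmult_indic; exact: measurable_sfunP.
have H d (T : measurableType d) (m : {measure set T -> \bar R}) (a : T -> 'cV[R]_n) w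
   (ma : measurable_fun setT a) (ew : expint m a w) : integ m (fun x => w x * g (a x)) ->
  (fun N => \int[m]_x (w x * h N (a x))) @ \oo --> \int[m]_x (w x * g (a x)).
  move=> iwg; apply: (@Rintegral_dct _ _ _ _ _ _ (fun x => `|w x * g (a x)|)).
  - by move=> N; apply: measurable_funM; [exact: expint_meas ew|exact: measurableT_comp].
  - by move=> x; apply: cvgMr; exact: ch.
  - exact: integ_norm.
  - by move=> N x; rewrite !normrM ler_wpM2l// !ger0_norm.
have h1 := H _ _ _ _ _ ma1 ew1 i1; have h2 := H _ _ _ _ _ ma2 ew2 i2.
rewrite /agree -(cvg_lim _ h1)// -(cvg_lim _ h2)//.
by congr (limn _); apply/funext => N; exact: th.
Qed.

(** Moments determine the law under exponential integrability, here for signed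
    weights carried by two different spaces.  If [m2] is the law of [a1] under
    [m1] and [a2] is the identity, the conclusion says that [w2] is the
    conditional expectation of [w1] given [a1]; this is how it is applied in
    [mehler_eigen]. *)
Lemma moment_agree (g : 'cV[R]_n -> R) : measurable_fun setT g ->
  integ m1 (fun x => w1 x * g (a1 x)) -> integ m2 (fun x => w2 x * g (a2 x)) ->
  agree g.
Proof.
move=> mg i1 i2.
have mp : measurable_fun setT g^\+ by exact: measurable_funrpos.
have mn : measurable_fun setT g^\- by exact: measurable_funrneg.
have H d (T : measurableType d) (m : {measure set T -> \bar R}) (a : T -> 'cV[R]_n) w
   (ma : measurable_fun setT a) (ew : expint m a w) : integ m (fun x => w x * g (a x)) ->
   [/\ integ m (fun x => w x * g^\+ (a x)), integ m (fun x => w x * g^\- (a x)) &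
     \int[m]_x (w x * g (a x)) = \int[m]_x (w x * g^\+ (a x)) - \int[m]_x (w x * g^\- (a x))].
  move=> iw.
  have ip : integ m (fun x => w x * g^\+ (a x)).
    apply: (@integ_le _ _ _ _ (fun x => `|w x * g (a x)|)); last 2 first.
    - exact: integ_norm.
    - move=> x; rewrite !normrM ler_wpM2l// ger0_norm ?funrpos_ge0//.
      by rewrite /funrpos ge_max ler_norm normr_ge0.
    by apply: measurable_funM; [exact: expint_meas ew|exact: measurableT_comp].
  have im : integ m (fun x => w x * g^\- (a x)).
    apply: (@integ_le _ _ _ _ (fun x => `|w x * g (a x)|)); last 2 first.
    - exact: integ_norm.
    - move=> x; rewrite !normrM ler_wpM2l// ger0_norm ?funrneg_ge0//.
      by rewrite /funrneg ge_max normr_ge0 andbT -normrN ler_norm.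
    by apply: measurable_funM; [exact: expint_meas ew|exact: measurableT_comp].
  split => //; rewrite -RintegralB//; apply: eq_Rintegral => x _.
  by rewrite -mulrBr -[in LHS](funrposBneg g).
have [p1 n1 e1] := H _ _ _ _ _ ma1 ew1 i1.
have [p2 n2 e2] := H _ _ _ _ _ ma2 ew2 i2.
rewrite /agree e1 e2; congr (_ - _).
- by apply: moment_agree_ge0 => // x; exact: funrpos_ge0.
- by apply: moment_agree_ge0 => // x; exact: funrneg_ge0.
Qed.

End moments.

(** * Densities and image measures *)

Section density.
Context {d} {T : measurableType d} {R : realType}.
Variables (m nu : {measure set T -> \bar R}) (p : T -> R).
Hypotheses (mp : measurable_fun setT p) (p0 : forall x, 0 <= p x).
Hypothesis nuE : forall A, measurable A -> nu A = (\int[m]_(x in A) (p x)%:E)%E.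
Local Open Scope ereal_scope.

Import HBNNSimple.

Let density_nnsfun (f : {nnsfun T >-> R}) :
  \int[nu]_x (f x)%:E = \int[m]_x ((f x)%:E * (p x)%:E).
Proof.
have mf r : measurable (f @^-1` [set r]) by exact: measurable_sfunP.
under [LHS]eq_integral do rewrite fimfunE -fsumEFin//.
rewrite [LHS]ge0_integral_fsum//; last 2 first.
  - by move=> r; exact/measurable_EFinP/measurableT_comp.
  - by move=> n x _; rewrite EFinM nnfun_muleindic_ge0.
under [RHS]eq_integral.
  move=> x xD; rewrite fimfunE -fsumEFin// muleC ge0_mule_fsumr; last first.
    by move=> r; rewrite EFinM nnfun_muleindic_ge0.
  over.
rewrite [RHS]ge0_integral_fsum//; last 2 first.
  - by move=> r; apply: emeasurable_funM; apply/measurable_EFinP => //; exact: measurableT_comp.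
  - by move=> n x _; apply: mule_ge0; [rewrite lee_fin|rewrite EFinM nnfun_muleindic_ge0].
apply: eq_fsbigr => r _.
have [r0|r0] := leP 0%R r; last first.
  have e : f @^-1` [set r] = set0.
    by apply/seteqP; split => // x /= fx; have : (0 <= f x)%R by []; rewrite fx leNgt r0.
  rewrite e integral0_eq; last by move=> x _; rewrite indic0 mulr0.
  by rewrite integral0_eq// => x _; rewrite indic0 mulr0 mule0.
under [RHS]eq_integral do rewrite EFinM muleCA.
rewrite integralZl_indic_nnsfun//= integral_indic// setIT nuE//.
rewrite ge0_integralZl//; last 2 first.
- by apply: emeasurable_funM; apply/measurable_EFinP => //; exact: measurable_indic.
- by move=> x _; rewrite mule_ge0// lee_fin.
congr (_ * _); rewrite integral_mkcond; apply: eq_integral => x _.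
rewrite /patch indicE; case: ifPn => _; by rewrite ?mule1 ?mule0.
Qed.

Lemma ge0_integral_density (f : T -> \bar R) : measurable_fun setT f ->
  (forall x, 0 <= f x) -> \int[nu]_x f x = \int[m]_x (f x * (p x)%:E).
Proof.
move=> mf f0; pose f_ := nnsfun_approx measurableT mf.
transitivity (limn (fun n => \int[nu]_x (f_ n x)%:E)).
  rewrite -monotone_convergence//=.
  - apply: eq_integral => ? /[!inE] xD; apply/esym/cvg_lim => //=.
    exact: cvg_nnsfun_approx.
  - by move=> n; exact/measurable_EFinP/measurable_funTS.
  - by move=> n ? _; rewrite lee_fin.
  - by move=> ? _ ? ? mn; rewrite lee_fin; exact/lefP/nd_nnsfun_approx.
rewrite [RHS](_ : _ = limn (fun n => \int[m]_x ((f_ n x)%:E * (p x)%:E))); last first.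
  rewrite -monotone_convergence//=.
  - apply: eq_integral => x /[!inE] xD; apply/esym/cvg_lim => //.
    rewrite [X in X @ _ --> _](_ : _ = fun n => (p x)%:E * (EFin \o f_ n) x); last first.
      by apply/funext => n; rewrite muleC.
    rewrite muleC; apply: cvgeZl => //.
    exact: cvg_nnsfun_approx.
  - by move=> n; apply: emeasurable_funM; apply/measurable_EFinP.
  - by move=> n ? _; rewrite mule_ge0// lee_fin.
  - by move=> ? _ ? ? mn; rewrite lee_wpmul2r ?lee_fin//; exact/lefP/nd_nnsfun_approx.
by congr (limn _); apply/funext => n; rewrite density_nnsfun.
Qed.
End density.

Lemma ge0_integral_image d1 d2 (X : measurableType d1) (Y : measurableType d2) (R : realType)
    (phi : X -> Y) (mphi : measurable_fun setT phi)
    (mu : {measure set X -> \bar R}) (f : Y -> \bar R) :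
  measurable_fun setT f -> (forall y, 0 <= f y)%E ->
  (\int[measure_function_pushforward__canonical__measure_function_Measure mu mphi]_y f y
   = \int[mu]_x f (phi x))%E.
Proof.
move=> mf f0.
by rewrite (@ge0_integral_pushforward _ _ _ _ R _ mphi mu setT)// preimage_setT.
Qed.

(** * Gaussian integrals *)

Section gauss_integral.
Context {R : realType}.

Lemma integral_gauss1 (a c : R) : 0 < a ->
  (\int[lebesgue_measure]_x (expR (- 2^-1 * (a * x ^+ 2) + c * x))%:E
   = ((2 * pi) `^ 2^-1 * a `^ (- 2^-1) * expR (2^-1 * (c ^+ 2 / a)))%:E)%E.
Proof.
move=> a0; have p0 := @pi_gt0 R.
pose s := (Num.sqrt a)^-1.
have s0 : s != 0 by rewrite invr_eq0 gt_eqF// sqrtr_gt0.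
have s2 : s ^+ 2 = a^-1 by rewrite exprVn sqr_sqrtr// ltW.
pose K := (2 * pi) `^ 2^-1 * a `^ (- 2^-1) * expR (2^-1 * (c ^+ 2 / a)).
have K0 : 0 <= K by rewrite /K !mulr_ge0 ?powR_ge0 ?expR_ge0.
have E x : expR (- 2^-1 * (a * x ^+ 2) + c * x) = K * normal_pdf (c / a) s x.
  rewrite normal_pdfE// /normal_peak /normal_fun s2 /K.
  have -> : Num.sqrt (a^-1 * pi *+ 2) = (2 * pi) `^ 2^-1 * a `^ (- 2^-1).
    rewrite powRN !powR12_sqrt ?mulr_ge0 ?ltW//.
    have -> : a^-1 * pi *+ 2 = (2 * pi) * a^-1 by rewrite -mulr_natl; ring.
    by rewrite sqrtrM ?mulr_ge0 ?ltW// sqrtrV// ltW.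
  set k := _ `^ _ * _ `^ _.
  have k0 : k != 0 by rewrite /k mulf_neq0// gt_eqF// powR_gt0// mulr_gt0.
  rewrite mulrACA divff// mul1r -expRD; congr expR.
  by rewrite -mulr_natl; field; rewrite gt_eqF.
under eq_integral do rewrite E EFinM.
rewrite ge0_integralZl ?lee_fin//.
- by rewrite integral_normal_pdf mule1.
- by apply/measurable_EFinP; exact: measurable_normal_pdf.
- by move=> x _; rewrite lee_fin normal_pdf_ge0.
Qed.

Lemma ge0_integral_lebesgue_cVS n (f : 'cV[R]_n.+1 -> \bar R) :
  measurable_fun setT f -> (forall x, 0 <= f x)%E ->
  (\int[lebesgue_cV R n.+1]_x f x =
   \int[lebesgue_cV R n]_y \int[lebesgue_measure]_x f (cV_cons (x, y)))%E.
Proof.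
move=> mf f0.
pose P : {measure set 'cV[R]_n.+1 -> \bar R} :=
  measure_function_pushforward__canonical__measure_function_Measure
    ((@lebesgue_measure R) \x (lebesgue_cV R n))%E (@measurable_cV_cons R n).
rewrite (@eq_measure_integral _ _ _ _ P)//.
rewrite ge0_integral_image//.
rewrite fubini_tonelli2//.
exact: (measurableT_comp mf (@measurable_cV_cons R n)).
Qed.

Lemma cV_consE n (x : R) (y : 'cV[R]_n) : cV_cons (x, y) = col_mx (x%:M : 'cV_1) y.
Proof.
apply/colP => i; rewrite !mxE; case: unliftP => [j ->|->].
  case: splitP => [k /=|k]; first by rewrite (ord1 k) /= /bump.
  by rewrite /= /bump leq0n add1n => -[] /val_inj ->.
case: splitP => [k _|k]; by rewrite ?(ord1 k) ?mxE.
Qed.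

Lemma quad_formE n (A : 'M[R]_n) x : quad_form A x = dotv x (A *m x).
Proof. by rewrite /quad_form /dotv mulmxA. Qed.

Section block.
Variables (n : nat) (a : R) (b : 'cV[R]_n) (C : 'M[R]_n).
Let A : 'M[R]_(1 + n) := block_mx a%:M b^T b C.
Implicit Types (x z : R) (y w : 'cV[R]_n).
Local Notation cons x y := (col_mx (x%:M : 'cV_1) y : 'cV[R]_(1 + n)).

Lemma dotv_cons x y z w : dotv (cons x y) (cons z w) = x * z + dotv y w.
Proof.
rewrite /dotv tr_col_mx mul_row_col mxE tr_scalar_mx -scalar_mxM.
by rewrite !mxE/= ?eqxx ?mulr1n.
Qed.

Lemma block_mul_cons x y : A *m cons x y = cons (a * x + dotv b y) (x *: b + C *m y).
Proof.
rewrite /A mul_block_col -scalar_mxM; congr col_mx; last by rewrite mul_mx_scalar.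
by apply/matrixP => i j; rewrite !ord1 !mxE /dotv/= ?eqxx ?mulr1n ?mxE.
Qed.

Lemma quad_cons x y : quad_form A (cons x y) = a * x ^+ 2 + 2 * x * dotv b y + quad_form C y.
Proof.
rewrite quad_formE block_mul_cons dotv_cons quad_formE dotvDr dotvZr (dotvC y b); ring.
Qed.

Definition schur := C - a^-1 *: (b *m b^T).

Lemma mul_schur y : schur *m y = C *m y - (a^-1 * dotv b y) *: b.
Proof.
rewrite /schur mulmxBl -scalemxAl -mulmxA -scalerA; congr (_ - _ *: _).
by apply/colP => i; rewrite !mxE big_ord1 mulrC.
Qed.

Lemma quad_schur y : quad_form schur y = quad_form C y - (dotv b y) ^+ 2 / a.
Proof. rewrite !quad_formE mul_schur dotvDr dotvNr dotvZr (dotvC y b); ring. Qed.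

Lemma det_schur : a != 0 -> \det A = a * \det schur.
Proof.
move=> a0.
have -> : A = block_mx 1%:M 0 (a^-1 *: b) 1%:M *m block_mx a%:M b^T 0 schur.
  rewrite mulmx_block !mul1mx !mul0mx !addr0 mul_mx_scalar scalerA divff// scale1r.
  by rewrite -scalemxAl /schur addrC subrK.
by rewrite det_mulmx det_lblock det_ublock !det1 !mul1r det_scalar1.
Qed.

Lemma schur_posdef : sym_posdef A -> 0 < a /\ sym_posdef schur.
Proof.
move=> [As Ap].
have a0 : 0 < a.
  have := Ap (cons 1 0); rewrite quad_cons quad_formE mulmx0 !dotv0.
  rewrite expr1n mulr1 mulr0 !addr0; apply.
  apply/eqP => /colP /(_ (lshift n ord0)); rewrite col_mxEu !mxE eqxx mulr1n => /eqP.
  by rewrite oner_eq0.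
split=> //; split.
  move: As; rewrite /A tr_block_mx trmxK => /eq_block_mx [_ _ _ Cs].
  by rewrite /schur linearB linearZ/= trmx_mul trmxK Cs.
move=> y y0; rewrite quad_schur.
have := Ap (cons (- (dotv b y / a)) y); rewrite quad_cons.
have -> : a * (- (dotv b y / a)) ^+ 2 + 2 * - (dotv b y / a) * dotv b y + quad_form C y
  = quad_form C y - dotv b y ^+ 2 / a by field; rewrite gt_eqF.
apply; apply/eqP => h; move/eqP: y0; apply.
by apply/colP => i; have /colP /(_ (rshift 1 i)) := h; rewrite col_mxEd => ->; rewrite !mxE.
Qed.
End block.

Lemma sym_block n (A : 'M[R]_(1 + n)) : A^T = A ->
  A = block_mx (A ord0 ord0)%:M (dlsubmx A)^T (dlsubmx A) (drsubmx A).
Proof.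
move=> As.
have e : ursubmx A = (dlsubmx A)^T by rewrite trmx_dlsub As.
have e2 : ulsubmx A = (A ord0 ord0)%:M.
  by rewrite [LHS]mx11_scalar !mxE; congr (A _ _)%:M; exact/val_inj.
by rewrite -{1}(submxK A) e e2.
Qed.

Lemma measurable_quad_form n (A : 'M[R]_n) : measurable_fun setT (quad_form A).
Proof.
rewrite (_ : quad_form A = fun x => \sum_i x i 0 * \sum_j A i j * x j 0).
  apply: measurable_sum => i; apply: measurable_funM; first exact: measurable_cV_coord.
  apply: measurable_sum => j; apply: measurable_funM => //; exact: measurable_cV_coord.
by apply/funext => x; rewrite quad_formE dotvE; apply: eq_bigr => i _; rewrite mxE.
Qed.

Lemma measurable_gauss_integrand n (A : 'M[R]_n) (m : 'cV[R]_n) :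
  measurable_fun setT (fun x => (expR (- 2^-1 * quad_form A x + dotv m x))%:E).
Proof.
apply/measurable_EFinP; apply: measurableT_comp => //; apply: measurable_funD.
  by apply: measurable_funM => //; exact: measurable_quad_form.
exact: measurable_dotv.
Qed.

(** Induction on the dimension: completing the square in the first coordinate
    leaves the same integral for the Schur complement, whose determinant is
    [\det A / a].  Positivity of the determinant comes out of the same
    induction. *)
Lemma integral_gauss n (A : 'M[R]_n) (m : 'cV[R]_n) : sym_posdef A -> 0 < \det A /\
  (\int[lebesgue_cV R n]_x (expR (- 2^-1 * quad_form A x + dotv (A *m m) x))%:E =
   ((2 * pi) `^ (n%:R / 2) * (\det A) `^ (- 2^-1) * expR (2^-1 * quad_form A m))%:E)%E.
Proof.
elim: n A m => [|n IH] A m pA.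
  split; first by rewrite det_mx00.
  have z (x : 'cV[R]_0) : x = 0 by apply/colP => -[].
  rewrite det_mx00 powR1 mul0r powRr0 mul1r mul1r /=.
  rewrite integral_dirac//.
    by rewrite diracT mul1e !quad_formE !(z (A *m _)) !dotv0 ?dot0v !mulr0 addr0.
  have -> : (fun x : 'cV[R]_0 => (expR (- 2^-1 * quad_form A x + dotv (A *m m) x))%:E) = cst 1%E.
    by apply/funext => x; rewrite quad_formE !(z (A *m _)) !dotv0 ?dot0v mulr0 addr0 expR0.
  exact: measurable_cst.
have AE := @sym_block n A pA.1.
move: AE; set a := A _ _; set b := dlsubmx _; set C := drsubmx _ => AE.
rewrite AE in pA *.
have [a0 pS] := schur_posdef pA.
have [IH1 IH2] := IH _ (dsubmx (m : 'cV_(1 + n))) pS.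
have aN : a != 0 by rewrite gt_eqF.
have dE := det_schur b C aN.
split; first by rewrite dE mulr_gt0.
rewrite ge0_integral_lebesgue_cVS//; last exact: measurable_gauss_integrand.
have mE : m = col_mx (m ord0 0)%:M (dsubmx (m : 'cV_(1 + n))) :> 'cV_(1+n).
  rewrite -{1}(vsubmxK (m : 'cV_(1 + n))); congr col_mx.
  by rewrite [LHS]mx11_scalar mxE; congr (m _ _)%:M; exact/val_inj.
move: mE IH2; set m0 := m _ _; set m' := dsubmx _ => mE IH2.
pose e0 := a * m0 + dotv b m'; pose e' := m0 *: b + C *m m'.
pose K := (2 * pi) `^ 2^-1 * a `^ (- 2^-1).
have K0 : 0 <= K by rewrite /K !mulr_ge0 ?powR_ge0.
transitivity ((K * expR (2^-1 * (e0 ^+ 2 / a)))%:E *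
  \int[lebesgue_cV R n]_y (expR (- 2^-1 * quad_form (schur a b C) y + dotv (schur a b C *m m') y))%:E)%E.
  rewrite -ge0_integralZl//; [|exact: measurable_gauss_integrand|by rewrite lee_fin mulr_ge0 ?expR_ge0].
  apply: eq_integral => y _.
  have E x : expR (- 2^-1 * quad_form (block_mx a%:M b^T b C) (cV_cons (x, y)) + dotv (block_mx a%:M b^T b C *m m) (cV_cons (x, y)))
     = expR (- 2^-1 * quad_form C y + dotv e' y) * expR (- 2^-1 * (a * x ^+ 2) + (e0 - dotv b y) * x).
    rewrite cV_consE mE block_mul_cons dotv_cons quad_cons -expRD; congr expR.
    rewrite -/e0 -/e'; by field.
  under eq_integral do rewrite E EFinM.
  rewrite ge0_integralZl ?lee_fin ?expR_ge0//; last first.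
    apply/measurable_EFinP; apply: measurableT_comp => //; apply: measurable_funD; apply: measurable_funM => //.
    by apply: measurable_funM => //; exact: measurable_funX.
  rewrite integral_gauss1// -!EFinM; congr EFin.
  rewrite -/K mulrCA mulrA -mulrA -!expRD -[RHS]mulrA; congr (_ * _).
  rewrite -expRD; congr expR.
  rewrite quad_schur mul_schur /e' !dotvDl dotvNl !dotvZl /e0.
  by field.
rewrite IH2 -EFinM; congr EFin.
have -> : n.+1%:R / 2 = 2^-1 + n%:R / 2 :> R by rewrite -natr1; field.
rewrite [X in _ = X * _ * _]powRD; last first.
  by apply/implyP => _; rewrite mulf_neq0// gt_eqF// pi_gt0.
rewrite dE [X in _ = _ * X * _]powRM ?ltW// /K.
rewrite mulrACA [_ `^ 2^-1 * _ * _]mulrACA; set u := (_ * _ * (_ * _)).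
congr (_ * _); rewrite -expRD; congr expR.
rewrite {u} mE quad_cons quad_schur /e0; by field.
Qed.
End gauss_integral.

Section gaussian_mgf.
Context {R : realType} {n : nat}.
Implicit Types S : 'M[R]_n.

Lemma posdef_unitmx S : sym_posdef S -> S \in unitmx.
Proof.
by move=> /(integral_gauss 0) [+ _]; rewrite unitmxE unitfE => /lt0r_neq0.
Qed.

Lemma posdef_invmx S : sym_posdef S -> sym_posdef (invmx S).
Proof.
move=> pS; have uS := posdef_unitmx pS; have [Ss Sp] := pS; split.
  by rewrite trmx_inv Ss.
move=> x x0; have -> : quad_form (invmx S) x = quad_form S (invmx S *m x).
  by rewrite !quad_formE mulKVmx// dotvC.
apply: Sp; apply: contraNneq x0 => h.
by rewrite -(mulKVmx uS x) h mulmx0.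
Qed.

(** The exponent is completed to a Gaussian of mean [S *m eta]. *)
Lemma gaussian_mgf S (eta : 'cV[R]_n) : sym_posdef S ->
  (\int[gaussian S]_x (expR (dotv eta x))%:E = (expR (2^-1 * quad_form S eta))%:E)%E.
Proof.
move=> pS; have uS := posdef_unitmx pS; have pI := posdef_invmx pS.
rewrite (@ge0_integral_density _ _ _ (lebesgue_cV R n) _ (gaussian_pdf S))//; last 3 first.
- exact: measurable_gaussian_pdf.
- exact: gaussian_pdf_ge0.
- by apply/measurable_EFinP; apply: measurableT_comp => //; exact: measurable_dotv.
have [dI /= E] := integral_gauss (S *m eta) pI.
pose c := (2 * pi) `^ (- (n%:R / 2)) * (\det S) `^ (- 2^-1) : R.
transitivity (c%:E * \int[lebesgue_cV R n]_x (expR (- 2^-1 * quad_form (invmx S) x + dotv (invmx S *m (S *m eta)) x))%:E)%E.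
  rewrite -ge0_integralZl//; [|exact: measurable_gauss_integrand|by rewrite lee_fin /c mulr_ge0 ?powR_ge0].
  apply: eq_integral => x _; rewrite -!EFinM; congr EFin.
  by rewrite /gaussian_pdf -/c mulrCA -expRD mulKmx// addrC.
rewrite E -EFinM; congr EFin.
have [dS _] := integral_gauss 0 pS.
have -> : quad_form (invmx S) (S *m eta) = quad_form S eta.
  by rewrite !quad_formE mulKmx// dotvC.
rewrite mulrA /c det_inv mulrACA -powRD; last first.
  by apply/implyP => _; rewrite mulf_neq0// gt_eqF// pi_gt0.
rewrite addNr powRr0 mul1r -powRM ?invr_ge0 ?ltW//.
by rewrite divff ?powR1 ?mul1r// gt_eqF.
Qed.

(** The same set function as [gaussian S], with the positive definiteness of
    [S] as an argument: this is what makes it a probability. *)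
Definition gaussian_prob S (pS : sym_posdef S) : set 'cV[R]_n -> \bar R := gaussian S.

HB.instance Definition _ S (pS : sym_posdef S) := Measure.copy (gaussian_prob pS) (gaussian S).

Let gaussian_setT S (pS : sym_posdef S) : gaussian_prob pS [set: _] = 1%E.
Proof.
have := gaussian_mgf 0 pS; rewrite quad_formE dot0v mulr0 expR0 => <-.
under eq_integral do rewrite dot0v expR0.
by rewrite integral_cst// mul1e.
Qed.

HB.instance Definition _ S (pS : sym_posdef S) :=
  @Measure_isProbability.Build _ _ R (gaussian_prob pS) (gaussian_setT pS).

Variables (S : 'M[R]_n) (pS : sym_posdef S).

Lemma integ_gaussian_exp eta : integ (gaussian_prob pS) (fun x => expR (dotv eta x)).
Proof.
apply/integrableP; split.
  by apply/measurable_EFinP; apply: measurableT_comp => //; exact: measurable_dotv.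
under eq_integral do rewrite /= ger0_norm ?expR_ge0//.
by rewrite gaussian_mgf// ltry.
Qed.

Lemma Rintegral_gaussian_exp eta :
  \int[gaussian_prob pS]_x expR (dotv eta x) = expR (2^-1 * quad_form S eta).
Proof. by rewrite /Rintegral gaussian_mgf. Qed.

End gaussian_mgf.

(** * Taylor jets at the origin *)

Section jet.
Context {R : realType}.
Implicit Types (f g : R -> R) (a b : nat -> R).

(** Taylor expansions of all orders, with bounds only: unlike a convergent
    power series, a jet survives products and rescalings without any
    discussion of radius of convergence, and it is still unique. *)
Definition jet f a := forall M, exists C, forall s, `|s| <= 1 ->
  `|f s - \sum_(j < M) a j * s ^+ j| <= C * `|s| ^+ M.

Lemma eq_jet f g a : f =1 g -> jet f a -> jet g a.
Proof. by move=> fg jf M; have [C h] := jf M; exists C => s s1; rewrite -fg h. Qed.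

Lemma jet_uniq f a b : jet f a -> jet f b -> a =1 b.
Proof.
move=> ja jb j; elim/ltn_ind: j => j IH.
have [C hC] := ja j.+1; have [C' hC'] := jb j.+1.
apply/eqP; rewrite -subr_eq0 -normr_le0; apply/ler_addgt0Pl => e e0; rewrite addr0.
pose K := `|C| + `|C'| + 1.
have K0 : 0 < K by rewrite /K ltr_wpDl// addr_ge0.
(* small enough for the error terms to be below [e] after division by [s ^ j] *)
pose s := Num.min 1 (e / K).
have s0 : 0 < s by rewrite lt_min ltr01 divr_gt0.
have s1 : `|s| <= 1 by rewrite gtr0_norm// ge_min lexx.
have h : `|a j - b j| * s ^+ j <= K * s ^+ j.+1.
  rewrite -[X in _ * X]gtr0_norm ?exprn_gt0// -normrM.
  have -> : (a j - b j) * s ^+ j = (f s - \sum_(i < j.+1) b i * s ^+ i) - (f s - \sum_(i < j.+1) a i * s ^+ i).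
    have eab : \sum_(i < j) a i * s ^+ i = \sum_(i < j) b i * s ^+ i.
      by apply: eq_bigr => i _; rewrite IH.
    rewrite !big_ord_recr/= eab; ring.
  apply: le_trans (ler_normB _ _) _.
  apply: le_trans (lerD (hC' _ s1) (hC _ s1)) _.
  rewrite -mulrDl gtr0_norm// ler_wpM2r ?exprn_ge0 ?ltW// /K addrC.
  by have := ler_norm C; have := ler_norm C'; lra.
rewrite exprS mulrA ler_pM2r ?exprn_gt0// in h.
apply: le_trans h _; rewrite -ler_pdivlMl// mulrC.
by rewrite /s ge_min lexx orbT.
Qed.

Lemma horner_bound (p : {poly R}) : exists C, forall s, `|s| <= 1 -> `|p.[s]| <= C.
Proof.
exists (\sum_(i < size p) `|p`_i|) => s s1; rewrite horner_coef.
apply: le_trans (ler_norm_sum _ _ _) _; apply: ler_sum => i _.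
by rewrite normrM ler_piMr// normrX exprn_ile1.
Qed.

Definition cauchy_prod a b (j : nat) : R := \sum_(i < j.+1) a i * b (j - i)%N.

Lemma jetM f g a b : jet f a -> jet g b -> jet (fun s => f s * g s) (cauchy_prod a b).
Proof.
move=> ja jb M.
have [Ca hCa] := ja M; have [Cb hCb] := jb M; have [C0 hC0] := ja 0%N.
pose P := \poly_(i < M) a i; pose Q := \poly_(i < M) b i.
have PE s : \sum_(j < M) a j * s ^+ j = P.[s] by rewrite horner_poly.
have QE s : \sum_(j < M) b j * s ^+ j = Q.[s] by rewrite horner_poly.
have [CQ hQ] := horner_bound Q; have [CD hD] := horner_bound (drop_poly M (P * Q)).
exists (C0 * Cb + CQ * Ca + CD) => s s1.
have -> : \sum_(j < M) cauchy_prod a b j * s ^+ j = (take_poly M (P * Q)).[s].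
  rewrite horner_poly; apply: eq_bigr => j _; congr (_ * _).
  rewrite coefM; apply: eq_bigr => i _; rewrite !coef_poly.
  have iM : (i < M)%N by apply: leq_trans (ltn_ord j); rewrite ltnS -ltnS.
  by rewrite iM (leq_ltn_trans (leq_subr _ _)).
have E : P.[s] * Q.[s] = (take_poly M (P * Q)).[s] + (drop_poly M (P * Q)).[s] * s ^+ M.
  by rewrite -hornerM -{1}(poly_take_drop M (P * Q)) hornerD hornerM hornerXn.
have -> : f s * g s - (take_poly M (P * Q)).[s] =
  f s * (g s - Q.[s]) + Q.[s] * (f s - P.[s]) + (drop_poly M (P * Q)).[s] * s ^+ M.
  apply/eqP; rewrite -subr_eq0; apply/eqP.
  have -> : (take_poly M (P * Q)).[s] = P.[s] * Q.[s] - (drop_poly M (P * Q)).[s] * s ^+ M by rewrite E addrK.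
  ring.
have C0s : `|f s| <= C0 by have := hC0 _ s1; rewrite big_ord0 subr0 expr0 mulr1.
have := hCa _ s1; rewrite PE => ha; have := hCb _ s1; rewrite QE => hb.
rewrite !mulrDl; apply: le_trans (ler_normD _ _) _; apply: lerD.
  apply: le_trans (ler_normD _ _) _; rewrite -!mulrA; apply: lerD; rewrite normrM ler_pM//.
  exact: hQ.
by rewrite normrM normrX ler_wpM2r ?exprn_ge0// hD.
Qed.

Lemma jet_scale f a r : `|r| <= 1 -> jet f a -> jet (fun s => f (r * s)) (fun j => r ^+ j * a j).
Proof.
move=> r1 ja M; have [C hC] := ja M; exists `|C| => s s1.
have rs : `|r * s| <= 1 by rewrite normrM mulr_ile1.
rewrite (eq_bigr (fun j : 'I_M => a j * (r * s) ^+ j)); last first.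
  by move=> j _; rewrite exprMn mulrCA mulrA.
apply: le_trans (hC _ rs) _; apply: le_trans (ler_norm _) _.
rewrite normrM normrX normr_id ler_wpM2l// normrM exprMn ler_piMl ?exprn_ge0//.
by rewrite exprn_ile1.
Qed.

Lemma jetZ k f a : jet f a -> jet (fun s => k * f s) (fun j => k * a j).
Proof.
move=> ja M; have [C hC] := ja M; exists (`|k| * C) => s s1.
have -> : k * f s - \sum_(j < M) k * a j * s ^+ j = k * (f s - \sum_(j < M) a j * s ^+ j).
  by rewrite mulrBr mulr_sumr; congr (_ - _); apply: eq_bigr => j _; rewrite mulrA.
by rewrite normrM -mulrA ler_wpM2l// hC.
Qed.

Lemma exp_rem (y : R) K : `|expR y - \sum_(k < K) y ^+ k / k`!%:R| <= `|y| ^+ K * expR `|y|.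
Proof.
have H n : `|series (exp_coeff y) (K + n)%N - \sum_(k < K) y ^+ k / k`!%:R| <= `|y| ^+ K * expR `|y|.
  rewrite seriesEord/= big_split_ord/= [X in X - _]addrC addrK.
  apply: le_trans (ler_norm_sum _ _ _) _.
  apply: le_trans (ler_wpM2l _ (series_exp_le n (normr_ge0 y))); last by rewrite exprn_ge0.
  rewrite seriesEord/= mulr_sumr; apply: ler_sum => i _.
  rewrite /exp_coeff/= normrM normrX exprD -mulrA ler_wpM2l ?exprn_ge0//.
  rewrite normrV ?unitfE ?pnatr_eq0 -?lt0n ?fact_gt0// normr_nat ler_wpM2l ?exprn_ge0//.
  by rewrite lef_pV2 ?posrE ?ltr0n ?fact_gt0// ler_nat leq_fact// leq_addl.
have cE : (fun n => `|series (exp_coeff y) (K + n)%N - \sum_(k < K) y ^+ k / k`!%:R|) @ \oo -->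
    `|expR y - \sum_(k < K) y ^+ k / k`!%:R|.
  apply: cvg_norm; apply: cvgB; last exact: cvg_cst.
  have h := is_cvg_series_exp_coeff y.
  have -> : (fun n => series (exp_coeff y) (K + n)%N) = (fun n => series (exp_coeff y) (n + K)%N).
    by apply/funext => j; rewrite addnC.
  by rewrite cvg_shiftn.
rewrite -(cvg_lim _ cE)//; apply: limr_le; last exact: nearW.
by apply/cvg_ex; eexists; exact: cE.
Qed.

(** The Taylor coefficients of [s |-> exp (b s ^ 2)]. *)
Definition sqexp_coeff (b : R) (j : nat) : R := if odd j then 0 else b ^+ j./2 / (j./2)`!%:R.

Lemma jet_sqexp (b : R) : jet (fun s => expR (b * s ^+ 2)) (sqexp_coeff b).
Proof.
move=> M.
have E s K : \sum_(j < K.*2) sqexp_coeff b j * s ^+ j = \sum_(k < K) (b * s ^+ 2) ^+ k / k`!%:R.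
  elim: K => [|K IH]; first by rewrite !big_ord0.
  rewrite doubleS !big_ord_recr/= IH -addrA; congr (_ + _).
  rewrite /sqexp_coeff/= odd_double/= mul0r addr0 doubleK exprMn -exprM mul2n mulrAC//.
exists (\sum_(j < M) `|sqexp_coeff b (M + j)| + `|b| ^+ M * expR `|b|) => s s1.
have -> : expR (b * s ^+ 2) - \sum_(j < M) sqexp_coeff b j * s ^+ j =
   \sum_(j < M) sqexp_coeff b (M + j) * s ^+ (M + j) + (expR (b * s ^+ 2) - \sum_(j < M.*2) sqexp_coeff b j * s ^+ j).
  rewrite -addnn big_split_ord/=; ring.
rewrite mulrDl; apply: le_trans (ler_normD _ _) _; apply: lerD.
  apply: le_trans (ler_norm_sum _ _ _) _; rewrite mulr_suml; apply: ler_sum => j _.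
  rewrite normrM ler_wpM2l// normrX exprD ler_piMr ?exprn_ge0// exprn_ile1//.
rewrite E; apply: le_trans (exp_rem _ _) _.
have s2 : `|s| ^+ 2 <= 1 by rewrite exprn_ile1.
rewrite normrM normrX exprMn mulrAC; apply: ler_pM.
- by rewrite mulr_ge0 ?exprn_ge0 ?expR_ge0.
- by rewrite exprn_ge0 ?exprn_ge0.
- by rewrite ler_wpM2l ?exprn_ge0// ler_expR ler_piMr.
- by rewrite -exprM mulnC mulnC mul2n -addnn exprD ler_piMr ?exprn_ge0// exprn_ile1.
Qed.
End jet.

(** * Laplace transforms *)

Section mgf.
Context {d} {T : measurableType d} {R : realType} {n : nat}.
Variables (m : {measure set T -> \bar R}) (a : T -> 'cV[R]_n) (w : T -> R).
Hypotheses (ma : measurable_fun setT a) (ew : expint m a w).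

Definition mgf (xi : 'cV[R]_n) := \int[m]_x (w x * expR (dotv xi (a x))).
Definition mom (xi : 'cV[R]_n) (k : nat) := (\int[m]_x (w x * dotv xi (a x) ^+ k)) / k`!%:R.

(** The remainder of order [M] of the exponential is bounded by
    [|s y| ^ M * exp |y|], and [|y| ^ M] by [M! * exp |y|]; the resulting
    weight [exp |2 y|] is integrable. *)
Lemma jet_mgf xi : jet (fun s => mgf (s *: xi)) (mom xi).
Proof.
move=> M; exists (\int[m]_x (M`!%:R * (`|w x| * expR `|dotv (2 *: xi) (a x)|))) => s s1.
have ik k : integ m (fun x => w x * dotv xi (a x) ^+ k) by apply: expint_integ; apply: expintM_dotX.
have [i1 i2] := @Rintegral_sum _ _ _ m setT measurableT _ (index_enum 'I_M)
  (fun k x => (s ^+ k / k`!%:R) * (w x * dotv xi (a x) ^+ k)) (fun k => integZ _ (ik k)).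
have -> : \sum_(j < M) mom xi j * s ^+ j = \int[m]_x (\sum_(k < M) (s ^+ k / k`!%:R) * (w x * dotv xi (a x) ^+ k)).
  by rewrite i2; apply: eq_bigr => j _; rewrite RintegralZl// /mom mulrC (mulrC (\int[_]_x _)) mulrA.
have ia : integ m (fun x => `|w x| * expR `|dotv (2 *: xi) (a x)|) by exact: expint_abs.
rewrite /mgf -RintegralB//.
rewrite mulrC -RintegralZl//; last exact: integZ.
have ib := integB (ew (s *: xi)) i1.
apply: le_trans (le_normr_Rintegral measurableT ib) _.
apply: le_Rintegral => //; [exact: integ_norm|by apply: integZ; exact: integZ|].
move=> x _; set y := dotv xi (a x).
have -> : w x * expR (dotv (s *: xi) (a x)) - \sum_(k < M) s ^+ k / k`!%:R * (w x * y ^+ k) =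
   w x * (expR (s * y) - \sum_(k < M) (s * y) ^+ k / k`!%:R).
  rewrite dotvZl mulrBr mulr_sumr; congr (_ - _); apply: eq_bigr => k _; rewrite exprMn; ring.
rewrite normrM dotvZl -/y.
have -> : `|s| ^+ M * (M`!%:R * (`|w x| * expR `|2 * y|)) =
  `|w x| * (`|s| ^+ M * (M`!%:R * expR `|2 * y|)) by ring.
rewrite ler_wpM2l//; apply: le_trans (exp_rem _ _) _.
rewrite normrM exprMn -mulrA ler_wpM2l ?exprn_ge0//.
have -> : `|2 * y| = `|y| + `|y| by rewrite normrM normr_nat mulr_natl mulr2n.
rewrite expRD mulrA; apply: ler_pM; rewrite ?exprn_ge0 ?expR_ge0//; first exact: expR_pow_le.
by rewrite ler_expR ler_piMl.
Qed.
End mgf.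

(** The moments are the Taylor coefficients of the Laplace transform along
    lines. *)
Lemma mgf_agree {d1 d2} {T1 : measurableType d1} {T2 : measurableType d2} {R : realType} {n : nat}
    (m1 : {measure set T1 -> \bar R}) (m2 : {measure set T2 -> \bar R})
    (a1 : T1 -> 'cV[R]_n) (a2 : T2 -> 'cV[R]_n) (w1 : T1 -> R) (w2 : T2 -> R) (g : 'cV[R]_n -> R) :
  measurable_fun setT a1 -> measurable_fun setT a2 ->
  expint m1 a1 w1 -> expint m2 a2 w2 ->
  (forall xi, mgf m1 a1 w1 xi = mgf m2 a2 w2 xi) ->
  measurable_fun setT g ->
  integ m1 (fun x => w1 x * g (a1 x)) -> integ m2 (fun x => w2 x * g (a2 x)) ->
  \int[m1]_x (w1 x * g (a1 x)) = \int[m2]_x (w2 x * g (a2 x)).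
Proof.
move=> ma1 ma2 ew1 ew2 E mg i1 i2.
apply: (moment_agree ma1 ma2 ew1 ew2) => // xi k.
have j1 := jet_mgf ma1 ew1 xi.
have j2 := jet_mgf ma2 ew2 xi.
have := jet_uniq (eq_jet (fun s => E (s *: xi)) j1) j2 k.
by rewrite /mom => /(mulIf _); apply; rewrite invr_eq0 pnatr_eq0 -lt0n fact_gt0.
Qed.

(** * The matrix exponential of a matrix with a single eigenvalue *)

Section single_eigenvalue.
Context {R : realType} {n : nat}.
Variable B : 'M[R]_n.+1.
Hypothesis B_stable : forall z : R[i], ceigenvalue B z -> complex.Re z < 0.
Hypothesis B_single : exists l : R[i], forall z : R[i], ceigenvalue B z <-> z = l.

(** The eigenvalue is real because the characteristic polynomial is real, so
    that its conjugate is an eigenvalue as well; the characteristic polynomial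
    is then a power of [X - lam] and Cayley-Hamilton applies. *)
Lemma single_eigenvalue_nilpotent :
  exists2 lam : R, lam < 0 & (B - lam%:M) ^+ n.+1 = 0.
Proof.
have [l Hl] := B_single.
pose Bc := map_mx (real_complex R) B.
have Hr z : root (char_poly Bc) z <-> z = l by rewrite -eigenvalue_root_char; exact: Hl.
have cB : map_poly (real_complex R) (char_poly B) = char_poly Bc by rewrite map_char_poly.
have l_real : l = (complex.Re l)%:C%C.
  have : root (char_poly Bc) (conjc l).
    rewrite -complex_root_conj -cB -map_poly_comp.
    have -> : map_poly (conjc \o real_complex R) (char_poly B) = map_poly (real_complex R) (char_poly B).
      by apply: eq_map_poly => x; exact: conjc_real.
    by rewrite cB; apply/Hr.
  move/Hr; case: (l) => a b [] /eqP; rewrite eq_sym -addr_eq0 -mulr2n mulrn_eq0/= => /eqP -> //.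
have [rs rsE] := closed_field_poly_normal (char_poly Bc).
move: rsE; rewrite (monicP (char_poly_monic Bc)) scale1r => rsE.
have rs_l z : z \in rs -> z = l.
  by move=> zr; apply/Hr; rewrite rsE root_prod_XsubC.
have sz : size rs = n.+1.
  by apply: eq_add_S; rewrite -(size_prod_XsubC rs id) -rsE size_char_poly.
have rsn : rs = nseq n.+1 l.
  by rewrite -sz; apply/all_pred1P/allP => z /rs_l ->; rewrite /= eqxx.
set lam := complex.Re l in l_real.
have cBE : char_poly B = ('X - lam%:P) ^+ n.+1.
  apply: (map_poly_inj (real_complex R)); rewrite cB rsE rsn big_nseq iter_mulr_1.
  by rewrite rmorphXn rmorphB /= map_polyX map_polyC/= -l_real.
exists lam; first by apply: B_stable; exact/Hl.
have := Cayley_Hamilton B; rewrite cBE rmorphXn rmorphB /= horner_mx_X horner_mx_C.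
by [].
Qed.
End single_eigenvalue.

Section nilexp.
Context {R : realType} {n : nat}.
Implicit Types M : 'M[R]_n.+1.

(** The exponential of [s *: M] for nilpotent [M]. *)
Definition nilexp M (s : R) : 'M[R]_n.+1 := \sum_(k < n.+1) (s ^+ k / k`!%:R) *: M ^+ k.

Let expp (s : R) : {poly R} := \poly_(k < n.+1) (s ^+ k / k`!%:R).

Let nilexpE M s : nilexp M s = horner_mx M (expp s).
Proof.
rewrite /expp poly_def rmorph_sum/=; apply: eq_bigr => k _.
by rewrite horner_mxZ rmorphXn/= horner_mx_X.
Qed.

Lemma nilexpD M s t : M ^+ n.+1 = 0 -> nilexp M (s + t) = nilexp M s * nilexp M t.
Proof.
move=> M0; rewrite !nilexpE -rmorphM/=.
rewrite -[in RHS](poly_take_drop n.+1 (expp s * expp t)) rmorphD rmorphM/=.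
rewrite rmorphXn/= horner_mx_X M0 mulr0 addr0; congr (horner_mx M _).
apply/polyP => j; rewrite !coef_poly; case: ifP => // jn.
rewrite coefM exprDn mulr_suml; rewrite (reindex_inj rev_ord_inj)/=.
apply: eq_bigr => i _; rewrite !coef_poly subSS.
have ij : (i <= j)%N by rewrite -ltnS.
rewrite (leq_ltn_trans ij jn) (leq_ltn_trans (leq_subr _ _) jn) subKn//.
rewrite -(bin_fact ij) bin_sub// -mulr_natr !natrM.
have f0 k : (k`!%:R : R) != 0 by rewrite pnatr_eq0 -lt0n fact_gt0.
have b0 : ('C(j, i)%:R : R) != 0 by rewrite pnatr_eq0 -lt0n bin_gt0.
field; by rewrite b0 !f0.
Qed.

Lemma nilexp0 M : nilexp M 0 = 1.
Proof.
rewrite /nilexp big_ord_recl/= big1 ?addr0; last by move=> i _; rewrite expr0n/= mul0r scale0r.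
by rewrite expr0 !expr0 fact0 divr1 scale1r.
Qed.

Lemma trmx_exp M k : (M ^+ k)^T = M^T ^+ k.
Proof.
elim: k => [|k IH]; first by rewrite !expr0 trmx1.
by rewrite exprS [RHS]exprSr -[M * _]/(M *m _) trmx_mul IH.
Qed.

Lemma trmx_nilexp M s : (nilexp M s)^T = nilexp M^T s.
Proof.
by rewrite /nilexp linear_sum/=; apply: eq_bigr => k _; rewrite linearZ/= trmx_exp.
Qed.

(** The partial sums of the exponential series of [s *: A] are rearranged into
    [\sum_(j <= n) e_(m - j) (s ^ j / j!) M ^ j], with [e_m] the partial sums of
    [expR (lam * s)]. *)
Lemma mexp_single (A : 'M[R]_n.+1) lam s : (A - lam%:M) ^+ n.+1 = 0 ->
  mexp (s *: A) = expR (lam * s) *: nilexp (A - lam%:M) s.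
Proof.
set M := A - lam%:M => M0.
pose y := lam * s.
pose G j : 'M[R]_n.+1 := (s ^+ j / j`!%:R) *: M ^+ j.
have G0 j : (n < j)%N -> G j = 0.
  move=> nj; rewrite /G (_ : M ^+ j = 0) ?scaler0//.
  by rewrite -(subnK nj) exprD M0 mulr0.
have f0 k : (k`!%:R : R) != 0 by rewrite pnatr_eq0 -lt0n fact_gt0.
have term k : (k`!%:R)^-1 *: (s *: A) ^+ k = \sum_(j < k.+1) exp_coeff y (k - j)%N *: G j.
  have -> : s *: A = y%:M + s *: M.
    by rewrite /M scalerBr scale_scalar_mx /y (mulrC lam) addrC subrK.
  rewrite exprDn_comm; last by apply/esym; exact: scalar_mxC.
  rewrite scaler_sumr; apply: eq_bigr => j _.
  have jk : (j <= k)%N by rewrite -ltnS.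
  rewrite exprZn -rmorphXn/= -[_%:M * _]/(_%:M *m _) mul_scalar_mx.
  rewrite -[X in _ *: X]scaler_nat /G !scalerA /exp_coeff/=; congr (_ *: _).
  rewrite -(bin_fact jk) !natrM.
  have b0 : ('C(k, j)%:R : R) != 0 by rewrite pnatr_eq0 -lt0n bin_gt0.
  by field; rewrite b0 !f0.
have termN k : (k`!%:R)^-1 *: (s *: A) ^+ k = \sum_(j < n.+1) (if (j <= k)%N then exp_coeff y (k - j)%N else 0) *: G j.
  rewrite term.
  rewrite -(big_mkord xpredT (fun j => exp_coeff y (k - j)%N *: G j)).
  rewrite -(big_mkord xpredT (fun j => (if (j <= k)%N then exp_coeff y (k - j)%N else 0) *: G j)).
  pose F j := (if (j <= k)%N then exp_coeff y (k - j)%N else 0) *: G j.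
  have F0 m p : (forall j, (m <= j)%N -> F j = 0) -> (m <= p)%N -> \sum_(0 <= j < p) F j = \sum_(0 <= j < m) F j.
    move=> h mp; rewrite (big_cat_nat (leq0n m) mp)//= [X in _ + X]big_nat_cond [X in _ + X]big1 ?addr0// => j.
    by rewrite andbT => /andP[+ _]; exact: h.
  transitivity (\sum_(0 <= j < k.+1) F j).
    by apply: eq_big_nat => j /andP[_]; rewrite ltnS /F => ->.
  transitivity (\sum_(0 <= j < maxn n.+1 k.+1) F j).
    apply/esym/F0; last exact: leq_maxr.
    by move=> j kj; rewrite /F leqNgt kj/= scale0r.
  apply: F0; last exact: leq_maxl.
  by move=> j nj; rewrite /F G0// scaler0.
have ser m : series (fun k => (k`!%:R)^-1 *: (s *: A) ^+ k) m = \sum_(j < n.+1) series (exp_coeff y) (m - j)%N *: G j.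
  rewrite seriesEord/=; under eq_bigr do rewrite termN.
  rewrite exchange_big/=; apply: eq_bigr => j _; rewrite -scaler_suml; congr (_ *: _).
  elim: m => [|m IH]; first by rewrite big_ord0 sub0n seriesEord/= big_ord0.
  rewrite big_ord_recr/= IH; case: leqP => jm.
    by rewrite subSn// !seriesEord/= big_ord_recr.
  by rewrite addr0 (eqP (ltnW jm : (m - j == 0)%N)) (eqP (jm : (m.+1 - j == 0)%N)).
rewrite /mexp; apply: cvg_lim; first exact: norm_hausdorff.
rewrite (funext ser) /nilexp scaler_sumr.
have cj (j : 'I_n.+1) : (fun m => series (exp_coeff y) (m - j)%N *: G j) @ \oo --> expR y *: G j.
  apply: cvgZr_tmp; rewrite -(cvg_shiftn j).
  rewrite (_ : (fun m => _) = series (exp_coeff y)); last by apply/funext => m; rewrite /= addnK.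
  exact: is_cvg_series_exp_coeff.
have H (r : seq 'I_n.+1) : (fun m => \sum_(j <- r) series (exp_coeff y) (m - j)%N *: G j) @ \oo -->
   \sum_(j <- r) expR y *: G j.
  elim: r => [|j r IH].
    rewrite big_nil (_ : (fun m => _) = fun=> 0); first exact: cvg_cst.
    by apply/funext => m; rewrite big_nil.
  rewrite big_cons (_ : (fun m => _) = fun m => series (exp_coeff y) (m - j)%N *: G j +
    \sum_(j <- r) series (exp_coeff y) (m - j)%N *: G j); first exact: cvgD.
  by apply/funext => m; rewrite big_cons.
exact: H.
Qed.
End nilexp.

(** * Exponential polynomials *)

Section expoly.
Context {R : realType}.
Implicit Types (c : R) (f g : R -> R).

(** Functions of this form are integrable on the half-line when [c < 0], which
    is what makes the covariance at infinite time converge. *)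
Definition expoly c f := exists p : {poly R}, forall s, f s = expR (c * s) * p.[s].

Lemma expolyZ k c f : expoly c f -> expoly c (fun s => k * f s).
Proof.
by case=> p pE; exists (k *: p) => s; rewrite pE hornerZ mulrCA.
Qed.

Lemma expolyM c1 c2 f g : expoly c1 f -> expoly c2 g -> expoly (c1 + c2) (fun s => f s * g s).
Proof.
case=> p pE [q qE]; exists (p * q) => s.
by rewrite pE qE hornerM mulrDl expRD mulrACA.
Qed.

Lemma expoly_sum (I : Type) (r : seq I) c (f : I -> R -> R) : (forall i, expoly c (f i)) ->
  expoly c (fun s => \sum_(i <- r) f i s).
Proof.
move=> ef; elim: r => [|i r [q qE]].
  by exists 0 => s; rewrite big_nil horner0 mulr0.
have [p pE] := ef i; exists (p + q) => s.
by rewrite big_cons qE pE hornerD mulrDr.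
Qed.

Lemma expoly_shift c f t : expoly c f -> expoly c (fun s => f (s + t)).
Proof.
case=> p pE; exists (expR (c * t) *: (p \Po ('X + t%:P))) => s.
rewrite pE mulrDr expRD hornerZ horner_comp hornerD hornerX hornerC; ring.
Qed.

Lemma expoly_meas c f : expoly c f -> measurable_fun setT f.
Proof.
case=> p pE; rewrite (funext pE); apply: measurable_funM.
  by apply: measurableT_comp => //; exact: measurable_funM.
rewrite (_ : horner p = fun s => \sum_(i < size p) p`_i * s ^+ i); last by apply/funext => s; rewrite horner_coef.
apply: measurable_sum => i; apply: measurable_funM => //; exact: measurable_funX.
Qed.

Lemma expoly_bound c f : c < 0 -> expoly c f ->
  exists C, forall s, 0 <= s -> `|f s| <= C * expR (c / 2 * s).
Proof.
move=> c0 [p pE]; pose b := - c / 2; have b0 : 0 < b by rewrite divr_gt0// oppr_gt0.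
exists (\sum_(i < size p) `|p`_i| * (i`!%:R / b ^+ i)) => s s0.
rewrite pE normrM ger0_norm ?expR_ge0//.
have -> : c / 2 * s = c * s + b * s by rewrite /b; field.
rewrite expRD mulrCA ler_wpM2l ?expR_ge0// horner_coef.
apply: le_trans (ler_norm_sum _ _ _) _; rewrite mulr_suml; apply: ler_sum => i _.
rewrite normrM normrX (ger0_norm s0) -mulrA ler_wpM2l// mulrAC.
rewrite ler_pdivlMr ?exprn_gt0// -exprMn mulrC.
by apply: expR_pow_le; rewrite mulr_ge0// ltW.
Qed.

Lemma expoly_integ c f : c < 0 -> expoly c f ->
  lebesgue_measure.-integrable `[0%R, +oo[%classic (EFin \o f).
Proof.
move=> c0 ef; have [C hC] := expoly_bound c0 ef.
pose r := - c / 2; have r0 : 0 < r by rewrite divr_gt0// oppr_gt0.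
have ip := integrable_exponential_pdf r0.
have ip' : lebesgue_measure.-integrable `[0%R, +oo[%classic (fun x => (C / r * exponential_pdf r x)%:E).
  apply: (integrableS measurableT) => //.
  by apply: (integZ (m := lebesgue_measure) (C / r) (f := exponential_pdf r)).
apply: le_integrable ip' => //.
  by apply/measurable_EFinP; apply: measurable_funTS; exact: expoly_meas ef.
move=> s /=; rewrite in_itv/= andbT => s0; rewrite lee_fin.
apply: le_trans (hC _ s0) _; apply: le_trans (ler_norm _).
rewrite exponential_pdfE//= mulrA mulfVK ?gt_eqF//.
by rewrite /r; have -> : - (- c / 2) * s = c / 2 * s by field.
Qed.
End expoly.

(** * The covariance matrices *)

Section translation.
Context {R : realType}.
Local Notation leb := (@lebesgue_measure R).

Lemma measurable_translate (t : R) :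
  measurable_fun setT (fun x : measurableTypeR R => (x + t : measurableTypeR R)).
Proof. exact: measurable_funD. Qed.

Lemma lebesgue_translate (t : R) (A : set (measurableTypeR R)) : measurable A ->
  leb A = pushforward leb (fun x : measurableTypeR R => (x + t : measurableTypeR R)) A.
Proof.
apply: (@lebesgue_measure_unique R
  (measure_function_pushforward__canonical__measure_function_Measure leb (measurable_translate t))).
move=> _ [[a b]] _ <-; rewrite /= /pushforward/=.
have -> : (fun x : measurableTypeR R => (x + t : measurableTypeR R)) @^-1` `]a, b]%classic = `]a - t, b - t]%classic.
  by apply/seteqP; split=> x /=; rewrite !in_itv/= ltrBlDr lerBrDr.
rewrite !lebesgue_measure_itv/= !lte_fin ltrD2r; case: ifP => // _.
by rewrite -!EFinB; congr EFin; ring.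
Qed.

Lemma Rintegral_translate (t : R) (f : R -> R) : measurable_fun setT f ->
  integ leb (fun x => f (x + t)) -> \int[leb]_x f x = \int[leb]_x f (x + t).
Proof.
move=> mf it; rewrite /Rintegral; congr fine.
rewrite (@eq_measure_integral _ _ _ _ (measure_function_pushforward__canonical__measure_function_Measure leb (measurable_translate t)))//; last first.
  by move=> A mA _; exact: lebesgue_translate.
by rewrite (integral_pushforward (measurable_translate t)) ?preimage_setT//; exact/measurable_EFinP.
Qed.
End translation.

Section covariance.
Context {R : realType} {n : nat}.
Variables (Q B : 'M[R]_n.+1) (lam : R).
Hypotheses (Qp : sym_posdef Q) (lam0 : lam < 0) (B0 : (B - lam%:M) ^+ n.+1 = 0).
Local Notation leb := (@lebesgue_measure R).
Local Notation E s := (mexp (s *: B)).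

Lemma mexpE s : E s = expR (lam * s) *: nilexp (B - lam%:M) s.
Proof. exact: mexp_single. Qed.

Lemma mexp_add s t : E (s + t) = E s *m E t.
Proof.
rewrite !mexpE nilexpD// -scalemxAl -scalemxAr scalerA -expRD -mulrDr.
by rewrite [nilexp _ s *m _]/(_ * _).
Qed.

Lemma mexp_zero : E 0 = 1%:M.
Proof. by rewrite mexpE mulr0 expR0 scale1r nilexp0. Qed.

Lemma mexp_unit s : E s \in unitmx.
Proof.
have : E s *m E (- s) = 1%:M by rewrite -mexp_add subrr mexp_zero.
by move/mulmx1_unit => [].
Qed.

Lemma trmx_mexp s : mexp (s *: B^T) = (E s)^T.
Proof.
have BT : (B^T - lam%:M) = (B - lam%:M)^T by rewrite linearB/= tr_scalar_mx.
rewrite (@mexp_single _ _ _ lam); last by rewrite BT -trmx_exp B0 trmx0.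
by rewrite mexpE linearZ/= trmx_nilexp BT.
Qed.

Lemma expoly_mexp i j : expoly lam (fun s => E s i j).
Proof.
pose M := B - lam%:M.
exists (\poly_(k < n.+1) ((M ^+ k) i j / k`!%:R)) => s.
rewrite mexpE mxE; congr (_ * _); rewrite horner_poly /nilexp summxE.
by apply: eq_bigr => k _; rewrite mxE mulrC mulrA mulrAC.
Qed.

Definition OUk (s : R) : 'M[R]_n.+1 := E s *m Q *m (E s)^T.

Lemma expoly_OUk i j : expoly (lam + lam) (fun s => OUk s i j).
Proof.
rewrite (_ : (fun s => _) = fun s => \sum_a (\sum_b E s i b * Q b a) * E s j a).
  apply: expoly_sum => a; apply: expolyM; last exact: expoly_mexp.
  apply: expoly_sum => b; have [p pE] := expolyZ (Q b a) (expoly_mexp i b).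
  by exists p => s; rewrite -pE mulrC.
by apply/funext => s; rewrite mxE; apply: eq_bigr => a _; rewrite !mxE.
Qed.

Definition OUdom (t : \bar R) : set (measurableTypeR R) := [set s : R | (0 <= s%:E <= t)%E].

Lemma OUdomy : OUdom +oo = `[0, +oo[%classic.
Proof.
apply/seteqP; split => s /=; rewrite in_itv/= andbT => s0; last by rewrite /OUdom/= lee_fin s0 leey.
by have /andP[] : (0 <= s%:E <= +oo)%E := s0; rewrite lee_fin.
Qed.

Lemma OUdomE (t : R) : OUdom t%:E = `[0, t]%classic.
Proof. by apply/seteqP; split => s /=; rewrite in_itv/= ?lee_fin. Qed.

Lemma measurable_OUdom t : measurable (OUdom t).
Proof.
case: t => [t| |]; rewrite ?OUdomE ?OUdomy//.
rewrite (_ : OUdom -oo = set0)//; apply/seteqP; split => // s /=.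
by case/andP => _; rewrite leeNy_eq.
Qed.

Lemma OU_covE t i j : OU_cov Q B t i j = \int[leb]_(s in OUdom t) OUk s i j.
Proof.
by rewrite mxE; apply: eq_Rintegral => s _; rewrite trmx_mexp.
Qed.

Lemma OUk_integ t i j : leb.-integrable (OUdom t) (fun s => (OUk s i j)%:E).
Proof.
apply: (integrableS (measurable_OUdom +oo) (measurable_OUdom t)).
- move=> s Ds; have /andP[s0 _] : (0 <= s%:E <= t)%E := Ds.
  by suff : (0 <= s%:E <= +oo)%E by []; rewrite s0 leey.
- rewrite OUdomy; apply: (@expoly_integ _ (lam + lam) (fun s => OUk s i j)); last exact: expoly_OUk.
  by have := lam0; lra.
Qed.

Lemma OUk_sym s : (OUk s)^T = OUk s.
Proof. by rewrite /OUk !trmx_mul trmxK Qp.1 mulmxA. Qed.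

Lemma OU_cov_sym t : (OU_cov Q B t)^T = OU_cov Q B t.
Proof.
apply/matrixP => i j; rewrite mxE !OU_covE; apply: eq_Rintegral => s _.
by rewrite -[in LHS]OUk_sym mxE.
Qed.

Lemma quad_formEE (A : 'M[R]_n.+1) x : quad_form A x = \sum_i \sum_j (x i 0 * x j 0) * A i j.
Proof.
rewrite quad_formE dotvE; apply: eq_bigr => i _; rewrite mxE mulr_sumr.
by apply: eq_bigr => j _; ring.
Qed.

Lemma quad_OU_cov t x : leb.-integrable (OUdom t) (fun s => (quad_form (OUk s) x)%:E) /\
  quad_form (OU_cov Q B t) x = \int[leb]_(s in OUdom t) quad_form (OUk s) x.
Proof.
have mD := measurable_OUdom t.
have i1 i j : leb.-integrable (OUdom t) (fun s => (x i 0 * x j 0 * OUk s i j)%:E).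
  by have := integrableZl mD (x i 0 * x j 0) (OUk_integ t i j).
have i2 i := Rintegral_sum mD (index_enum 'I_n.+1) (i1 i).
have i3 := Rintegral_sum mD (index_enum 'I_n.+1) (fun i => (i2 i).1).
have e : quad_form^~ x \o OUk = fun s => \sum_i \sum_j (x i 0 * x j 0) * OUk s i j.
  by apply/funext => s /=; rewrite quad_formEE.
split; first by have := i3.1; congr (integrable leb _ _); apply/funext => s; rewrite quad_formEE.
transitivity (\int[leb]_(s in OUdom t) (\sum_i \sum_j (x i 0 * x j 0) * OUk s i j)); last first.
  by apply: eq_Rintegral => s _; rewrite quad_formEE.
rewrite i3.2 quad_formEE; apply: eq_bigr => i _; rewrite (i2 i).2; apply: eq_bigr => j _.
by rewrite OU_covE RintegralZl//; exact: OUk_integ.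
Qed.

Lemma quad_OUk_gt0 s x : x != 0 -> 0 < quad_form (OUk s) x.
Proof.
move=> x0; have -> : quad_form (OUk s) x = quad_form Q ((E s)^T *m x).
  by rewrite !quad_formE /OUk -!mulmxA dotv_mulmxr.
apply: Qp.2; apply: contraNneq x0 => h.
have uT : (E s)^T \in unitmx by rewrite unitmx_tr mexp_unit.
by rewrite -(mulKmx uT x) h mulmx0.
Qed.

(** The quadratic form is the integral of a function that is positive at every
    time, over a set of times of positive measure. *)
Lemma OU_cov_posdef t : (0 < t)%E -> sym_posdef (OU_cov Q B t).
Proof.
move=> t0; split=> [|x x0]; first exact: OU_cov_sym.
have mD := measurable_OUdom t.
have [ig ->] := quad_OU_cov t x.
have g0 s : OUdom t s -> 0 <= quad_form (OUk s) x by move=> _; exact/ltW/quad_OUk_gt0.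
rewrite lt_neqAle Rintegral_ge0// andbT; apply/negP => /eqP /esym h.
have h2 : (\int[leb]_(s in OUdom t) `|(quad_form (OUk s) x)%:E| = 0)%E.
  transitivity (\int[leb]_(s in OUdom t) (quad_form (OUk s) x)%:E)%E.
    by apply: eq_integral => s /set_mem Ds; rewrite gee0_abs// lee_fin g0.
  by rewrite -[LHS]fineK ?(integrable_fin_num mD ig)// [fine _]h.
have mg : measurable_fun (OUdom t) (fun s => (quad_form (OUk s) x)%:E) by exact: measurable_int ig.
have [N [mN N0 DN]] := (ae_eq_integral_abs leb mD mg).1 h2.
have DsN : OUdom t `<=` N.
  move=> s Ds; apply: DN => /= /(_ Ds) [] /eqP; rewrite gt_eqF//; exact: quad_OUk_gt0.
have [d d0 dD] : exists2 d : R, 0 < d & `[0, d]%classic `<=` OUdom t.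
  case: t t0 {mD ig g0 h h2 mg DN DsN} => [t| |] t0 //.
    by exists t => //; rewrite OUdomE.
  by exists 1 => //; rewrite OUdomy => s /=; rewrite !in_itv/= => /andP[->].
have : (leb `[0%R, d]%classic <= leb N)%E.
  by apply: le_measure; rewrite ?inE//; exact: subset_trans DsN.
by rewrite N0 lebesgue_measure_itv/= lte_fin d0 oppr0 adde0 lee_fin leNgt d0.
Qed.

(** The integral over [[0, +oo[] is split at [t] and the tail is translated to
    [[0, +oo[], where the integrand factors through [mexp (t *: B)]. *)
Lemma OU_cov_invariant t : 0 <= t ->
  OU_cov Q B +oo = OU_cov Q B t%:E + E t *m OU_cov Q B +oo *m (E t)^T.
Proof.
move=> t0; apply/matrixP => i j; rewrite [RHS]mxE !OU_covE; apply/eqP.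
rewrite addrC -subr_eq OUdomy OUdomE; apply/eqP.
have iy a b : leb.-integrable `[0%R, +oo[%classic (fun s => (OUk s a b)%:E).
  by rewrite -OUdomy; exact: OUk_integ.
rewrite Rintegral_itvB//; last exact: iy.
have ec a b := expoly_OUk a b.
have cc : lam + lam < 0 by have := lam0; lra.
have ist : leb.-integrable `[0%R, +oo[%classic (fun s => (OUk (s + t) i j)%:E).
  exact: (expoly_integ cc (expoly_shift t (ec i j))).
transitivity (\int[leb]_(s in `[0%R, +oo[) OUk (s + t) i j).
  rewrite -(Rintegral_itv_obnd_cbnd (r := 0)); last first.
    by apply: integrableS ist => //; apply: subset_itvr; rewrite bnd_simp.
  rewrite [LHS]Rintegral_mkcond [RHS]Rintegral_mkcond.
  have eqp : (fun s => ((fun s => OUk s i j) \_ `]t, +oo[%classic) (s + t)) =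
    (fun s => OUk (s + t) i j) \_ `]0, +oo[%classic.
    apply/funext => s; rewrite !patchE.
    have -> : (s + t \in `]t, +oo[%classic) = (s \in `]0, +oo[%classic).
      by rewrite !mem_setE !in_itv/= !andbT -{1}(add0r t) ltrD2r.
    by [].
  rewrite [LHS](@Rintegral_translate _ t).
  - by rewrite eqp.
  - apply/(measurable_restrictT _ _).1 => //; apply: measurable_funTS; exact: expoly_meas (ec i j).
  - rewrite eqp; have : leb.-integrable `]0%R, +oo[%classic (fun s => (OUk (s + t) i j)%:E).
      by apply: integrableS ist => //; apply: subset_itvr; rewrite bnd_simp.
    move=> ipos; rewrite (_ : EFin \o _ = (fun s => (OUk (s + t) i j)%:E) \_ `]0, +oo[%classic).
      by apply/(integrable_mkcond _ _).1.
    by apply/funext => s; rewrite /= !patchE; case: ifP.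
have OUkD s : OUk (s + t) = E t *m OUk s *m (E t)^T.
  by rewrite /OUk addrC mexp_add trmx_mul !mulmxA.
have mD : measurable (`[0%R, +oo[%classic : set (measurableTypeR R)) by [].
have i1 a b : leb.-integrable `[0%R, +oo[%classic (fun s => ((E t i a * E t j b) * OUk s a b)%:E).
  by have := integrableZl mD (E t i a * E t j b) (iy a b).
have i2 a := Rintegral_sum mD (index_enum 'I_n.+1) (i1 a).
have i3 := Rintegral_sum mD (index_enum 'I_n.+1) (fun a => (i2 a).1).
transitivity (\int[leb]_(s in `[0, +oo[) (\sum_a \sum_b (E t i a * E t j b) * OUk s a b)).
  apply: eq_Rintegral.
  move=> s _; rewrite OUkD mxE exchange_big/=; apply: eq_bigr => b _; rewrite !mxE mulr_suml.
  by apply: eq_bigr => a _; ring.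
rewrite i3.2.
transitivity (\sum_a \sum_b (E t i a * E t j b) * OU_cov Q B +oo a b).
  apply: eq_bigr => a _; rewrite (i2 a).2; apply: eq_bigr => b _.
  by rewrite OU_covE OUdomy RintegralZl//; exact: iy.
rewrite [RHS]mxE exchange_big/=; apply: eq_bigr => b _; rewrite !mxE mulr_suml.
by apply: eq_bigr => a _; ring.
Qed.
End covariance.

(** * Equality in law *)

Section same_law.
Context {d1 d2} {T1 : measurableType d1} {T2 : measurableType d2} {R : realType} {n : nat}.
Variables (m1 : probability T1 R) (m2 : probability T2 R).
Variables (a1 : T1 -> 'cV[R]_n) (a2 : T2 -> 'cV[R]_n).
Hypotheses (ma1 : measurable_fun setT a1) (ma2 : measurable_fun setT a2).
Hypothesis e1 : forall xi, integ m1 (fun x => expR (dotv xi (a1 x))).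
Hypothesis e2 : forall xi, integ m2 (fun x => expR (dotv xi (a2 x))).
Hypothesis e12 : forall xi, \int[m1]_x expR (dotv xi (a1 x)) = \int[m2]_x expR (dotv xi (a2 x)).

(** The case of the constant weight [1] in [mgf_agree], applied to indicators. *)
Lemma same_law_meas A : measurable A -> m1 (a1 @^-1` A) = m2 (a2 @^-1` A).
Proof.
move=> mA.
have H d (T : measurableType d) (m : probability T R) (a : T -> 'cV[R]_n) (ma : measurable_fun setT a) :
  [/\ measurable (a @^-1` A), integ m (fun x => 1 * \1_A (a x)) & (\int[m]_x (1 * \1_A (a x)))%:E = m (a @^-1` A)].
  have mpA : measurable (a @^-1` A) by rewrite -[X in measurable X]setTI; exact: ma.
  have e : (fun x => 1 * \1_A (a x)) = \1_(a @^-1` A) :> (T -> R).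
    by apply/funext => x; rewrite mul1r.
  rewrite e; split => //; first exact: integrable_indic.
  rewrite /Rintegral fineK ?integral_indic ?setIT//.
  exact: fin_num_measure.
have [_ i1 <-] := H _ _ m1 a1 ma1; have [_ i2 <-] := H _ _ m2 a2 ma2.
congr EFin; apply: (mgf_agree ma1 ma2) => //.
- by move=> xi; under eq_fun do rewrite mul1r.
- by move=> xi; under eq_fun do rewrite mul1r.
- move=> xi; rewrite /mgf; under eq_Rintegral do rewrite mul1r.
  by under [RHS]eq_Rintegral do rewrite mul1r.
Qed.

Lemma same_law_ge0 (f : 'cV[R]_n -> \bar R) : measurable_fun setT f -> (forall x, 0 <= f x)%E ->
  (\int[m1]_x f (a1 x) = \int[m2]_x f (a2 x))%E.
Proof.
move=> mf f0; rewrite -(ge0_integral_image ma1)// -(ge0_integral_image ma2)//.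
by apply: eq_measure_integral => A mA _; exact: same_law_meas.
Qed.

Lemma same_law_integ (g : 'cV[R]_n -> R) : measurable_fun setT g ->
  integ m2 (fun x => g (a2 x)) -> integ m1 (fun x => g (a1 x)).
Proof.
move=> mg /integrableP [_ h]; apply/integrableP; split.
  by apply/measurable_EFinP; exact: measurableT_comp.
apply: le_lt_trans h; rewrite le_eqVlt; apply/orP; left; apply/eqP.
apply: (same_law_ge0 (f := fun x => `|(g x)%:E|%E)) => //.
by apply: measurableT_comp => //; exact/measurable_EFinP.
Qed.

Lemma same_law_Rintegral (g : 'cV[R]_n -> R) : measurable_fun setT g ->
  \int[m1]_x g (a1 x) = \int[m2]_x g (a2 x).
Proof.
move=> mg; have mEg := (measurable_EFinP setT g).2 mg.
rewrite /Rintegral; congr fine.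
rewrite -[LHS]/(\int[m1]_x (((EFin \o g) \o a1) x))%E -[RHS]/(\int[m2]_x (((EFin \o g) \o a2) x))%E.
rewrite integralE [RHS]integralE.
have [mp mn] := (measurable_funepos mEg, measurable_funeneg mEg).
congr (_ - _)%E.
- under eq_integral do rewrite funepos_comp.
  under [RHS]eq_integral do rewrite funepos_comp.
  exact: (same_law_ge0 mp (fun x => funepos_ge0 _ x)).
- under eq_integral do rewrite funeneg_comp.
  under [RHS]eq_integral do rewrite funeneg_comp.
  exact: (same_law_ge0 mn (fun x => funeneg_ge0 _ x)).
Qed.
End same_law.

Section gaussian_product.
Context {R : realType} {n : nat}.
Variables (S1 S2 : 'M[R]_n) (p1 : sym_posdef S1) (p2 : sym_posdef S2).
Local Notation g1 := (gaussian_prob p1).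
Local Notation g2 := (gaussian_prob p2).

Lemma gaussian_product_exp (al be : 'cV[R]_n) :
  integ (g1 \x g2)%E (fun p => expR (dotv al p.1 + dotv be p.2)) /\
  \int[(g1 \x g2)%E]_p expR (dotv al p.1 + dotv be p.2) =
    expR (2^-1 * (quad_form S1 al + quad_form S2 be)).
Proof.
have mf : measurable_fun setT (fun p : 'cV[R]_n * 'cV[R]_n => (expR (dotv al p.1 + dotv be p.2))%:E).
  apply/measurable_EFinP; apply: measurableT_comp => //; apply: measurable_funD.
  - exact: (measurableT_comp (measurable_dotv al) measurable_fst).
  - exact: (measurableT_comp (measurable_dotv be) measurable_snd).
have E : (\int[(g1 \x g2)%E]_p (expR (dotv al p.1 + dotv be p.2))%:E =
    (expR (2^-1 * (quad_form S1 al + quad_form S2 be)))%:E)%E.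
  rewrite fubini_tonelli1//= /fubini_F/=.
  transitivity (\int[g1]_x ((expR (2^-1 * quad_form S2 be))%:E * (expR (dotv al x))%:E))%E.
    apply: eq_integral => x _; under eq_integral do rewrite expRD EFinM.
    rewrite ge0_integralZl ?lee_fin ?expR_ge0//; last first.
      by apply/measurable_EFinP; apply: measurableT_comp => //; exact: measurable_dotv.
    by rewrite gaussian_mgf// muleC.
  rewrite ge0_integralZl ?lee_fin ?expR_ge0//; last first.
    by apply/measurable_EFinP; apply: measurableT_comp => //; exact: measurable_dotv.
  by rewrite gaussian_mgf// -EFinM -expRD mulrDr addrC.
split; last by rewrite /Rintegral E.
apply/integrableP; split => //.
under eq_integral do rewrite gee0_abs ?lee_fin ?expR_ge0//.
by rewrite E ltry.
Qed.
End gaussian_product.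

(** * The normalised Laplace transform of a square-integrable function *)

Section phi.
Context {R : realType} {n : nat}.
Variables (S : 'M[R]_n) (pS : sym_posdef S).
Local Notation gam := (gaussian_prob pS).
Local Notation q := (quad_form S).
Implicit Types (w u v : 'cV[R]_n -> R) (eta : 'cV[R]_n).

Definition sqint w := measurable_fun setT w /\ integ gam (fun x => w x ^+ 2).

Lemma quad_formZ k eta : q (k *: eta) = k ^+ 2 * q eta.
Proof. by rewrite !quad_formE -scalemxAr dotvZl dotvZr mulrA expr2. Qed.

Lemma quad_formD eta xi : q (eta + xi) = q eta + 2 * dotv xi (S *m eta) + q xi.
Proof.
rewrite !quad_formE mulmxDr !dotvDl !dotvDr.
have -> : dotv eta (S *m xi) = dotv xi (S *m eta) by rewrite dotv_mulmxr pS.1 dotvC.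
ring.
Qed.

Lemma ler_prod_sq (a b : R) : `|a * b| <= a ^+ 2 + b ^+ 2.
Proof.
rewrite normrM -(real_normK (num_real a)) -(real_normK (num_real b)).
have := sqr_ge0 (`|a| - `|b|); have := sqr_ge0 (`|a| + `|b|); lra.
Qed.

Lemma sqint_exp eta : sqint (fun x => expR (dotv eta x)).
Proof.
split; first by apply: measurableT_comp => //; exact: measurable_dotv.
have := integ_gaussian_exp pS (2 *: eta); congr (integrable _ _ _).
by apply/funext => x; rewrite /= dotvZl expRM_natl.
Qed.

Lemma sqint_expint w : sqint w -> expint gam id w.
Proof.
move=> [mw iw] eta.
apply: (@integ_le _ _ _ _ (fun x => w x ^+ 2 + expR (dotv (2 *: eta) x))).
- by apply: measurable_funM => //; apply: measurableT_comp => //; exact: measurable_dotv.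
- by apply: integD => //; exact: integ_gaussian_exp.
- move=> x; rewrite dotvZl expRM_natl.
  exact: ler_prod_sq.
Qed.

Lemma sqintM_integ u v : sqint u -> sqint v -> integ gam (fun x => u x * v x).
Proof.
move=> [mu iu] [mv iv].
apply: (@integ_le _ _ _ _ (fun x => u x ^+ 2 + v x ^+ 2)).
- exact: measurable_funM.
- exact: integD.
- by move=> x; exact: ler_prod_sq.
Qed.

Local Notation mgfg := (mgf gam id).
Local Notation momg := (mom gam id).

(** The factor [expR (- 2^-1 * q eta)] makes [phi] of a constant function
    constant, and makes the semigroup act by a linear substitution of [eta]
    alone (see [phi_mehler_op]). *)
Definition phi w eta := mgfg w eta * expR (- 2^-1 * q eta).

(** The Taylor coefficients of [s |-> phi w (s *: eta)] ([jet_phi]), or,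
    equivalently, the pairing of [w] with a Hermite polynomial ([hcoeffE]). *)
Definition hcoeff w eta := cauchy_prod (momg w eta) (sqexp_coeff (- 2^-1 * q eta)).

Lemma jet_phi w eta : sqint w -> jet (fun s => phi w (s *: eta)) (hcoeff w eta).
Proof.
move=> sw; have jm := jet_mgf (@measurable_id _ _ _) (sqint_expint sw) eta.
apply: eq_jet (jetM jm (jet_sqexp (- 2^-1 * q eta))) => s.
by rewrite /phi quad_formZ; congr (_ * expR _); ring.
Qed.

Lemma hcoeffZ w eta r j : sqint w -> `|r| <= 1 -> hcoeff w (r *: eta) j = r ^+ j * hcoeff w eta j.
Proof.
move=> sw r1.
have e : (fun s => phi w (s *: (r *: eta))) =1 (fun s => phi w ((r * s) *: eta)).
  by move=> s; rewrite scalerA mulrC.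
exact: (jet_uniq (eq_jet e (jet_phi (r *: eta) sw)) (jet_scale r1 (jet_phi eta sw)) j).
Qed.
End phi.

(** * Mehler's formula and orthogonality of homogeneous chaoses *)

Section mehler.
Context {R : realType} {n : nat}.
Variables (S : 'M[R]_n) (pS : sym_posdef S).
Local Notation gam := (gaussian_prob pS).
Local Notation q := (quad_form S).
Local Notation gam2 := (gam \x gam)%E.
Implicit Types (u v : 'cV[R]_n -> R).

(* any [0 < r < 1] would do; a Pythagorean triple keeps [s] rational *)
Let r : R := 3 / 5.
Let s : R := 4 / 5.
Let X (p : 'cV[R]_n * 'cV[R]_n) := p.1.
Let Z (p : 'cV[R]_n * 'cV[R]_n) := r *: p.1 + s *: p.2.

Let mX : measurable_fun setT X. Proof. exact: measurable_fst. Qed.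

Let mZ : measurable_fun setT Z.
Proof.
apply: measurable_fun_cVP => i; under eq_fun do rewrite !mxE.
apply: measurable_funD; apply: measurable_funM => //.
- exact: (measurableT_comp (measurable_cV_coord i) measurable_fst).
- exact: (measurableT_comp (measurable_cV_coord i) measurable_snd).
Qed.

Lemma measurable_col_mx d (T : measurableType d) (f g : T -> 'cV[R]_n) :
  measurable_fun setT f -> measurable_fun setT g ->
  measurable_fun setT (fun x => col_mx (f x) (g x)).
Proof.
move=> mf mg; apply: measurable_fun_cVP => i.
case: (split_ordP i) => j ->.
  under eq_fun do rewrite col_mxEu; exact: (measurableT_comp (measurable_cV_coord j) mf).
under eq_fun do rewrite col_mxEd; exact: (measurableT_comp (measurable_cV_coord j) mg).
Qed.

Lemma measurable_usubmx : measurable_fun setT (@usubmx R n n 1).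
Proof.
apply: measurable_fun_cVP => i; under eq_fun do rewrite mxE.
exact: measurable_cV_coord.
Qed.

Lemma measurable_dsubmx : measurable_fun setT (@dsubmx R n n 1).
Proof.
apply: measurable_fun_cVP => i; under eq_fun do rewrite mxE.
exact: measurable_cV_coord.
Qed.

Let expXZ (al be : 'cV[R]_n) :
  integ gam2 (fun p => expR (dotv al (X p) + dotv be (Z p))) /\
  \int[gam2]_p expR (dotv al (X p) + dotv be (Z p)) =
    expR (2^-1 * (q al + 2 * r * dotv be (S *m al) + q be)).
Proof.
have e p : dotv al (X p) + dotv be (Z p) = dotv (al + r *: be) p.1 + dotv (s *: be) p.2.
  by rewrite /Z dotvDr !dotvZr dotvDl !dotvZl addrA.
have [i1 i2] := gaussian_product_exp pS pS (al + r *: be) (s *: be).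
split; first by move: i1; congr (integrable _ _ _); apply/funext => p; rewrite /= e.
under eq_Rintegral do rewrite e.
rewrite i2 (quad_formD pS) !quad_formZ dotvZl; congr (expR (_ * _)).
by rewrite /r /s; field.
Qed.

Let XZ p := col_mx (X p) (Z p).
Let ZX p := col_mx (Z p) (X p).

Let dot_col (xi : 'cV[R]_(n + n)) (x y : 'cV[R]_n) :
  dotv xi (col_mx x y) = dotv (usubmx xi) x + dotv (dsubmx xi) y.
Proof. by rewrite -{1}(vsubmxK xi) /dotv tr_col_mx mul_row_col mxE. Qed.

(** [X] and [Z] are exchangeable: their joint Laplace transform is symmetric as
    [r ^ 2 + s ^ 2 = 1]. *)
Let law_XZ (g : 'cV[R]_(n + n) -> R) : measurable_fun setT g ->
  integ gam2 (fun p => g (ZX p)) ->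
  integ gam2 (fun p => g (XZ p)) /\ \int[gam2]_p g (XZ p) = \int[gam2]_p g (ZX p).
Proof.
move=> mg ig.
have mXZ : measurable_fun setT XZ by exact: measurable_col_mx.
have mZX : measurable_fun setT ZX by exact: measurable_col_mx.
have h1 xi : integ gam2 (fun p => expR (dotv xi (XZ p))).
  have [+ _] := expXZ (usubmx xi) (dsubmx xi).
  by congr (integrable _ _ _); apply/funext => p; rewrite /= /XZ dot_col.
have h2 xi : integ gam2 (fun p => expR (dotv xi (ZX p))).
  have [+ _] := expXZ (dsubmx xi) (usubmx xi).
  by congr (integrable _ _ _); apply/funext => p; rewrite /= /ZX dot_col addrC.
have h12 xi : \int[gam2]_p expR (dotv xi (XZ p)) = \int[gam2]_p expR (dotv xi (ZX p)).
  have [_ e1] := expXZ (usubmx xi) (dsubmx xi).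
  have [_ e2] := expXZ (dsubmx xi) (usubmx xi).
  under eq_Rintegral do rewrite dot_col.
  under [RHS]eq_Rintegral do rewrite dot_col addrC.
  rewrite e1 e2; congr (expR (_ * _)).
  have -> : dotv (dsubmx xi) (S *m usubmx xi) = dotv (usubmx xi) (S *m dsubmx xi).
    by rewrite dotv_mulmxr pS.1 dotvC.
  ring.
split; first exact: (same_law_integ mXZ mZX h1 h2 h12 mg ig).
exact: (same_law_Rintegral mXZ mZX h1 h2 h12 mg).
Qed.

Let expXZ_int u v : sqint pS u -> sqint pS v -> integ gam2 (fun p => u (Z p) * v (X p)) /\
  \int[gam2]_p (u (Z p) * v (X p)) = \int[gam2]_p (v (Z p) * u (X p)).
Proof.
move=> [mu iu] [mv iv].
have m1 : measurable_fun setT (fun z : 'cV[R]_(n + n) => usubmx z) by exact: measurable_usubmx.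
have m2 : measurable_fun setT (fun z : 'cV[R]_(n + n) => dsubmx z) by exact: measurable_dsubmx.
have iX (f : 'cV[R]_n -> R) : integ gam f -> integ gam2 (fun p => f (X p)).
  move=> fi; have mf := integ_meas fi; apply/integrable12ltyP.
    by apply/measurable_EFinP; exact: (measurableT_comp mf measurable_fst).
  rewrite (_ : (\int[gam]_x _)%E = \int[gam]_x `|(f x)%:E|)%E; first by case/integrableP: fi.
  apply: eq_integral => x _; rewrite /= integral_cst// (_ : _ setT = 1%E) ?mule1//.
  exact: probability_setT.
have iXX : integ gam2 (fun p => u (X p) ^+ 2) := iX _ iu.
have iXv : integ gam2 (fun p => v (X p) ^+ 2) := iX _ iv.
have iZ : integ gam2 (fun p => u (Z p) ^+ 2).
  have mg : measurable_fun setT (fun z : 'cV_(n + n) => u (dsubmx z) ^+ 2).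
    by apply: measurable_funX; exact: measurableT_comp.
  have ig : integ gam2 (fun p => u (dsubmx (ZX p)) ^+ 2).
    by move: iXX; congr (integrable _ _ _); apply/funext => p; rewrite /= col_mxKd.
  have [+ _] := law_XZ mg ig; congr (integrable _ _ _); apply/funext => p.
  by rewrite /= col_mxKd.
have iZX : integ gam2 (fun p => u (Z p) * v (X p)).
  apply: (@integ_le _ _ _ _ (fun p => u (Z p) ^+ 2 + v (X p) ^+ 2)).
  - by apply: measurable_funM; exact: measurableT_comp.
  - exact: integD.
  - by move=> p; exact: ler_prod_sq.
split => //.
have := @law_XZ (fun z => v (dsubmx z) * u (usubmx z)).
rewrite /XZ /ZX => /(_ _ _)[].
- by apply: measurable_funM; exact: measurableT_comp.
- move: iZX; congr (integrable _ _ _); apply/funext => p /=.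
  by rewrite col_mxKd col_mxKu mulrC.
- move=> _; under eq_Rintegral do rewrite col_mxKd col_mxKu.
  under [RHS]eq_Rintegral do rewrite col_mxKd col_mxKu mulrC.
  by move=> ->.
Qed.

Let momg := mom gam id.

(** The conditional expectation of [u Z] given [X] is [r ^ d * u X], obtained by
    comparing moments: the Laplace transform of [u Z] along [X] is
    [phi u (r *: eta) * exp (q eta / 2)], and [phi u] is homogeneous of degree
    [d] at the level of jets. *)
Lemma mehler_eigen u v d : sqint pS u -> sqint pS v ->
  (forall eta j, j != d -> hcoeff pS u eta j = 0) ->
  \int[gam2]_p (u (Z p) * v (X p)) = r ^+ d * \int[gam]_x (u x * v x).
Proof.
move=> su sv hd; have [mu iu] := su.
have eu := sqint_expint su.
have [i1 _] := expXZ_int su sv.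
have r1 : `|r| <= 1 by rewrite /r ger0_norm; lra.
have sexp := sqint_exp pS.
have ew : expint gam2 X (fun p => u (Z p)) by move=> eta; have [] := expXZ_int su (sexp eta).
(* integrating over the second factor first leaves a Gaussian integral *)
have mgfE eta : mgf gam2 X (fun p => u (Z p)) eta =
    phi pS u (r *: eta) * expR (2^-1 * q eta).
  rewrite /mgf (expXZ_int su (sexp eta)).2.
  have e p : expR (dotv eta (Z p)) * u (X p) = (u p.1 * expR (dotv (r *: eta) p.1)) * expR (dotv (s *: eta) p.2).
    by rewrite /Z dotvDr !dotvZr !dotvZl expRD /X; ring.
  have ip : integ gam2 (fun p => (u p.1 * expR (dotv (r *: eta) p.1)) * expR (dotv (s *: eta) p.2)).
    have [+ _] := expXZ_int (sexp eta) su; congr (integrable _ _ _).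
    by apply/funext => p; rewrite /= e.
  under eq_Rintegral do rewrite e.
  rewrite /Rintegral -(integral12_prod_meas1 ip) /fubini_F/=.
  have iy x : (\int[gam]_y (u x * expR (dotv (r *: eta) x) * expR (dotv (s *: eta) y))%:E =
     (expR (2^-1 * q (s *: eta)))%:E * (u x * expR (dotv (r *: eta) x))%:E)%E.
    under eq_integral do rewrite EFinM.
    rewrite integralZl//; last exact: integ_gaussian_exp.
    by rewrite gaussian_mgf// muleC.
  under eq_integral do rewrite iy.
  rewrite integralZl//; last exact: eu.
  rewrite fineM//; last by apply: integrable_fin_num => //; exact: eu.
  rewrite /phi /mgf /Rintegral !quad_formZ mulrC -mulrA -expRD; congr (_ * expR _).
  by rewrite /r /s; field.
have jphi eta : jet (fun t => phi pS u (r *: (t *: eta))) (fun j => r ^+ d * hcoeff pS u eta j).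
  have := jet_scale r1 (jet_phi eta su).
  have -> : (fun j => r ^+ j * hcoeff pS u eta j) = (fun j => r ^+ d * hcoeff pS u eta j).
    by apply/funext => j; have [->//|jd] := eqVneq j d; rewrite hd// !mulr0.
  by apply: eq_jet => t; rewrite scalerA.
have jexp eta : jet (fun t => expR (2^-1 * q (t *: eta))) (sqexp_coeff (2^-1 * q eta)).
  by apply: eq_jet (jet_sqexp _) => t; rewrite quad_formZ; congr expR; ring.
have ew2 : expint gam id (fun x => r ^+ d * u x).
  by move=> eta; under eq_fun do rewrite -mulrA; apply: integZ; exact: eu.
have momE eta k : \int[gam2]_p (u (Z p) * dotv eta (X p) ^+ k) =
    \int[gam]_x (r ^+ d * u x * dotv eta x ^+ k).
  have j1 := jetM (jphi eta) (jexp eta).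
  have j1' : jet (fun t => mgf gam2 X (fun p => u (Z p)) (t *: eta))
      (cauchy_prod (fun j => r ^+ d * hcoeff pS u eta j) (sqexp_coeff (2^-1 * q eta))).
    by apply: eq_jet j1 => t; rewrite mgfE.
  have j2 := jetM (jetZ (r ^+ d) (jet_phi eta su)) (jexp eta).
  have j2' : jet (fun t => mgf gam id (fun x => r ^+ d * u x) (t *: eta))
      (cauchy_prod (fun j => r ^+ d * hcoeff pS u eta j) (sqexp_coeff (2^-1 * q eta))).
    apply: eq_jet j2 => t; rewrite /phi /mgf -!mulrA -expRD.
    rewrite mulNr addNr expR0 mulr1; under [RHS]eq_Rintegral do rewrite -mulrA.
    by rewrite RintegralZl//; exact: eu.
  have := jet_uniq (jet_mgf mX ew eta) j1' k.
  rewrite -(jet_uniq (jet_mgf (@measurable_id _ _ _) ew2 eta) j2' k).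
  by rewrite /mom => /(mulIf _); apply; rewrite invr_eq0 pnatr_eq0 -lt0n fact_gt0.
have i2 : integ gam (fun x => r ^+ d * u x * v x).
  by under eq_fun do rewrite -mulrA; apply: integZ; exact: sqintM_integ su sv.
have := moment_agree mX (@measurable_id _ _ _) ew ew2 momE sv.1 i1 i2.
rewrite /agree => ->; under eq_Rintegral do rewrite -mulrA.
by rewrite RintegralZl//; exact: sqintM_integ su sv.
Qed.

(** By exchangeability of [X] and [Z], [mehler_eigen] applied to [u] and to [v]
    gives [r ^ d * \int u v = r ^ e * \int u v]. *)
Lemma chaos_orthogonal u v d e : sqint pS u -> sqint pS v -> d != e ->
  (forall eta j, j != d -> hcoeff pS u eta j = 0) ->
  (forall eta j, j != e -> hcoeff pS v eta j = 0) ->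
  \int[gam]_x (u x * v x) = 0.
Proof.
move=> su sv de hu hv.
have := mehler_eigen su sv hu; rewrite (expXZ_int su sv).2 (mehler_eigen sv su hv).
under eq_Rintegral do rewrite mulrC.
move=> /eqP; rewrite -subr_eq0 -mulrBl mulf_eq0 subr_eq0 => /orP[|/eqP//].
have r01 : 0 < r < 1 by rewrite /r; apply/andP; split; lra.
case/andP: r01 => r0 r1 /eqP /(ieexprIn r0) h.
by move: de; rewrite h ?eqxx// lt_eqF.
Qed.
End mehler.

(** * Continuous functions on column vectors are measurable *)

(** The sigma-algebra of ['cV[R]_n] is generated by the coordinates, not by the
    open sets.  A continuous function is the limit of its values at the nodes of
    finer and finer grids, and these approximations take countably many values,
    each on a box. *)
Section continuous_cV.
Context {R : realType} {n : nat}.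

Let grid (k : nat) (x : 'cV[R]_n) : 'cV[int]_n := \col_i Num.floor (k.+1%:R * x i 0).
Let node (k : nat) (z : 'cV[int]_n) : 'cV[R]_n := \col_i ((z i 0)%:~R / k.+1%:R).

Let grid_cvg (x : 'cV[R]_n) : (fun k => node k (grid k x)) @ \oo --> x.
Proof.
apply/cvgrPdist_le => e e0; near=> k.
rewrite /Num.norm/= mx_normrE; apply: bigmax_le => [|[i j] _]; first exact: ltW.
rewrite /= (ord1 j) !mxE.
have k0 : (0 : R) < k.+1%:R by rewrite ltr0n.
have h1 := Num.Theory.floor_le_tmp (k.+1%:R * x i 0).
have h2 := Num.Theory.floorD1_gt (k.+1%:R * x i 0).
have -> : x i 0 - (Num.floor (k.+1%:R * x i 0))%:~R / k.+1%:R =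
  (k.+1%:R * x i 0 - (Num.floor (k.+1%:R * x i 0))%:~R) / k.+1%:R.
  by field; rewrite gt_eqF.
rewrite normrM normfV (gtr0_norm k0) ger0_norm ?subr_ge0//.
apply: (@le_trans _ _ k.+1%:R^-1).
  rewrite -[leRHS]mul1r ler_wpM2r ?invr_ge0 ?ltW//.
  by rewrite ltrBlDl; move: h2; rewrite intrD.
near: k; have := @cvg_harmonic R => /cvgrPdist_le /(_ e e0).
apply: filterS => k; rewrite sub0r normrN; exact: le_trans (ler_norm _).
Unshelve. all: by end_near. Qed.

Lemma continuous_measurable_cV (f : 'cV[R]_n -> R) : continuous f -> measurable_fun setT f.
Proof.
move=> cf; apply: (@measurable_fun_cvg _ _ _ _ (fun k x => f (node k (grid k x)))); last first.
  by move=> x _; apply: continuous_cvg; [exact: cf|exact: grid_cvg].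
move=> k _ Y mY; rewrite setTI.
pose F (i : nat) : set 'cV[R]_n := if unpickle i is Some z then
  (if `[< Y (f (node k z)) >] then grid k @^-1` [set z] else set0) else set0.
have -> : (fun x => f (node k (grid k x))) @^-1` Y = \bigcup_i F i.
  apply/seteqP; split => x /=.
    move=> Yx; exists (pickle (grid k x)) => //; rewrite /F pickleK.
    by rewrite asboolT.
  move=> [i _]; rewrite /F; case: unpickle => // z.
  case: asboolP => // Yz gz; have gzE : grid k x = z by exact: gz.
  by rewrite gzE.
apply: bigcupT_measurable => i; rewrite /F; case: unpickle => // z.
case: asboolP => // _.
rewrite (_ : _ @^-1` _ = \bigcap_(i in [set: 'I_n]) (@cV_coord _ R n i @^-1`
    `[(z i 0)%:~R / k.+1%:R, ((z i 0) + 1)%:~R / k.+1%:R[%classic)).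
  apply: fin_bigcap_measurable; first exact: finite_finset.
  move=> j _; rewrite -[X in measurable X]setTI; apply: measurable_cV_coord => //.
have k0 : (0 : R) < k.+1%:R by rewrite ltr0n.
apply/seteqP; split => x /=.
  move=> <- j _ /=; rewrite /cV_coord in_itv/= !mxE ler_pdivrMr// ltr_pdivlMr//.
  by rewrite mulrC Num.Theory.floor_le_tmp Num.Theory.floorD1_gt.
move=> h; apply/colP => j; rewrite mxE.
have := h j I; rewrite /= /cV_coord in_itv/= ler_pdivrMr// ltr_pdivlMr// => /andP[h1 h2].
by apply: Num.Theory.floor_def; rewrite mulrC h1 h2.
Qed.
End continuous_cV.

(** * The semigroup and the Laplace transform *)

Section semigroup_phi.
Context {R : realType} {n : nat}.
Variables (S St E : 'M[R]_n) (pS : sym_posdef S) (pSt : sym_posdef St).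
Hypothesis SE : S = St + E *m S *m E^T.
Local Notation gam := (gaussian_prob pS).
Local Notation gamt := (gaussian_prob pSt).
Local Notation q := (quad_form S).

Definition mehler_op (f : 'cV[R]_n -> R) (x : 'cV[R]_n) : R :=
  \int[gamt]_y f (E *m x - y).

Variables (f : 'cV[R]_n -> R) (M : R).
Hypotheses (mf : measurable_fun setT f) (fM : forall x, `|f x| <= M).

Let Z (p : 'cV[R]_n * 'cV[R]_n) := E *m p.1 - p.2.

Let mZ : measurable_fun setT Z.
Proof.
apply: measurable_fun_cVP => i; under eq_fun do rewrite !mxE.
apply: measurable_funB; last exact: (measurableT_comp (measurable_cV_coord i) measurable_snd).
apply: measurable_sum => j; apply: measurable_funM => //.
exact: (measurableT_comp (measurable_cV_coord j) measurable_fst).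
Qed.

Let M0 : 0 <= M. Proof. exact: le_trans (fM 0). Qed.

Lemma bounded_sqint (g : 'cV[R]_n -> R) : measurable_fun setT g ->
  (exists K, forall x, `|g x| <= K) -> sqint pS g.
Proof.
move=> mg [K gK]; split => //.
apply: (@integ_le _ _ _ _ (fun=> K ^+ 2)).
- exact: measurable_funX.
- exact: finite_measure_integrable_cst.
- move=> x; rewrite normrX lerXn2r ?nnegrE//.
  exact: le_trans (gK 0).
Qed.

Let iZ : integ (gam \x gamt)%E (fun p => f (Z p)).
Proof.
apply: (@integ_le _ _ _ _ (fun=> M)) => //; first exact: measurableT_comp.
have [+ _] := gaussian_product_exp pS pSt 0 0.
move/(integZ M); congr (integrable _ _ _); apply/funext => p.
by rewrite /= !dot0v addr0 expR0 mulr1.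
Qed.

Lemma measurable_mehler_op : measurable_fun setT (mehler_op f).
Proof.
have h := measurable_fubini_F iZ.
exact: (measurableT_comp (fine_measurable measurableT) h).
Qed.

Let if_ x : integ gamt (fun y => f (E *m x - y)).
Proof.
apply: (@integ_le _ _ _ _ (fun=> M)) => //; last exact: finite_measure_integrable_cst.
apply: measurableT_comp => //; apply: measurable_fun_cVP => i; under eq_fun do rewrite !mxE.
by apply: measurable_funB => //; exact: measurable_cV_coord.
Qed.

Lemma mehler_op_bounded x : `|mehler_op f x| <= M.
Proof.
apply: le_trans (le_normr_Rintegral measurableT (if_ x)) _.
have -> : M = \int[gamt]_y M.
  rewrite Rintegral_cst// -[LHS]mulr1; congr (_ * _).
  have h : gamt setT = 1%E by exact: probability_setT.
  exact: (esym (congr1 (@fine R) h)).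
apply: le_Rintegral => //; last exact: finite_measure_integrable_cst.
exact: integ_norm.
Qed.

Lemma sqint_mehler_op : sqint pS (mehler_op f).
Proof.
apply: bounded_sqint; first exact: measurable_mehler_op.
by exists M; exact: mehler_op_bounded.
Qed.

(** The sum [Z = E x - y] of independent Gaussians of covariances [E S E^T] and
    [St] has covariance [S] again.  Weighting by [exp <eta, x>] shifts its mean
    by [E S eta], which is the mean shift produced by the weight
    [exp <rho, z>] when [S rho = E S eta]. *)
Lemma phi_mehler_op eta :
  phi pS (mehler_op f) eta = phi pS f (invmx S *m (E *m (S *m eta))).
Proof.
set rho := invmx S *m _.
have uS := posdef_unitmx pS.
have Srho : S *m rho = E *m (S *m eta) by rewrite /rho mulKVmx.
have [K KE] : exists K, K = expR (2^-1 * q eta - 2^-1 * q rho) by eexists.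
pose w1 (p : 'cV[R]_n * 'cV[R]_n) := expR (dotv eta p.1).
(* [K] makes the two weights have the same total mass *)
pose w2 (z : 'cV[R]_n) := K * expR (dotv rho z).
have w1E xi p : w1 p * expR (dotv xi (Z p)) = expR (dotv (eta + E^T *m xi) p.1 + dotv (- xi) p.2).
  by rewrite /w1 /Z -expRD dotvDr dotvNr dotv_mulmxr dotvDl dotvNl addrA.
have w2E xi z : w2 z * expR (dotv xi z) = K * expR (dotv (rho + xi) z).
  by rewrite /w2 -mulrA -expRD dotvDl.
have ew1 : expint (gam \x gamt)%E Z w1.
  move=> xi; have [+ _] := gaussian_product_exp pS pSt (eta + E^T *m xi) (- xi).
  by congr (integrable _ _ _); apply/funext => p; rewrite /= w1E.
have ew2 : expint gam id w2.
  by move=> xi; under eq_fun do rewrite w2E; apply: integZ; exact: integ_gaussian_exp.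
have mgfE xi : mgf (gam \x gamt)%E Z w1 xi = mgf gam id w2 xi.
  rewrite /mgf; under eq_Rintegral do rewrite w1E.
  under [RHS]eq_Rintegral do rewrite w2E.
  apply: (etrans (gaussian_product_exp pS pSt (eta + E^T *m xi) (- xi)).2).
  have hR := RintegralZl K measurableT (integ_gaussian_exp pS (rho + xi)).
  apply: (etrans _ (esym hR)).
  rewrite Rintegral_gaussian_exp KE -expRD; congr expR.
  rewrite !(quad_formD pS) Srho.
  have -> : quad_form St (- xi) = quad_form St xi.
    by rewrite !quad_formE mulmxN dotvNl dotvNr opprK.
  have -> : q xi = quad_form St xi + q (E^T *m xi).
    rewrite [in LHS]SE !quad_formE mulmxDl dotvDr -!mulmxA; congr (_ + _).
    by rewrite dotv_mulmxr.
  have -> : dotv (E^T *m xi) (S *m eta) = dotv xi (E *m (S *m eta)) by rewrite [RHS]dotv_mulmxr.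
  by field.
have bf : bddmeas f by split => //; exists M.
have i1 : integ (gam \x gamt)%E (fun p => w1 p * f (Z p)) by apply: integ_bdd ew1 bf.
have i2 : integ gam (fun z => w2 z * f z) by apply: (integ_bdd (@measurable_id _ _ _) ew2 bf).
have H := mgf_agree mZ (@measurable_id _ _ _) ew1 ew2 mgfE mf i1 i2.
have -> : phi pS f rho = expR (- 2^-1 * q eta) * \int[gam]_z (w2 z * f z).
  have ifr := sqint_expint (bounded_sqint mf (ex_intro _ M fM)) rho.
  have -> : \int[gam]_z (w2 z * f z) = K * \int[gam]_z (f z * expR (dotv rho z)).
    rewrite -(RintegralZl K measurableT ifr); apply: eq_Rintegral => z _.
    by rewrite /w2 -mulrA [f z * _]mulrC.
  rewrite /phi /mgf.
  rewrite mulrA KE -expRD mulrC; congr (expR _ * _); ring.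
rewrite -H /phi mulrC; congr (_ * _).
rewrite /mgf /Rintegral -(integral12_prod_meas1 i1) /fubini_F/=; congr fine.
apply: eq_integral => x _.
rewrite mulrC EFinM.
have -> : (mehler_op f x)%:E = (\int[gamt]_y (f (E *m x - y))%:E)%E.
  by rewrite /mehler_op /Rintegral fineK//; exact: (integrable_fin_num measurableT (if_ x)).
have e := integralZl measurableT (if_ x) (expR (dotv eta x)).
apply: etrans (esym e) _; apply: eq_integral => y _.
by rewrite -EFinM.
Qed.
End semigroup_phi.

(** * Convergence in L2 and pairings *)

Definition part {R : realType} (b : bool) (z : R[i]) : R :=
  if b then complex.Im z else complex.Re z.

Section pairing.
Context {R : realType} {n : nat}.
Variables (S : 'M[R]_n) (pS : sym_posdef S).
Local Notation gam := (gaussian_prob pS).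
Implicit Types (f u v : 'cV[R]_n -> R[i]) (g : 'cV[R]_n -> R).

Lemma part_le_normc b (z : R[i]) : `|part b z| <= Normc.normc z.
Proof.
case: z => x y; rewrite /Normc.normc -sqrtr_sqr ler_sqrt ?addr_ge0 ?sqr_ge0//.
by case: b => /=; rewrite ?lerDl ?lerDr sqr_ge0.
Qed.

Lemma partB b (z z' : R[i]) : part b (z - z') = part b z - part b z'.
Proof. by case: z z' => ? ? [? ?]; case: b. Qed.

Lemma partZ b k (z : R[i]) : part b (k%:C%C * z) = k * part b z.
Proof. by case: z => ? ?; case: b => /=; ring. Qed.

Definition sqintC u := forall b, sqint pS (fun x => part b (u x)).

Lemma L2_sqintC u : L2 gam u -> sqintC u.
Proof.
move=> [u1 u2] b; split.
  by case: b; [move: u2|move: u1]; rewrite inE => /andP[]; rewrite inE.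
by case: b; exact: Lfun2_integrable_sqr.
Qed.

Lemma sqint_Lnorm g : sqint pS g -> ('N[gam]_2%:E[EFin \o g] < +oo)%E.
Proof.
move=> [mg /integrableP[_]]; rewrite unlock => ig; rewrite poweR_lty//.
apply: le_lt_trans ig; rewrite le_eqVlt; apply/orP; left; apply/eqP.
apply: eq_integral => x _; rewrite /= powR_mulrn// normrX.
by [].
Qed.

Lemma pairing_le f g b : (forall b, measurable_fun setT (fun x => part b (f x))) ->
  measurable_fun setT g ->
  (`|\int[gam]_x (part b (f x) * g x)|%:E <= L2norm gam f * 'N[gam]_2%:E[EFin \o g])%E.
Proof.
move=> mf mg.
have mn : measurable_fun setT (fun x => Normc.normc (f x)).
  rewrite (_ : (fun x => _) = fun x => Num.sqrt (part false (f x) ^+ 2 + part true (f x) ^+ 2)).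
    apply: measurableT_comp => //; first exact: continuous_measurable_fun (@sqrt_continuous R).
    by apply: measurable_funD; apply: measurable_funX; exact: mf.
  by apply/funext => x; case: (f x).
have h2 : (2^-1 + 2^-1 = 1 :> R) by field.
have := hoelder gam mn mg (ltr0Sn R 1) (ltr0Sn R 1) h2.
apply: le_trans; rewrite Lnorm1.
have hfine (x : \bar R) : (`|fine x|%:E <= `|x|)%E by case: x => //=; rewrite ?normr0 ?leey.
apply: le_trans (hfine _) _.
have mh : measurable_fun setT (fun x => (part b (f x) * g x)%:E).
  by apply/measurable_EFinP; apply: measurable_funM => //; exact: mf.
apply: le_trans (le_abse_integral gam measurableT mh) _.
apply: ge0_le_integral => //.
- exact: measurableT_comp.
- by apply: measurableT_comp => //; apply/measurable_EFinP; exact: measurable_funM.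
- move=> x _; rewrite /= lee_fin !normrM ler_wpM2r//.
  by apply: le_trans (part_le_normc b (f x)) _; exact: ler_norm.
Qed.

(** Pairing with a square-integrable function is continuous for the [L^2] norm,
    by the Hoelder inequality. *)
Lemma pairing_cvg0 (X : Type) (F : set_system X) (FF : Filter F)
   (D : X -> 'cV[R]_n -> R[i]) g b :
  (forall x b, measurable_fun setT (fun y => part b (D x y))) -> sqint pS g ->
  L2norm gam (D x) @[x --> F] --> 0%E ->
  \int[gam]_y (part b (D x y) * g y) @[x --> F] --> (0 : R).
Proof.
move=> mD sg /fine_cvgP[Dfin D0].
have gf := sqint_Lnorm sg; have g0 := Lnorm_ge0 gam 2%:E (EFin \o g).
pose K := fine 'N[gam]_2%:E[EFin \o g].
have KE : ('N[gam]_2%:E[EFin \o g] = K%:E)%E by rewrite fineK// ge0_fin_numE.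
have K0 : 0 <= K by rewrite -lee_fin -KE.
have K1 : 0 < K + 1 by rewrite ltr_wpDl.
apply/cvgr0Pnorm_le => e e0.
have eK : 0 < e / (K + 1) by rewrite divr_gt0.
move/cvgr0Pnorm_le : D0 => /(_ _ eK) D0.
near=> x.
have h := pairing_le b (mD x) sg.1.
have Dx : L2norm gam (D x) \is a fin_num by near: x.
have Dx2 : `|fine (L2norm gam (D x))| <= e / (K + 1) by near: x.
rewrite -lee_fin; apply: le_trans h _.
rewrite KE -(fineK Dx) -EFinM lee_fin.
apply: (@le_trans _ _ (e / (K + 1) * (K + 1))); last by rewrite divfK// gt_eqF.
apply: (@le_trans _ _ (e / (K + 1) * K)).
  by rewrite ler_wpM2r//; apply: le_trans Dx2; exact: ler_norm.
by rewrite ler_wpM2l ?(ltW eK)// lerDl.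
Unshelve. all: by end_near. Qed.

Lemma pairingB u v g b : sqintC u -> sqintC v -> sqint pS g ->
  \int[gam]_y (part b (u y - v y) * g y) =
  \int[gam]_y (part b (u y) * g y) - \int[gam]_y (part b (v y) * g y).
Proof.
move=> su sv sg; rewrite -RintegralB//; last 2 first.
- exact: (sqintM_integ (su b) sg).
- exact: (sqintM_integ (sv b) sg).
by apply: eq_Rintegral => y _; rewrite partB mulrBl.
Qed.

Lemma pairing_cvg (X : Type) (F : set_system X) (FF : Filter F)
   (D : X -> 'cV[R]_n -> R[i]) u g b :
  (forall x, sqintC (D x)) -> sqintC u -> sqint pS g ->
  L2norm gam (fun y => D x y - u y) @[x --> F] --> 0%E ->
  \int[gam]_y (part b (D x y) * g y) @[x --> F] --> \int[gam]_y (part b (u y) * g y).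
Proof.
move=> sD su sg cD.
have mD x b' : measurable_fun setT (fun y => part b' (D x y - u y)).
  under eq_fun do rewrite partB.
  by apply: measurable_funB; [exact: (sD x b').1|exact: (su b').1].
have := @pairing_cvg0 _ F FF (fun x y => D x y - u y) g b mD sg cD.
under eq_fun do rewrite pairingB//.
by move/cvg_sub0; apply; exact: cvg_cst.
Qed.

Lemma bounded_continuous_part (f : 'cV[R]_n -> R[i]) b : bounded_continuous f ->
  measurable_fun setT (fun x => part b (f x)) /\ exists M, forall x, `|part b (f x)| <= M.
Proof.
move=> [[M fM] c1 c2]; split.
  by apply: continuous_measurable_cV; case: b.
by exists M => x; apply: le_trans (fM x); exact: part_le_normc.
Qed.
End pairing.

(** * Hermite polynomials *)

Section hermite.
Context {R : realType} {n : nat}.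
Variables (S : 'M[R]_n) (pS : sym_posdef S).
Local Notation gam := (gaussian_prob pS).
Local Notation q := (quad_form S).
Implicit Types (w : 'cV[R]_n -> R).

(** Up to normalisation, the Hermite polynomial of degree [j] of the Gaussian
    measure, in the direction [eta]. *)
Definition herm (eta : 'cV[R]_n) (j : nat) (x : 'cV[R]_n) : R :=
  \sum_(i < j.+1) (sqexp_coeff (- 2^-1 * q eta) (j - i)%N / i`!%:R) * dotv eta x ^+ i.

Lemma sqintD w w' : sqint pS w -> sqint pS w' -> sqint pS (fun x => w x + w' x).
Proof.
move=> sw sw'; split; first by apply: measurable_funD; [exact: sw.1|exact: sw'.1].
have h : (fun x => (w x + w' x) ^+ 2) = fun x => w x ^+ 2 + (2 * (w x * w' x) + w' x ^+ 2).
  by apply/funext => x; ring.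
rewrite h; apply: integD; first exact: sw.2.
by apply: integD; [apply: integZ; exact: sqintM_integ sw sw'|exact: sw'.2].
Qed.

Lemma sqintZ k w : sqint pS w -> sqint pS (fun x => k * w x).
Proof.
move=> sw; split; first by apply: measurable_funM => //; exact: sw.1.
by under eq_fun do rewrite exprMn; apply: integZ; exact: sw.2.
Qed.

Lemma sqint_dotX eta i : sqint pS (fun x => dotv eta x ^+ i).
Proof.
split; first by apply: measurable_funX; exact: measurable_dotv.
have e1 : expint gam id (fun=> 1).
  by move=> xi; under eq_fun do rewrite mul1r; exact: integ_gaussian_exp.
have := expint_integ (expintM_dotX (@measurable_id _ _ _) eta (2 * i) e1).
congr (integrable _ _ _); apply/funext => x.
by rewrite /= mul1r mulnC exprM.
Qed.

Lemma sqint_herm eta j : sqint pS (herm eta j).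
Proof.
rewrite /herm; move: (j.+1) => m; elim: m => [|m IH].
  under eq_fun do rewrite big_ord0.
  have := sqintZ 0 (sqint_exp pS 0); by under eq_fun do rewrite mul0r.
under eq_fun do rewrite big_ord_recr/=.
apply: (@sqintD (fun x => \sum_(i < m) _) (fun x => _)) => //.
by apply: sqintZ; exact: sqint_dotX.
Qed.

Lemma hcoeffE w eta j : sqint pS w -> hcoeff pS w eta j = \int[gam]_x (w x * herm eta j x).
Proof.
move=> sw; pose c i := sqexp_coeff (- 2^-1 * q eta) (j - i)%N / i`!%:R.
have ik i : integ gam (fun x => w x * dotv eta x ^+ i) by exact: sqintM_integ sw (sqint_dotX eta i).
have [_ e] := @Rintegral_sum _ _ _ gam setT measurableT _ (index_enum 'I_j.+1)
  (fun i x => c i * (w x * dotv eta x ^+ i)) (fun i => integZ _ (ik i)).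
transitivity (\int[gam]_x (\sum_(i < j.+1) c i * (w x * dotv eta x ^+ i))).
  rewrite e /hcoeff /cauchy_prod; apply: eq_bigr => i _.
  rewrite RintegralZl//.
  rewrite /mom /c; ring.
by apply: eq_Rintegral => x _; rewrite /herm mulr_sumr; apply: eq_bigr => i _; rewrite mulrCA.
Qed.

Lemma hcoeff_lin (w1 w2 w3 : 'cV[R]_n -> R) (a c : R) eta j : sqint pS w1 -> sqint pS w2 -> sqint pS w3 ->
  hcoeff pS (fun x => w1 x - (a * w2 x + c * w3 x)) eta j =
  hcoeff pS w1 eta j - (a * hcoeff pS w2 eta j + c * hcoeff pS w3 eta j).
Proof.
move=> s1 s2 s3.
have s4 := sqintD (sqintZ a s2) (sqintZ c s3).
have s5 : sqint pS (fun x => w1 x - (a * w2 x + c * w3 x)).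
  have := sqintD s1 (sqintZ (-1) s4); congr (sqint _ _).
  by apply/funext => x; rewrite mulN1r.
have sh := sqint_herm eta j.
have i1 := sqintM_integ s1 sh; have i2 := sqintM_integ s2 sh; have i3 := sqintM_integ s3 sh.
rewrite (hcoeffE _ _ s5) (hcoeffE _ _ s1) (hcoeffE _ _ s2) (hcoeffE _ _ s3).
rewrite -(RintegralZl a measurableT i2) -(RintegralZl c measurableT i3).
have i2' := integZ a i2; have i3' := integZ c i3.
rewrite -(RintegralD measurableT i2' i3').
have i4 := integD i2' i3'.
rewrite -(RintegralB measurableT i1 i4).
by apply: eq_Rintegral => x _; ring.
Qed.

Lemma hcoeff_ae0 (w : 'cV[R]_n -> R) eta j : sqint pS w -> {ae gam, forall x, w x = 0} ->
  hcoeff pS w eta j = 0.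
Proof.
move=> sw w0; rewrite hcoeffE// /Rintegral.
rewrite (ae_eq_integral (cst 0%E))//.
- by rewrite integral0.
- by apply/measurable_EFinP; apply: measurable_funM; [exact: sw.1|exact: (sqint_herm eta j).1].
- by apply: filterS w0 => x -> _; rewrite mul0r.
Qed.
End hermite.

(** * Polynomials and their derivatives *)

Section polynomials.
Context {R : realType}.

Lemma expR_poly_derivative (c : R) (p : {poly R}) :
  t^-1 * (expR (c * t) * p.[t] - p.[0]) @[t --> 0^'+] --> c * p.[0] + p^`().[0].
Proof.
pose g : R -> R := (expR \o horner (c *: 'X)) * horner p.
have dg : is_derive (0 : R) 1 g (c * p.[0] + p^`().[0]).
  have d1 : is_derive (0 : R) 1 (expR \o horner (c *: 'X)) (expR (c *: 'X).[0] * (c *: 'X)^`().[0]).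
    by apply: is_derive1_comp.
  have d2 := is_deriveM d1 (is_derive_poly p 0); apply: (is_derive_eq d2).
  by rewrite /= derivZ derivX /GRing.scale/= !hornerE expR0 mul1r /= !mulr1 addrC mulrC.
have [dg1 dg2] := dg.
have e : (fun t => t^-1 * (expR (c * t) * p.[t] - p.[0])) =
    (fun t : R => t^-1 *: ((g \o shift 0) (t *: 1) - g 0)).
  apply/funext => t; rewrite /= /shift/= addr0 /GRing.scale/= mulr1.
  have gE x : g x = expR (c * x) * p.[x] by rewrite -[LHS]/(expR (c *: 'X).[x] * p.[x]) !hornerE.
  by rewrite !gE mulr0 expR0 mul1r.
by rewrite e -dg2; exact: cvg_dnbhs_at_right dg1.
Qed.

Lemma eq_horner (p q : {poly R}) : (forall t, p.[t] = q.[t]) -> p = q.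
Proof.
move=> pq; apply/eqP; rewrite -subr_eq0; apply/eqP.
apply: (@roots_geq_poly_eq0 _ _ [seq i%:R | i <- iota 0 (size (p - q))]).
- by apply/allP => _ /mapP[i _ ->]; rewrite rootE hornerD hornerN pq subrr.
- by rewrite map_inj_uniq ?iota_uniq// => i k /eqP; rewrite eqr_nat => /eqP.
- by rewrite size_map size_iota.
Qed.

(** The system says that [p + i q] is an eigenvector of differentiation for the
    nonzero eigenvalue [a + i c], which is absurd for degree reasons. *)
Lemma poly_deriv_system (a c : R) (p q : {poly R}) : a ^+ 2 + c ^+ 2 != 0 ->
  p^`() = a *: p - c *: q -> q^`() = a *: q + c *: p -> p = 0 /\ q = 0.
Proof.
move=> ac dp dq.
(* multiplication by the conjugate of [a + i c] expresses [p] and [q] through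
   their derivatives *)
have pE : (a ^+ 2 + c ^+ 2) *: p = a *: p^`() + c *: q^`().
  by rewrite dp dq; apply/polyP => i; rewrite !(coefD, coefZ, coefN); ring.
have qE : (a ^+ 2 + c ^+ 2) *: q = a *: q^`() - c *: p^`().
  by rewrite dp dq; apply/polyP => i; rewrite !(coefD, coefZ, coefN); ring.
have szd (r : {poly R}) m : (size r <= m.+1)%N -> (size r^`() <= m)%N.
  move=> rm; apply: leq_trans (size_poly _ _) _.
  by move: rm; case: (size r).
have szl (x y : R) (r1 r2 : {poly R}) m : (size r1 <= m)%N -> (size r2 <= m)%N ->
    (size (x *: r1 + y *: r2)%R <= m)%N.
  move=> h1 h2; apply: leq_trans (size_polyD _ _) _; rewrite geq_max.
  by rewrite (leq_trans (size_scale_leq _ _) h1) (leq_trans (size_scale_leq _ _) h2).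
have H m : (size p <= m)%N -> (size q <= m)%N -> p = 0 /\ q = 0.
  elim: m => [|m IH] sp sq.
    by move: sp sq; rewrite !leqn0 !size_poly_eq0 => /eqP-> /eqP->.
  apply: IH.
    by rewrite -(size_scale _ ac) pE; apply: szl; exact: szd.
  by rewrite -(size_scale _ ac) qE -scaleNr; apply: szl; exact: szd.
by apply: (H (maxn (size p) (size q))); [exact: leq_maxl|exact: leq_maxr].
Qed.
End polynomials.

(** * Polynomial functions of time *)

Section polyfun.
Context {R : realType}.

Definition polyfun (f : R -> R) := exists p : {poly R}, forall t, f t = p.[t].

Lemma polyfun_cst k : polyfun (fun=> k).
Proof. by exists k%:P => t; rewrite hornerC. Qed.

Lemma polyfunD f g : polyfun f -> polyfun g -> polyfun (fun t => f t + g t).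
Proof. by move=> [p pE] [p' pE']; exists (p + p') => t; rewrite pE pE' hornerD. Qed.

Lemma polyfunM f g : polyfun f -> polyfun g -> polyfun (fun t => f t * g t).
Proof. by move=> [p pE] [p' pE']; exists (p * p') => t; rewrite pE pE' hornerM. Qed.

Lemma polyfunX f k : polyfun f -> polyfun (fun t => f t ^+ k).
Proof. by move=> [p pE]; exists (p ^+ k) => t; rewrite pE horner_exp. Qed.

Lemma polyfun_id : polyfun id.
Proof. by exists 'X => t; rewrite hornerX. Qed.

Lemma polyfun_sum (I : Type) (r : seq I) (f : I -> R -> R) : (forall i, polyfun (f i)) ->
  polyfun (fun t => \sum_(i <- r) f i t).
Proof.
move=> pf; elim: r => [|i r IH]; first by under eq_fun do rewrite big_nil; exact: polyfun_cst.
by under eq_fun do rewrite big_cons; exact: polyfunD.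
Qed.

Context {n : nat} (S : 'M[R]_n) (pS : sym_posdef S) (K : nat) (al : 'I_K -> 'cV[R]_n).
Local Notation gam := (gaussian_prob pS).
Local Notation q := (quad_form S).

Definition polycurve (t : R) : 'cV[R]_n := \sum_(k < K) t ^+ k *: al k.

Lemma dotv_polycurve x t : dotv (polycurve t) x = \sum_(k < K) t ^+ k * dotv (al k) x.
Proof.
rewrite /polycurve /dotv linear_sum/= mulmx_suml summxE; apply: eq_bigr => k _.
by rewrite linearZ/= -scalemxAl mxE.
Qed.

Lemma polyfun_moment i w : expint gam id w ->
  polyfun (fun t => \int[gam]_x (w x * dotv (polycurve t) x ^+ i)).
Proof.
elim: i w => [|i IH] w ew.
  by under eq_fun do under eq_Rintegral do rewrite expr0; exact: polyfun_cst.
have ek k : expint gam id (fun x => w x * dotv (al k) x).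
  by have := expintM_dot (@measurable_id _ _ _) (al k) ew.
rewrite (_ : (fun t => _) = fun t => \sum_(k < K) t ^+ k * \int[gam]_x ((w x * dotv (al k) x) * dotv (polycurve t) x ^+ i)).
  apply: polyfun_sum => k; apply: polyfunM; last exact: IH.
  by apply: polyfunX; exact: polyfun_id.
apply/funext => t.
have ik (k : 'I_K) : integ gam (fun x => t ^+ k * (w x * dotv (al k) x * dotv (polycurve t) x ^+ i)).
  apply: integZ.
  exact: (expint_integ (expintM_dotX (@measurable_id _ _ _) (polycurve t) i (ek k))).
have [_ e] := Rintegral_sum measurableT (index_enum 'I_K) ik.
transitivity (\int[gam]_x (\sum_(k < K) t ^+ k * (w x * dotv (al k) x * dotv (polycurve t) x ^+ i))).
  apply: eq_Rintegral => x _; rewrite exprS mulrA [in X in w x * X]dotv_polycurve mulr_sumr mulr_suml.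
  by apply: eq_bigr => k _; ring.
rewrite e; apply: eq_bigr => k _; rewrite RintegralZl//.
exact: (expint_integ (expintM_dotX (@measurable_id _ _ _) (polycurve t) i (ek k))).
Qed.

Lemma polyfun_hcoeff w j : sqint pS w -> polyfun (fun t => hcoeff pS w (polycurve t) j).
Proof.
move=> sw; apply: polyfun_sum => i; apply: polyfunM.
  by apply: polyfunM; [apply: polyfun_moment; exact: sqint_expint|exact: polyfun_cst].
rewrite /sqexp_coeff; case: odd; first exact: polyfun_cst.
apply: polyfunM; last exact: polyfun_cst.
apply: polyfunX; apply: polyfunM; first exact: polyfun_cst.
under eq_fun do rewrite quad_formE dotv_polycurve.
apply: polyfun_sum => k; apply: polyfunM; first by apply: polyfunX; exact: polyfun_id.
under eq_fun do rewrite dotv_mulmxr dotvC dotv_polycurve.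
apply: polyfun_sum => l; apply: polyfunM; last exact: polyfun_cst.
by apply: polyfunX; exact: polyfun_id.
Qed.
End polyfun.

(** * The semigroup and its generator on Hermite coefficients *)

Section generator.
Context {R : realType} {n : nat}.
Variables (Q B : 'M[R]_n.+1) (lam : R).
Hypotheses (Qp : sym_posdef Q) (lam0 : lam < 0) (B0 : (B - lam%:M) ^+ n.+1 = 0).
Local Notation E t := (mexp (t *: B)).
Local Notation S := (OU_cov Q B +oo).
Let pS : sym_posdef S := OU_cov_posdef Qp lam0 B0 (ltry 0).
Local Notation gam := (gaussian_prob pS).
Implicit Types (u v w : 'cV[R]_n.+1 -> R[i]).

(** The action of the semigroup on the argument of [phi]. *)
Definition transport (t : R) (eta : 'cV[R]_n.+1) := invmx S *m (E t *m (S *m eta)).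

Lemma part_OU_sg t (t0 : (0 < t%:E)%E) b f x :
  part b (OU_sg Q B t f x) =
  mehler_op (E t) (OU_cov_posdef Qp lam0 B0 t0) (fun y => part b (f y)) x.
Proof. by case: b. Qed.

(** [phi_mehler_op] for bounded continuous functions, extended to [L^2] by
    density: for fixed [eta], [phi] is a continuous functional. *)
Lemma phi_OU_sgL2 t u v b eta : 0 < t -> OU_sgL2 Q B t u v ->
  phi pS (fun x => part b (v x)) eta = phi pS (fun x => part b (u x)) (transport t eta).
Proof.
move=> t0 [Lu Lv [f [bf cu cv]]].
have t0' : (0 < t%:E)%E by rewrite lte_fin.
have su : sqintC pS u by exact: L2_sqintC.
have sv : sqintC pS v by exact: L2_sqintC.
have sf k : sqintC pS (f k).
  by move=> b'; have [mf fM] := bounded_continuous_part b' (bf k); exact: bounded_sqint.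
have sh k : sqintC pS (OU_sg Q B t (f k)).
  move=> b'; have [mf [M fM]] := bounded_continuous_part b' (bf k).
  under eq_fun do rewrite (part_OU_sg t0').
  exact: sqint_mehler_op fM.
have h1 := pairing_cvg (b := b) _ sh sv (sqint_exp pS eta) cv.
have h2 := pairing_cvg (b := b) _ sf su (sqint_exp pS (transport t eta)) cu.
have h (k : nat) : phi pS (fun x => part b (OU_sg Q B t (f k) x)) eta =
    phi pS (fun x => part b (f k x)) (transport t eta).
  have [mf [M fM]] := bounded_continuous_part b (bf k).
  under [X in phi _ X]eq_fun do rewrite (part_OU_sg t0').
  have SE := OU_cov_invariant Q lam0 B0 (ltW t0).
  have H := phi_mehler_op pS (OU_cov_posdef Qp lam0 B0 t0') SE mf fM.
  exact: H.
have l1 : phi pS (fun x => part b (OU_sg Q B t (f k) x)) eta @[k --> \oo] -->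
   phi pS (fun x => part b (v x)) eta.
  by apply: cvgMl; exact: h1.
have l2 : phi pS (fun x => part b (f k x)) (transport t eta) @[k --> \oo] -->
   phi pS (fun x => part b (u x)) (transport t eta).
  by apply: cvgMl; exact: h2.
move: l1; under eq_fun do rewrite h.
by move/(cvg_unique _ l2) => ->.
Qed.

Lemma transportZ t s eta : transport t (s *: eta) = s *: transport t eta.
Proof. by rewrite /transport -!scalemxAr. Qed.

Lemma hcoeff_OU_sgL2 t u v b eta j : 0 < t -> OU_sgL2 Q B t u v ->
  hcoeff pS (fun x => part b (v x)) eta j =
  hcoeff pS (fun x => part b (u x)) (transport t eta) j.
Proof.
move=> t0 uv; have [Lu Lv _] := uv.
have ju := jet_phi (transport t eta) (L2_sqintC (pS := pS) Lu b).
have jv := jet_phi eta (L2_sqintC (pS := pS) Lv b).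
apply: (jet_uniq jv); apply: eq_jet ju => s.
by rewrite (phi_OU_sgL2 _ _ t0 uv) transportZ.
Qed.

(** A coefficient is the pairing with a Hermite polynomial, hence continuous in
    [L^2], so that the difference quotients of the semigroup may be computed on
    coefficients. *)
Lemma hcoeff_OU_op u w b eta j : OU_op Q B u w ->
  t^-1 * (hcoeff pS (fun x => part b (u x)) (transport t eta) j -
          hcoeff pS (fun x => part b (u x)) eta j) @[t --> 0^'+] -->
  hcoeff pS (fun x => part b (w x)) eta j.
Proof.
move=> [Lu Lw [h [uh ch]]].
have su : sqintC pS u by exact: L2_sqintC.
have sw : sqintC pS w by exact: L2_sqintC.
(* [h t] is only known to be square-integrable for positive [t] *)
pose h' t := if 0 < t then h t else u.
have sh t : sqintC pS (h' t).
  by rewrite /h'; case: ifP => // t0; have [_ Lh _] := uh _ t0; exact: L2_sqintC.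
have nt : \forall t \near (0 : R)^'+, h' t = h t.
  by near=> t; rewrite /h' ifT.
have ch' : L2norm gam (fun x => t^-1%:C%C * (h' t x - u x) - w x) @[t --> 0^'+] --> 0%E.
  apply: cvg_trans ch; apply: near_eq_cvg.
  by apply: filterS nt => t ->.
have mD (t : R) b' : measurable_fun setT (fun x => part b' (t^-1%:C%C * (h' t x - u x) - w x)).
  under eq_fun do rewrite partB partZ partB.
  apply: measurable_funB; last exact: (sw b').1.
  apply: measurable_funM => //.
  by apply: measurable_funB; [exact: (sh t b').1|exact: (su b').1].
have FF : Filter (0 : R)^'+ by typeclasses eauto.
have c0 := pairing_cvg0 FF b mD (sqint_herm pS eta j) ch'.
have e (t : R) : \int[gam]_y (part b (t^-1%:C%C * (h' t y - u y) - w y) * herm S eta j y) =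
  t^-1 * (hcoeff pS (fun x => part b (h' t x)) eta j - hcoeff pS (fun x => part b (u x)) eta j)
   - hcoeff pS (fun x => part b (w x)) eta j.
  rewrite (hcoeffE _ _ (sh t b)) (hcoeffE _ _ (su b)) (hcoeffE _ _ (sw b)).
  have i1 := sqintM_integ (sh t b) (sqint_herm pS eta j).
  have i2 := sqintM_integ (su b) (sqint_herm pS eta j).
  have i3 := sqintM_integ (sw b) (sqint_herm pS eta j).
  rewrite -(RintegralB measurableT i1 i2).
  have i4 := integB i1 i2.
  rewrite -(RintegralZl t^-1 measurableT i4).
  have i5 := integZ t^-1 i4.
  rewrite -(RintegralB measurableT i5 i3).
  by apply: eq_Rintegral => y _; rewrite partB partZ partB; ring.
apply: cvg_zero.
apply: cvg_trans c0; apply: near_eq_cvg.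
near=> t; rewrite e; congr (_ * (_ - _) - _).
have t0 : 0 < t by [].
have -> : h' t = h t by near: t.
by rewrite (hcoeff_OU_sgL2 _ _ _ t0 (uh t t0)).
Unshelve. all: by end_near. Qed.

Local Notation M := (B - lam%:M).

(** The polynomial part of [transport]. *)
Definition nil_transport (t : R) (eta : 'cV[R]_n.+1) := invmx S *m (nilexp M t *m (S *m eta)).

Lemma transportE t eta : transport t eta = expR (lam * t) *: nil_transport t eta.
Proof. by rewrite /transport (mexpE B0) -scalemxAl -scalemxAr. Qed.

Lemma nil_transportD s t eta : nil_transport (s + t) eta = nil_transport s (nil_transport t eta).
Proof.
rewrite /nil_transport (nilexpD _ _ B0).
by rewrite mulKVmx ?(posdef_unitmx pS)// !mulmxA.
Qed.

Lemma nil_transport0 eta : nil_transport 0 eta = eta.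
Proof. by rewrite /nil_transport nilexp0 mul1mx mulKmx// (posdef_unitmx pS). Qed.

Lemma hcoeff_nil_transport (w : 'cV[R]_n.+1 -> R) eta j : sqint pS w ->
  exists p : {poly R}, forall t, hcoeff pS w (nil_transport t eta) j = p.[t].
Proof.
move=> sw.
have [p pE] := polyfun_hcoeff
  (fun k : 'I_n.+1 => k`!%:R^-1 *: (invmx S *m (M ^+ k *m (S *m eta)))) j sw.
exists p => t; rewrite -pE; congr hcoeff.
rewrite /nil_transport /nilexp /polycurve mulmx_suml mulmx_sumr; apply: eq_bigr => k _.
by rewrite -scalemxAl -scalemxAr scalerA.
Qed.

Lemma hcoeff_transport (w : 'cV[R]_n.+1 -> R) eta j (p : {poly R}) t : sqint pS w -> 0 <= t ->
  (forall s, hcoeff pS w (nil_transport s eta) j = p.[s]) ->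
  hcoeff pS w (transport t eta) j = expR (j%:R * lam * t) * p.[t].
Proof.
move=> sw t0 pE; rewrite transportE hcoeffZ// ?pE -?expRM_natl ?mulrA//.
by rewrite ger0_norm ?expR_ge0// -expR0 ler_expR mulr_le0_ge0// ltW.
Qed.

(** By the group law [nil_transportD] it is enough to differentiate at time
    [0], where [transport] contributes the factor [exp (j lam t)] and the
    derivative of [p]. *)
Lemma hcoeff_poly_OU_op u w b eta j (p r : {poly R}) : OU_op Q B u w ->
  (forall s, hcoeff pS (fun x => part b (u x)) (nil_transport s eta) j = p.[s]) ->
  (forall s, hcoeff pS (fun x => part b (w x)) (nil_transport s eta) j = r.[s]) ->
  r = (j%:R * lam) *: p + p^`().
Proof.
move=> uw pE rE; have [Lu Lw _] := uw.
have su := L2_sqintC (pS := pS) Lu b.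
apply: eq_horner => s; rewrite -rE hornerD hornerZ.
have h := @hcoeff_OU_op u w b (nil_transport s eta) j uw.
pose ps := p \Po ('X + s%:P).
have psE t : hcoeff pS (fun x => part b (u x)) (nil_transport t (nil_transport s eta)) j = ps.[t].
  by rewrite -nil_transportD pE horner_comp hornerD hornerX hornerC.
have ps0 : p.[s] = ps.[0] by rewrite horner_comp hornerD hornerX hornerC add0r.
have dps0 : p^`().[s] = ps^`().[0].
  by rewrite deriv_comp hornerM horner_comp derivD derivX derivC !hornerE.
rewrite ps0 dps0; apply: (cvg_unique (@Rhausdorff R) h) => /=.
have H := @expR_poly_derivative R (j%:R * lam) ps.
apply: (cvg_trans _ H); apply: near_eq_cvg.
near=> t; have t0 : 0 < t by [].
by rewrite (hcoeff_transport su (ltW t0) psE) pE ps0.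
Unshelve. all: by end_near. Qed.

(** Induction on [k]: if the coefficients of [(L - mu) u] vanish then the
    polynomials [p0], [p1] of the real and imaginary parts of [u] satisfy
    [(p0 + i p1)^`() = (mu - j lam) (p0 + i p1)]. *)
Lemma hcoeff_eigen mu k u j : OU_shift_pow Q B mu k u (fun=> 0) -> (j%:R * lam)%:C%C != mu ->
  forall b eta, hcoeff pS (fun x => part b (u x)) eta j = 0.
Proof.
move=> + jmu; elim: k u => [|k IH] u.
  move=> [Lu _ u0] b eta; apply: hcoeff_ae0; first exact: (L2_sqintC (pS := pS) Lu b).
  by apply: filterS u0 => x ->; case: b.
move=> [v uv /IH{}IH] b eta; have [Lu Lv _] := uv.
have su := L2_sqintC (pS := pS) Lu; have sv := L2_sqintC (pS := pS) Lv.
have [p0 p0E] := hcoeff_nil_transport eta j (su false).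
have [p1 p1E] := hcoeff_nil_transport eta j (su true).
have [r0 r0E] := hcoeff_nil_transport eta j (sv false).
have [r1 r1E] := hcoeff_nil_transport eta j (sv true).
have d0 := hcoeff_poly_OU_op uv p0E r0E.
have d1 := hcoeff_poly_OU_op uv p1E r1E.
set a := complex.Re mu; set c := complex.Im mu.
have e0 : r0 = a *: p0 - c *: p1.
  apply: eq_horner => s; rewrite !hornerE -p0E -p1E -r0E; apply/eqP; rewrite -subr_eq0 -mulNr.
  rewrite -(hcoeff_lin _ _ _ _ (sv false) (su false) (su true)); apply/eqP.
  rewrite -(IH false (nil_transport s eta)); congr hcoeff.
  by apply/funext => x; rewrite /a /c; case: (mu) (u x) (v x) => ? ? [? ?] [? ?] /=; ring.
have e1 : r1 = a *: p1 + c *: p0.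
  apply: eq_horner => s; rewrite !hornerE -p0E -p1E -r1E; apply/eqP; rewrite -subr_eq0.
  rewrite -(hcoeff_lin _ _ _ _ (sv true) (su true) (su false)); apply/eqP.
  rewrite -(IH true (nil_transport s eta)); congr hcoeff.
  by apply/funext => x; rewrite /a /c; case: (mu) (u x) (v x) => ? ? [? ?] [? ?] /=; ring.
have ac : (a - j%:R * lam) ^+ 2 + c ^+ 2 != 0.
  rewrite paddr_eq0 ?sqr_ge0// !sqrf_eq0 subr_eq0.
  apply: contra jmu => /andP[/eqP aE /eqP c0].
  by apply/eqP; move: aE c0; rewrite /a /c; case: (mu) => ? ? /= -> ->.
have [] := @poly_deriv_system R (a - j%:R * lam) c p0 p1 ac.
- by move: d0; rewrite e0 scalerBl => d0; rewrite addrAC d0 [X in X - _]addrC addrK.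
- by move: d1; rewrite e1 scalerBl => d1; rewrite addrAC d1 [X in X - _]addrC addrK.
move=> p00 p10; rewrite -(nil_transport0 eta).
by case: b; rewrite ?p0E ?p1E ?p00 ?p10 horner0.
Qed.

End generator.

(** * Orthogonality *)

Section orthogonality.
Context {R : realType} {n : nat}.
Variables (S : 'M[R]_n) (pS : sym_posdef S).
Local Notation gam := (gaussian_prob pS).

Lemma L2dot_orthogonal (u v : 'cV[R]_n -> R[i]) : sqintC pS u -> sqintC pS v ->
  (forall b b', \int[gam]_x (part b (u x) * part b' (v x)) = 0) -> L2dot gam u v = 0.
Proof.
move=> su sv uv.
have i b b' := sqintM_integ (su b) (sv b').
rewrite /L2dot /cintegral.
have -> : \int[gam]_x complex.Re (u x * conjc (v x)) = 0.
  transitivity (\int[gam]_x (part false (u x) * part false (v x) + part true (u x) * part true (v x))).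
    by apply: eq_Rintegral => x _; case: (u x) (v x) => ? ? [? ?] /=; ring.
  by rewrite (RintegralD measurableT (i _ _) (i _ _)) !uv addr0.
have -> : \int[gam]_x complex.Im (u x * conjc (v x)) = 0.
  transitivity (\int[gam]_x (part true (u x) * part false (v x) - part false (u x) * part true (v x))).
    by apply: eq_Rintegral => x _; case: (u x) (v x) => ? ? [? ?] /=; ring.
  by rewrite (RintegralB measurableT (i _ _) (i _ _)) !uv subr0.
by [].
Qed.

(** At most one degree [j] satisfies [j lam = mu].  If none does, any degree is
    acceptable for [mu], and it can be chosen different from the other one. *)
Lemma distinct_degrees (lam : R) (mu nu : R[i]) : lam < 0 -> mu != nu ->
  exists d e : nat, [/\ d != e, forall j, j != d -> (j%:R * lam)%:C%C != mu &
    forall j, j != e -> (j%:R * lam)%:C%C != nu].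
Proof.
move=> lam0 munu.
have inj (i j : nat) : (i%:R * lam)%:C%C = (j%:R * lam)%:C%C -> i = j.
  move=> [] /(mulIf (ltr0_neq0 lam0)) /eqP; by rewrite eqr_nat => /eqP.
have none (z : R[i]) : ~ (exists d : nat, (d%:R * lam)%:C%C = z) ->
    forall j : nat, (j%:R * lam)%:C%C != z.
  by move=> h j; apply/eqP => e; apply: h; exists j.
have some (d : nat) (z : R[i]) : (d%:R * lam)%:C%C = z ->
    forall j : nat, j != d -> (j%:R * lam)%:C%C != z.
  by move=> <- j; apply: contra_neq => /inj.
have [[d dE]|/none hmu] := pselect (exists d : nat, (d%:R * lam)%:C%C = mu).
  have [[e eE]|/none hnu] := pselect (exists e : nat, (e%:R * lam)%:C%C = nu).
    exists d, e; split; [|exact: some|exact: some].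
    by apply: contra_neq munu => de; rewrite -dE -eE de.
  by exists d, d.+1; split => //; [rewrite neq_ltn leqnn|exact: some].
have [[e eE]|/none hnu] := pselect (exists e : nat, (e%:R * lam)%:C%C = nu).
  by exists e.+1, e; split => //; [rewrite neq_ltn leqnn orbT|exact: some].
by exists 0%N, 1%N.
Qed.

End orthogonality.

Theorem proposition3p1 (R : realType) (N : nat) (Q B : 'M[R]_N)
    (N_gt0 : (0 < N)%N) (Q_sym_posdef : sym_posdef Q)
    (B_stable : forall z : R[i], ceigenvalue B z -> complex.Re z < 0)
    (B_single : exists l : R[i], forall z : R[i], ceigenvalue B z <-> z = l)
    (u v : 'cV[R]_N -> R[i]) (mu nu : R[i]) :
  OU_gen_eigenfun Q B mu u -> OU_gen_eigenfun Q B nu v -> mu <> nu ->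
  L2dot (OU_gauss Q B +oo%E) u v = 0.
Proof.
case: N N_gt0 Q B Q_sym_posdef B_stable B_single u v => // n _ Q B Qp B_stable B_single u v.
move=> [Lu _ [k _ hu]] [Lv _ [m _ hv]] /eqP munu.
have [lam lam0 B0] := single_eigenvalue_nilpotent B_stable B_single.
have [d [e [de hd he]]] := distinct_degrees lam0 munu.
pose pS := OU_cov_posdef Qp lam0 B0 (ltry 0).
have su := L2_sqintC (pS := pS) Lu; have sv := L2_sqintC (pS := pS) Lv.
apply: (L2dot_orthogonal su sv) => b b'.
apply: (chaos_orthogonal (su b) (sv b') de).
- by move=> eta j jd; exact: (hcoeff_eigen Qp lam0 B0 hu (hd j jd)).
- by move=> eta j je; exact: (hcoeff_eigen Qp lam0 B0 hv (he j je)).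
Qed.
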